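(* Let $0 \in E \subset \mathbb{R}^d$ be compact such that $E \subset \mathrm{int}(\lambda E)$ for all $\lambda > 1$. Let $(t_n)_{n \in \mathbb{N}} \subset \mathbb{R}^d$ be such that $(f_n)_{n \in \mathbb{N}}$, defined by $f_n(x) = e^{i \langle x , t_n \rangle}$, is a frame for $L_2(E)$, with frame operator $S$. Let $\lambda_0 > 1$ and let $g$ be such that $\mathcal{F}^{-1}(g):\mathbb{R}^d \rightarrow \mathbb{R}$ is a $C^\infty$ function with $\mathcal{F}^{-1}(g)|_{E} = 1$ and $\mathcal{F}^{-1}(g)|_{(\lambda_0 E)^c} = 0$. Put $B_{kn} = \langle S^{-1}f_n , S^{-1}f_k \rangle_{L_2(E)}$ for $k,n \in \mathbb{N}$. If $\lambda \geq \lambda_0$ and $f \in PW_E$, then $$f(t) = \frac{1}{\lambda^d}\sum_{k \in \mathbb{N}} \Big( \sum_{n \in \mathbb{N}} B_{kn}\, f\big( \tfrac{t_n}{\lambda} \big) \Big)\, g\big(t-\tfrac{t_k}{\lambda}\big), \qquad t \in \mathbb{R}^d,$$ where the sum over $k$ converges in $L_2(\mathbb{R}^d)$, and also uniformly on $\mathbb{R}^d$. Further, the map $B:\ell_2(\mathbb{N}) \rightarrow \ell_2(\mathbb{N})$ defined by $(y_k)_{k \in \mathbb{N}} \mapsto \big( \sum_{n \in \mathbb{N}} B_{kn} y_n \big)_{k \in \mathbb{N}}$ is bounded and linear, and it is an onto isomorphism if and only if $(f_n)_{n \in \mathbb{N}}$ is a Riesz basis for $L_2(E)$.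
   Context: Fourier transform on $L_2(\mathbb{R}^d)$: $\mathcal{F}(f)(\cdot) = \int_{\mathbb{R}^d} f(\xi)e^{-i \langle \cdot , \xi \rangle}\, d\xi$, with inverse $\mathcal{F}^{-1}(f)(\cdot) = \frac{1}{(2\pi)^d}\int_{\mathbb{R}^d} f(\xi)e^{i \langle \cdot , \xi \rangle}\, d\xi$ (integrals understood as $L_2$ limits). For a bounded measurable set $E$ of positive measure, $PW_E = \{f \in L_2(\mathbb{R}^d) : \mathrm{supp}(\mathcal{F}^{-1}(f)) \subset E\}$; elements of $PW_E$ (and $g$) are identified with their continuous representatives. $A^c$ denotes the complement of $A$ in $\mathbb{R}^d$, and $\lambda E=\{\lambda x: x\in E\}$. A frame for a separable Hilbert space $H$ is a sequence $(f_n)_n \subset H$ such that for some $0<A<B$, $A\|f\|^2 \leq \sum_n |\langle f, f_n\rangle|^2 \leq B\|f\|^2$ for all $f \in H$. Its frame operator is $Sf = \sum_n \langle f, f_n\rangle f_n$, a positive self-adjoint onto isomorphism of $H$. Given an orthonormal basis $(e_n)_n$ of $H$, a sequence $(f_n)_n\subset H$ is a Riesz basis for $H$ if the map $Le_n = f_n$ is (extends to) an onto isomorphism $H\to H$. Inner products are linear in the first variable. *)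

(* Defs.v *)
From HB Require Import structures.
From mathcomp Require Import all_boot all_order all_algebra.
From mathcomp Require Import all_classical all_reals all_analysis.
From mathcomp Require Import complex.
Set Implicit Arguments.
Unset Strict Implicit.
Unset Printing Implicit Defensive.
Import Order.TTheory GRing.Theory Num.Theory.
Import numFieldNormedType.Exports.
Local Open Scope classical_set_scope.
Local Open Scope ring_scope.

(* R^d carries the product (= Borel) sigma-algebra, generated by the
   coordinates, as the library does for [d.-tuple R]. *)
Section measurable_rV.
Variables (R : realType) (d : nat).

Let coords : 'I_d -> 'rV[R]_d -> measurableTypeR R := fun i x => x ord0 i.

Let rV_set0 : g_sigma_preimage coords set0.
Proof. exact: sigma_algebra0. Qed.

Let rV_setC A : g_sigma_preimage coords A -> g_sigma_preimage coords (~` A).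
Proof. exact: sigma_algebraC. Qed.

Let rV_bigcup (F : _^nat) : (forall i, g_sigma_preimage coords (F i)) ->
  g_sigma_preimage coords (\bigcup_i (F i)).
Proof. exact: sigma_algebra_bigcup. Qed.

HB.instance Definition _ :=
  @isMeasurable.Build (measure_tuple_display default_measure_display)
    'rV[R]_d (g_sigma_preimage coords) rV_set0 rV_setC rV_bigcup.

End measurable_rV.

Section lebesgue_rV.
Variable R : realType.

Definition rV_snoc (d : nat) (p : 'rV[R]_d * measurableTypeR R) : 'rV[R]_d.+1 :=
  \row_(i < d.+1) if unlift ord_max i is Some j then p.1 ord0 j else p.2.

Lemma measurable_coord (d : nat) (i : 'I_d) :
  measurable_fun [set: 'rV[R]_d] (fun x => x ord0 i : measurableTypeR R).
Proof.
move=> _ Y mY; rewrite setTI; apply: sub_sigma_algebra => /=.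
rewrite -bigcup_seq/=; exists i => /=; first by rewrite mem_index_enum.
by exists Y => //; rewrite setTI.
Qed.

Lemma measurable_rV_snoc (d : nat) : measurable_fun setT (@rV_snoc d).
Proof.
move=> _ Y mY; rewrite setTI.
suff : g_sigma_preimage (fun (i : 'I_d.+1) (x : 'rV[R]_d.+1) =>
    x ord0 i : measurableTypeR R) `<=` [set A | measurable (@rV_snoc d @^-1` A)].
  exact.
apply: smallest_sub.
  split => /=.
  - by rewrite preimage_set0.
  - by move=> A mA; rewrite setTD preimage_setC; exact: measurableC.
  - by move=> F mF; rewrite preimage_bigcup; exact: bigcup_measurable.
rewrite -bigcup_seq => _ [i _ [B mB <-]] /=; rewrite setTI.
rewrite -comp_preimage.
have -> : (fun x : 'rV[R]_d.+1 => x ord0 i) \o @rV_snoc d =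
    (fun p => if unlift ord_max i is Some j then p.1 ord0 j else p.2).
  by apply/funext => p; rewrite /= mxE.
rewrite -[X in measurable X]setTI.
case: (unlift ord_max i) => [j|].
  by apply: (measurableT_comp (@measurable_coord d j)) => //; exact: measurable_fst.
exact: measurable_snd.
Qed.

Definition lebesgue_snoc (d : nat) (m : {measure set 'rV[R]_d -> \bar R}) :
    set 'rV[R]_d.+1 -> \bar R :=
  pushforward (m \x (@lebesgue_measure R))%E (@rV_snoc d).

HB.instance Definition _ (d : nat) (m : {measure set 'rV[R]_d -> \bar R}) :=
  Measure.copy (lebesgue_snoc m)
    (measure_function_pushforward__canonical__measure_function_Measure
      _ (measurable_rV_snoc (d := d))).

Fixpoint lebesgue_rV (d : nat) : {measure set 'rV[R]_d -> \bar R} :=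
  match d with
  | 0 => \d_ (0 : 'rV[R]_0)
  | n.+1 => lebesgue_snoc (lebesgue_rV n)
  end.

Lemma lebesgue_rV_box (d : nat) (A : 'I_d -> set (measurableTypeR R)) :
  (forall i, measurable (A i)) ->
  (lebesgue_rV d [set x | forall i, A i (x ord0 i)] =
   \prod_(i < d) lebesgue_measure (A i))%E.
Proof.
elim: d A => [|d IH] A mA; first by rewrite big_ord0 /= diracE mem_set // => -[].
rewrite big_ord_recr /= /lebesgue_snoc /pushforward -IH //.
rewrite -product_measure1E //.
  congr (_ _); apply/seteqP; split => -[x y] /=.
    move=> H; split=> /= [i|]; last by have := H ord_max; rewrite mxE unlift_none.
    have := H (lift ord_max i); rewrite mxE liftK; congr (A _ _).
    by apply/val_inj; rewrite /= /bump leqNgt ltn_ord.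
  move=> [H1 H2] i; rewrite mxE; case: unliftP => [j ->|->] //=.
  have := H1 j; congr (A _ _).
  by apply/val_inj; rewrite /= /bump leqNgt ltn_ord.
match goal with |- measurable ?X =>
  have -> : X = \bigcap_(i in [set: 'I_d]) ((fun x : 'rV[R]_d =>
    x ord0 i : measurableTypeR R) @^-1` A (widen_ord (leqnSn d) i))
end.
  by apply/seteqP; split => x /= H i; [move=> _; exact: H|exact: (H i I)].
apply: fin_bigcap_measurable => // i _; rewrite -[X in measurable X]setTI.
by apply: measurable_coord.
Qed.

End lebesgue_rV.

(* A Hilbert space of (classes of) functions [T -> R[i]] is given by its set of
   representatives and its inner product; [u] and [v] represent the same
   element when [hnorm (u - v) = 0].  For L_2(E) this is equality a.e. on E. *)
Record hspace (R : realType) (T : Type) := HSpace {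
  hset : set (T -> R[i]) ;
  hdot : (T -> R[i]) -> (T -> R[i]) -> R[i] }.

Section hilbert.
Variables (R : realType) (T : Type) (H : hspace R T).
Implicit Types (u v w : T -> R[i]) (e f : nat -> T -> R[i]).
Implicit Types L : (T -> R[i]) -> T -> R[i].

Definition hnorm u : R := Num.sqrt (complex.Re (hdot H u u)).

Definition heq u v : Prop := hnorm (u \- v) = 0.

Definition hcvg (u_ : nat -> T -> R[i]) v : Prop :=
  [/\ forall n, hset H (u_ n), hset H v & hnorm (u_ n \- v) @[n --> \oo] --> 0].

Definition hexpansion e f u (N : nat) : T -> R[i] :=
  fun x => \sum_(n < N) hdot H u (e n) * f n x.

Definition is_frame f : Prop :=
  (forall n, hset H (f n)) /\
  exists A B : R, [/\ 0 < A, A < B & forall u, hset H u ->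
    ((A * hnorm u ^+ 2)%:E
       <= \sum_(0 <= n <oo) (Normc.normc (hdot H u (f n)) ^+ 2)%:E
       <= (B * hnorm u ^+ 2)%:E)%E].

(* The graph of the frame operator S of [f]: [v] represents [S u]. *)
Definition frame_op f u v : Prop := hset H u /\ hcvg (hexpansion f f u) v.

(* A representative of [S^-1 v], unique up to [heq] when [f] is a frame. *)
Definition frame_op_inv f v : T -> R[i] := xget (fun=> 0) [set u | frame_op f u v].

Definition is_orthonormal_basis e : Prop :=
  [/\ forall n, hset H (e n),
      forall m n, hdot H (e m) (e n) = (m == n)%:R &
      forall u, hset H u -> hcvg (hexpansion e e u) u].

Definition is_bounded_linear L : Prop :=
  [/\ forall u, hset H u -> hset H (L u),
      forall (a : R[i]) u v, hset H u -> hset H v ->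
        heq (L (fun x => a * u x + v x)) (fun x => a * L u x + L v x) &
      exists M : R, forall u, hset H u -> hnorm (L u) <= M * hnorm u].

Definition is_onto_isomorphism L : Prop :=
  is_bounded_linear L /\ exists L', [/\ is_bounded_linear L',
    forall u, hset H u -> heq (L' (L u)) u &
    forall u, hset H u -> heq (L (L' u)) u].

(* The notion does not depend on the orthonormal basis [e]. *)
Definition is_riesz_basis f : Prop :=
  (forall n, hset H (f n)) /\
  exists e L, [/\ is_orthonormal_basis e, is_onto_isomorphism L &
                  forall n, heq (L (e n)) (f n)].

End hilbert.

Section concrete_spaces.
Variable R : realType.

Definition cRintegral (d : nat) (D : set 'rV[R]_d) (f : 'rV[R]_d -> R[i]) : R[i] :=
  ((\int[lebesgue_rV R d]_(x in D) complex.Re (f x)) +i*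
   (\int[lebesgue_rV R d]_(x in D) complex.Im (f x)))%C.

Definition L2 (d : nat) (E : set 'rV[R]_d) : hspace R 'rV[R]_d := HSpace
  [set u | [/\ measurable_fun E (fun x => complex.Re (u x) : measurableTypeR R),
               measurable_fun E (fun x => complex.Im (u x) : measurableTypeR R) &
               (\int[lebesgue_rV R d]_(x in E) (Normc.normc (u x) ^+ 2)%:E < +oo)%E]]
  (fun u v => cRintegral E (fun x => u x * ((v x)^*)%C)).

(* The regular module [R[i]^o] carries the topology of the complex plane. *)
Definition summable_series (u : nat -> R[i]) : Prop :=
  cvgn (series (u : nat -> R[i]^o)).

Definition csum (u : nat -> R[i]) : R[i] := limn (series (u : nat -> R[i]^o)).

Definition l2 : hspace R nat := HSpace
  [set y | (\sum_(0 <= k <oo) (Normc.normc (y k) ^+ 2)%:E < +oo)%E]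
  (fun y z => csum (fun k => y k * ((z k)^*)%C)).

End concrete_spaces.

Section fourier.
Variables (R : realType) (d : nat).
Implicit Types (E : set 'rV[R]_d) (f h : 'rV[R]_d -> R[i]) (G : 'rV[R]_d -> R).

Definition dotv (x y : 'rV[R]_d) : R := \sum_(i < d) x ord0 i * y ord0 i.

Definition expi (a : R) : R[i] := (cos a +i* sin a)%C.

(* The norm of ['rV[R]_d] is the sup norm, so the domain is the cube [-N, N]^d. *)
Definition inv_fourier_trunc (N : nat) f : 'rV[R]_d -> R[i] := fun x =>
  (((2 * pi) ^+ d)^-1)%:C%C *
  cRintegral [set xi | `|xi| <= N%:R] (fun xi => f xi * expi (dotv x xi)).

(* [h] represents the inverse Fourier transform of [f] in L_2(R^d). *)
Definition is_inv_fourier f h : Prop :=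
  hset (L2 setT) f /\ hcvg (L2 setT) (fun N => inv_fourier_trunc N f) h.

(* Elements of PW_E are given by their continuous representatives; the support
   of an L_2 class lies in E when the class vanishes a.e. outside E. *)
Definition PW E : set ('rV[R]_d -> R[i]) := [set f |
  continuous (f : 'rV[R]_d -> R[i]^o) /\
  exists h, is_inv_fourier f h /\
            {ae lebesgue_rV R d, forall xi, ~ E xi -> h xi = 0}].

Fixpoint partials (s : seq 'I_d) G : 'rV[R]_d -> R :=
  if s is i :: s' then 'D_(delta_mx ord0 i) (partials s' G) else G.

Definition smooth G : Prop := forall s : seq 'I_d,
  continuous (partials s G) /\
  forall (i : 'I_d) x, derivable (partials s G) x (delta_mx ord0 i).

Definition dilate (a : R) E : set 'rV[R]_d := [set a *: x | x in E].

End fourier.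

(* Main.v *)
(** The Gram matrix [B] of the dual frame is [U S^-2 U^*], where [U u] is the
    sequence of the [<u, f_n>] and [S = U^* U].  Hence [B (U u) = U (S^-1 u)]:
    [B] turns the samples of [u] into the coefficients of its frame expansion
    [u = sum_k <S^-1 u, f_k> f_k].  If [h], the inverse Fourier transform of [f],
    lives on [E], then [f(t_n / lambda) = <H, f_n>] with
    [H(eta) = lambda^d h(lambda eta)].  Dilating the expansion of [H] and
    multiplying it by [G], which is [1] on [E] and [0] off [lambda E], gives an
    expansion of [h] that converges in [L_2]; the supports being bounded, it also
    converges in [L_1].  The Fourier transform carries these into [L_2] and
    uniform convergence of the sampling series.

    Of Fourier analysis this only requires Plancherel's inequality up to a
    constant and the inversion formula for [h] with bounded support.  Both follow
    by Fubini from the Fejer kernel, whose Fourier transform is a triangle.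

    [B] is an isomorphism iff [U^*] is injective.  In that case Gram-Schmidt
    turns [(f_n)] into an orthonormal basis [(e_n)], and [e_n |-> f_n] is an
    isomorphism. *)
From HB Require Import structures.
Require Import Defs.
From mathcomp Require Import all_boot all_order all_algebra.
From mathcomp Require Import all_classical all_reals all_analysis.
From mathcomp Require Import complex.
From mathcomp Require Import measurable_realfun.
From mathcomp Require Import ring lra.
Set Implicit Arguments.
Unset Strict Implicit.
Unset Printing Implicit Defensive.
Import Order.TTheory GRing.Theory Num.Theory.
Import numFieldNormedType.Exports.
Local Open Scope classical_set_scope.
Local Open Scope ring_scope.

(** Two obstacles shape the details. Vectors are functions that are equal only up to [heq], and
    [synthesis] and [frame_op_inv] choose representatives with [xget]. So the algebra of S holds up
    to [heq] only, and it becomes genuine equality once it is paired with the frame vectors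
    ([heq_analysis]), that is, in ell_2.

    The inverse Fourier transform is given only as an L_2 limit of truncated integrals, with no
    pointwise formula for it. It is therefore reached by pairing with a damped character. The Fejer
    kernel suits this for three reasons. It is integrable, so Fubini applies. Its transform has
    compact support, so the truncation is invisible from some N on. Both functions are nonnegative
    with explicit integrals, so the triangles form an approximate identity and a Schur test gives
    the Plancherel bound.

    Both modes of convergence come from one identity ([remainder]): the error of the sampling series
    is the Fourier transform of a function supported in lambda E whose L_2 norm is controlled by the
    error of the frame expansion. *)

Local Notation nc := Normc.normc.

(** * Abstract pre-Hilbert spaces *)

Section complex_abs.
Variable R : realType.
Implicit Types z w : R[i].

Lemma ncD z w : nc (z + w) <= nc z + nc w. Proof. exact: le_normcD. Qed.
Lemma ncN z : nc (- z) = nc z. Proof. exact: normcN. Qed.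
Lemma ncB z w : nc (z - w) = nc (w - z). Proof. by rewrite -ncN opprB. Qed.
Lemma nc_ge0 z : 0 <= nc z. Proof. by case: z => a b; exact: sqrtr_ge0. Qed.
Lemma nc_sqr z : nc z ^+ 2 = complex.Re z ^+ 2 + complex.Im z ^+ 2.
Proof. by case: z => a b /=; rewrite sqr_sqrtr// addr_ge0// sqr_ge0. Qed.
Lemma nc_conj z : nc z^*%C = nc z.
Proof. by case: z => a b /=; rewrite sqrrN. Qed.
Lemma nc_real (a : R) : nc a%:C%C = `|a|.
Proof. by rewrite /= expr0n addr0 sqrtr_sqr. Qed.
Lemma nc_eq0 z : nc z <= 0 -> z = 0.
Proof.
by move=> z0; apply: Normc.eq0_normc; apply/eqP; rewrite eq_le z0 nc_ge0.
Qed.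
Lemma Re_le_nc z : `|complex.Re z| <= nc z.
Proof.
rewrite -(ler_sqr (x := `|_|)) ?nnegrE ?nc_ge0// nc_sqr real_normK ?num_real//.
by rewrite lerDl sqr_ge0.
Qed.
Lemma Im_le_nc z : `|complex.Im z| <= nc z.
Proof.
rewrite -(ler_sqr (x := `|_|)) ?nnegrE ?nc_ge0// nc_sqr real_normK ?num_real//.
by rewrite lerDr sqr_ge0.
Qed.
Lemma nc_le_ReIm z : nc z <= `|complex.Re z| + `|complex.Im z|.
Proof.
rewrite -(ler_sqr (x := nc z)) ?nnegrE ?nc_ge0 ?addr_ge0// nc_sqr sqrrD.
by rewrite !real_normK ?num_real// addrAC lerDl mulrn_wge0// mulr_ge0.
Qed.
Lemma ReD z w : complex.Re (z + w) = complex.Re z + complex.Re w.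
Proof. by case: z w => ? ? []. Qed.
Lemma ImD z w : complex.Im (z + w) = complex.Im z + complex.Im w.
Proof. by case: z w => ? ? []. Qed.
Lemma ReN z : complex.Re (- z) = - complex.Re z. Proof. by case: z. Qed.
Lemma ImN z : complex.Im (- z) = - complex.Im z. Proof. by case: z. Qed.
Lemma ReM z w : complex.Re (z * w) =
  complex.Re z * complex.Re w - complex.Im z * complex.Im w.
Proof. by case: z w => ? ? []. Qed.
Lemma ImM z w : complex.Im (z * w) =
  complex.Re z * complex.Im w + complex.Im z * complex.Re w.
Proof. by case: z w => ? ? []. Qed.
Lemma ReJ z : complex.Re z^*%C = complex.Re z. Proof. by case: z. Qed.
Lemma ImJ z : complex.Im z^*%C = - complex.Im z. Proof. by case: z. Qed.
Lemma complex_eqP z w :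
  complex.Re z = complex.Re w -> complex.Im z = complex.Im w -> z = w.
Proof. by case: z w => ? ? [? ?] /= -> ->. Qed.
Lemma conjM z w : (z * w)^*%C = z^*%C * w^*%C.
Proof. by apply: complex_eqP; rewrite ?(ReJ, ImJ, ReM, ImM); ring. Qed.
Lemma conjD z w : (z + w)^*%C = z^*%C + w^*%C.
Proof. by apply: complex_eqP; rewrite ?(ReJ, ImJ, ReD, ImD)//; ring. Qed.
Lemma conjK z : (z^*%C)^*%C = z.
Proof. by apply: complex_eqP; rewrite ?(ReJ, ImJ)// opprK. Qed.
Lemma mul_conj z : z * z^*%C = (nc z ^+ 2)%:C%C.
Proof.
by apply: complex_eqP; rewrite ?(ReM, ImM) ReJ ImJ /= ?nc_sqr; ring.
Qed.
Lemma conj_sum (I : Type) (s : seq I) (F : I -> R[i]) :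
  (\sum_(i <- s) F i)^*%C = \sum_(i <- s) (F i)^*%C.
Proof.
elim: s => [|a s IH]; first by rewrite !big_nil conjc0.
by rewrite !big_cons conjD IH.
Qed.
Lemma nc_sum (I : Type) (s : seq I) (F : I -> R[i]) :
  nc (\sum_(i <- s) F i) <= \sum_(i <- s) nc (F i).
Proof.
elim: s => [|a s IH]; first by rewrite !big_nil Normc.normc0.
by rewrite !big_cons (le_trans (ncD _ _))// lerD2l.
Qed.

(** Convergence through the modulus keeps limits real; [ccvgP] translates it to the topology of
    [R[i]^o]. *)
Definition ccvg (z_ : nat -> R[i]) z : Prop :=
  nc (z_ n - z) @[n --> \oo] --> (0 : R).

Lemma ccvg_unique (z_ : nat -> R[i]) z w : ccvg z_ z -> ccvg z_ w -> z = w.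
Proof.
move=> zz zw; apply/eqP; rewrite -subr_eq0; apply/eqP/nc_eq0.
have h : (fun n => nc (z_ n - z) + nc (z_ n - w)) @ \oo --> (0 : R).
  by rewrite -(addr0 (0 : R)); exact: cvgD.
apply: (ler_cvg_to (cvg_cst (nc (z - w))) h); near=> n.
rewrite (ncB (z_ n) z) (le_trans _ (ncD _ _))//.
by rewrite addrA subrK.
Unshelve. all: by end_near. Qed.

Lemma ccvg_le (z_ : nat -> R[i]) z (e : nat -> R) :
  (forall n, nc (z_ n - z) <= e n) -> e @ \oo --> (0 : R) -> ccvg z_ z.
Proof.
move=> h e0; apply: (squeeze_cvgr _ (cvg_cst 0) e0); near=> n.
by rewrite nc_ge0 h.
Unshelve. all: by end_near. Qed.

End complex_abs.

Section real_series.
Variable R : realType.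

(** The Cauchy criterion in the shape asked by [hcomplete]; it yields the convergence of synthesis
    series and of the Neumann series. *)
Lemma bounded_sum_tail (c : nat -> R) (M : R) : (forall n, 0 <= c n) ->
  (forall N, \sum_(n < N) c n <= M) ->
  forall e, 0 < e -> exists N, forall m n, (N <= m <= n)%N ->
    \sum_(i < n) c i - \sum_(i < m) c i <= e.
Proof.
move=> c0 cM e e0.
have nd : {homo (fun N => \sum_(n < N) c n) : n m / (n <= m)%N >-> n <= m}.
  move=> n m /subnK <-; elim: (m - n)%N => [|k IH]; first by rewrite add0n.
  by rewrite addSn big_ord_recr /= (le_trans IH)// lerDl.
have ub : has_ubound (range (fun N => \sum_(n < N) c n)).
  by exists M => _ [N _ <-].
have cv := nondecreasing_is_cvgn nd ub.
have lub := nondecreasing_cvgn_le nd cv.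
have /cvgrPdist_le/(_ e e0)[N _ hN] := cv.
exists N => m n /andP[Nm mn].
have := hN m Nm; have := lub n.
set l := limn _ => h1; rewrite ger0_norm ?subr_ge0//.
by move: h1; rewrite /= => h1 h2; lra.
Qed.

End real_series.

Section prehilbert.
Variables (R : realType) (T : Type) (H : hspace R T).
Implicit Types (u v w : T -> R[i]) (a : R[i]).

(** The form is only positive semidefinite: a function that vanishes almost everywhere has norm 0
    without being 0. *)
Record prehilbert : Prop := PreHilbert {
  ph_0 : hset H (fun=> 0);
  ph_lin : forall a u v, hset H u -> hset H v ->
    hset H (fun x => a * u x + v x);
  ph_dotl : forall a u v w, hset H u -> hset H v -> hset H w ->
    hdot H (fun x => a * u x + v x) w = a * hdot H u w + hdot H v w;
  ph_dotC : forall u v, hset H u -> hset H v -> hdot H v u = (hdot H u v)^*%C;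
  ph_ge0 : forall u, hset H u -> 0 <= complex.Re (hdot H u u) }.

Hypothesis pH : prehilbert.

Lemma ph_scale a u : hset H u -> hset H (fun x => a * u x).
Proof.
move=> hu; have := ph_lin pH a hu (ph_0 pH).
by congr (hset H _); apply/funext => x; rewrite addr0.
Qed.

Lemma ph_add u v : hset H u -> hset H v -> hset H (fun x => u x + v x).
Proof.
move=> hu hv; have := ph_lin pH 1 hu hv.
by congr (hset H _); apply/funext => x; rewrite mul1r.
Qed.

Lemma subE u v : u \- v = (fun x => (-1) * v x + u x).
Proof. by apply/funext => x /=; rewrite mulN1r addrC. Qed.

Lemma ph_sub u v : hset H u -> hset H v -> hset H (u \- v).
Proof. by move=> hu hv; rewrite subE; exact: ph_lin. Qed.

Lemma hdot0l w : hset H w -> hdot H (fun=> 0) w = 0.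
Proof.
move=> hw; have := ph_dotl pH (-1) (ph_0 pH) (ph_0 pH) hw.
have -> : (fun x : T => -1 * 0 + 0 : R[i]) = (fun=> 0).
  by apply/funext => x; rewrite mulr0 addr0.
by rewrite mulN1r addNr.
Qed.

Lemma hdotZl a u w : hset H u -> hset H w ->
  hdot H (fun x => a * u x) w = a * hdot H u w.
Proof.
move=> hu hw; have := ph_dotl pH a hu (ph_0 pH) hw.
rewrite hdot0l// addr0 => <-; congr (hdot H _ w).
by apply/funext => x; rewrite addr0.
Qed.

Lemma hdotBl u v w : hset H u -> hset H v -> hset H w ->
  hdot H (u \- v) w = hdot H u w - hdot H v w.
Proof. by move=> hu hv hw; rewrite subE (ph_dotl pH)// mulN1r addrC. Qed.

Lemma hdotlr a u v w : hset H u -> hset H v -> hset H w ->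
  hdot H w (fun x => a * u x + v x) = a^*%C * hdot H w u + hdot H w v.
Proof.
move=> hu hv hw; have hl := ph_lin pH a hu hv.
by rewrite (ph_dotC pH hl hw) (ph_dotl pH)// conjD conjM -!(ph_dotC pH).
Qed.

Lemma hnorm_ge0 u : 0 <= hnorm H u. Proof. exact: sqrtr_ge0. Qed.

Lemma hnorm_sqr u : hset H u -> hnorm H u ^+ 2 = complex.Re (hdot H u u).
Proof. by move=> hu; rewrite sqr_sqrtr// (ph_ge0 pH). Qed.

Lemma hdot_self u : hset H u -> hdot H u u = (hnorm H u ^+ 2)%:C%C.
Proof.
move=> hu; rewrite hnorm_sqr//; have := ph_dotC pH hu hu.
case: (hdot H u u) => a b /= -[] bN; congr (_ +i* _)%C.
(* Hermitian symmetry gives b = - b for the imaginary part, so 2 b = 0. *)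
by apply/eqP; rewrite -[_ == _](mulrn_eq0 b 2) mulr2n {1}bN addNr.
Qed.

Lemma hnorm_lin a u v : hset H u -> hset H v ->
  hnorm H (fun x => a * u x + v x) ^+ 2 =
  nc a ^+ 2 * hnorm H u ^+ 2 + 2 * complex.Re (a * hdot H u v) + hnorm H v ^+ 2.
Proof.
move=> hu hv; have hl := ph_lin pH a hu hv.
rewrite hnorm_sqr// (ph_dotl pH)// !hdotlr// (ph_dotC pH hu hv) !hdot_self//.
by rewrite !(ReD, ReM, ImD, ImM, ReJ, ImJ, nc_sqr) /=; ring.
Qed.

Lemma hnormZ a u : hset H u -> hnorm H (fun x => a * u x) = nc a * hnorm H u.
Proof.
move=> hu; apply/eqP; rewrite -(@eqrXn2 _ 2)// ?mulr_ge0 ?nc_ge0 ?hnorm_ge0//.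
have hau := ph_scale a hu.
rewrite hnorm_sqr// (hdotZl a hu hau) (ph_dotC pH hau hu) (hdotZl a hu hu) conjM mulrA mul_conj hdot_self//.
by rewrite ReM ReJ ImJ /= oppr0 mulr0 subr0 exprMn.
Qed.

Lemma hnorm0 : hnorm H (fun=> 0) = 0.
Proof.
have := hnormZ 0 (ph_0 pH); rewrite Normc.normc0 [RHS]mul0r => <-.
by congr (hnorm H _); apply/funext => x; rewrite mulr0.
Qed.

Lemma hnormN u v : hset H u -> hset H v -> hnorm H (u \- v) = hnorm H (v \- u).
Proof.
move=> hu hv; have := hnormZ (-1) (ph_sub hu hv).
rewrite ncN Normc.normc1 mul1r => <-; congr (hnorm H _).
by apply/funext => x /=; rewrite mulN1r opprB.
Qed.

Lemma cauchy_schwarz u v : hset H u -> hset H v ->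
  nc (hdot H u v) <= hnorm H u * hnorm H v.
Proof.
move=> hu hv; set c := hdot H u v.
(* Expansion of the square of the norm of u - t c v for real t, with c the inner product of u and
   v. *)
have key (t : R) : 0 <= hnorm H u ^+ 2 - 2 * t * nc c ^+ 2
    + t ^+ 2 * nc c ^+ 2 * hnorm H v ^+ 2.
  have := sqr_ge0 (hnorm H (fun x => (- (t%:C%C * c)) * v x + u x)).
  rewrite hnorm_lin// (ph_dotC pH hu hv) -/c ncN Normc.normcM exprMn.
  rewrite nc_real real_normK ?num_real//.
  have -> : complex.Re (- (t%:C%C * c) * c^*%C) = - (t * nc c ^+ 2).
    by rewrite !(ReM,ImM,ReN,ImN,ReJ,ImJ,nc_sqr) /=; ring.
  by rewrite /=; lra.
rewrite -(@ler_sqr _ (nc c)) ?nnegrE ?mulr_ge0 ?nc_ge0 ?hnorm_ge0// exprMn.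
have b0 := sqr_ge0 (nc c); have a0 := sqr_ge0 (hnorm H u).
have d0 := sqr_ge0 (hnorm H v).
move: key b0 a0 d0; move: (nc c ^+ 2) (hnorm H u ^+ 2) (hnorm H v ^+ 2).
move=> b a d key b0 a0; rewrite le_eqVlt => /predU1P[d0|d0].
  (* If v has norm 0 the bound is affine in t, and t = (a + 1) / (2 b) makes it equal to -1.
     Otherwise t = 1 / d is the minimiser. *)
  rewrite -d0 mulr0 leNgt; apply/negP => b0'.
  have := key ((a + 1) / (2 * b)); rewrite -d0 mulr0 addr0.
  have -> : 2 * ((a + 1) / (2 * b)) * b = a + 1 by field; rewrite gt_eqF.
  by lra.
have := key d^-1; have -> : a - 2 * d^-1 * b + d^-1 ^+ 2 * b * d = a - b / d.
  by field; rewrite gt_eqF.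
by rewrite subr_ge0 ler_pdivrMr.
Qed.

Lemma hnormD u v : hset H u -> hset H v ->
  hnorm H (fun x => u x + v x) <= hnorm H u + hnorm H v.
Proof.
move=> hu hv.
rewrite -ler_sqr ?nnegrE ?addr_ge0 ?hnorm_ge0//.
have := hnorm_lin 1 hu hv; under eq_fun do rewrite mul1r.
move=> ->; rewrite Normc.normc1 mul1r expr1n mul1r.
have : complex.Re (hdot H u v) <= hnorm H u * hnorm H v.
  by rewrite (le_trans _ (cauchy_schwarz hu hv))// (le_trans _ (Re_le_nc _))// ler_norm.
by move=> h; rewrite sqrrD; lra.
Qed.

Lemma hnorm_tri u v w : hset H u -> hset H v -> hset H w ->
  hnorm H (u \- w) <= hnorm H (u \- v) + hnorm H (v \- w).
Proof.
move=> hu hv hw; apply: le_trans (hnormD (ph_sub hu hv) (ph_sub hv hw)).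
by rewrite le_eqVlt; apply/orP; left; apply/eqP; congr (hnorm H _);
  apply/funext => x /=; rewrite addrA subrK.
Qed.

Lemma hnorm_sub_le u v : hset H u -> hset H v ->
  hnorm H u <= hnorm H v + hnorm H (u \- v).
Proof.
move=> hu hv; apply: le_trans (hnormD hv (ph_sub hu hv)).
by rewrite le_eqVlt; apply/orP; left; apply/eqP; congr (hnorm H _);
  apply/funext => x /=; rewrite addrCA subrr addr0.
Qed.

Lemma heq_refl u : heq H u u.
Proof.
rewrite /heq -hnorm0; congr (hnorm H _); apply/funext => x /=; exact: subrr.
Qed.

Lemma heq_sym u v : hset H u -> hset H v -> heq H u v -> heq H v u.
Proof. by move=> hu hv; rewrite /heq hnormN. Qed.

Lemma heq_trans u v w : hset H u -> hset H v -> hset H w ->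
  heq H u v -> heq H v w -> heq H u w.
Proof.
move=> hu hv hw uv vw; apply/eqP; rewrite eq_le hnorm_ge0 andbT.
by rewrite (le_trans (hnorm_tri hu hv hw))// uv vw addr0.
Qed.

Lemma heq_dotl u v w : hset H u -> hset H v -> hset H w ->
  heq H u v -> hdot H u w = hdot H v w.
Proof.
move=> hu hv hw uv; apply/eqP; rewrite -subr_eq0 -hdotBl//.
apply/eqP/nc_eq0; rewrite (le_trans (cauchy_schwarz _ hw))//; first exact: ph_sub.
by rewrite uv mul0r.
Qed.

Lemma heq_dotr u v w : hset H u -> hset H v -> hset H w ->
  heq H u v -> hdot H w u = hdot H w v.
Proof.
by move=> hu hv hw uv; rewrite (ph_dotC pH hu hw) (heq_dotl hu hv)// -(ph_dotC pH).
Qed.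

Lemma heq_hnorm u v : hset H u -> hset H v -> heq H u v -> hnorm H u = hnorm H v.
Proof.
move=> hu hv uv; congr (Num.sqrt (complex.Re _)).
by rewrite (heq_dotl hu hv)// (heq_dotr hu hv).
Qed.

Lemma heq_lin a u v u' v' : hset H u -> hset H v -> hset H u' -> hset H v' ->
  heq H u u' -> heq H v v' ->
  heq H (fun x => a * u x + v x) (fun x => a * u' x + v' x).
Proof.
move=> hu hv hu' hv' uu vv; apply/eqP; rewrite eq_le hnorm_ge0 andbT.
have -> : (fun x => a * u x + v x) \- (fun x => a * u' x + v' x) =
    (fun x => (a * (u \- u') x) + (v \- v') x).
  by apply/funext => x /=; ring.
rewrite (le_trans (hnormD (ph_scale _ (ph_sub hu hu')) (ph_sub hv hv')))//.
by rewrite hnormZ ?uu ?vv ?mulr0 ?addr0//; exact: ph_sub.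
Qed.

(** With c the coefficients of a vector this is convertible to [hexpansion], which links [frame_op]
    to the lemmas below. *)
Definition lincomb (c : nat -> R[i]) (f : nat -> T -> R[i]) (N : nat) : T -> R[i] :=
  fun x => \sum_(n < N) c n * f n x.

Lemma lincombS c f N :
  lincomb c f N.+1 = (fun x => c N * f N x + lincomb c f N x).
Proof. by apply/funext => x; rewrite /lincomb big_ord_recr addrC. Qed.

Lemma lincomb0 c f : lincomb c f 0 = (fun=> 0).
Proof. by apply/funext => x; rewrite /lincomb big_ord0. Qed.

Lemma ph_lincomb c f N : (forall n, hset H (f n)) -> hset H (lincomb c f N).
Proof.
move=> hf; elim: N => [|N IH]; first by rewrite lincomb0; exact: ph_0.
by rewrite lincombS; exact: ph_lin.
Qed.

Lemma hdot_lincombl c f N w : (forall n, hset H (f n)) -> hset H w ->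
  hdot H (lincomb c f N) w = \sum_(n < N) c n * hdot H (f n) w.
Proof.
move=> hf hw; elim: N => [|N IH]; first by rewrite lincomb0 big_ord0 hdot0l.
by rewrite lincombS (ph_dotl pH)// ?IH ?big_ord_recr/= 1?addrC//; exact: ph_lincomb.
Qed.

Lemma hcvg_unique (u_ : nat -> T -> R[i]) v w : hcvg H u_ v -> hcvg H u_ w -> heq H v w.
Proof.
move=> [hu hv uv] [_ hw uw]; apply/eqP; rewrite eq_le hnorm_ge0 andbT.
have h : (fun n => hnorm H (u_ n \- v) + hnorm H (u_ n \- w)) @ \oo --> (0 : R).
  by rewrite -(addr0 (0 : R)); exact: cvgD.
apply: (ler_cvg_to (cvg_cst (hnorm H (v \- w))) h); near=> n.
by rewrite (hnormN (hu n) hv) hnorm_tri.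
Unshelve. all: by end_near. Qed.

Lemma hcvg_le (u_ : nat -> T -> R[i]) v (e : nat -> R) : (forall n, hset H (u_ n)) -> hset H v ->
  (forall n, hnorm H (u_ n \- v) <= e n) -> e @ \oo --> (0 : R) -> hcvg H u_ v.
Proof.
move=> hu hv h e0; split => //; apply: (squeeze_cvgr _ (cvg_cst 0) e0); near=> n.
by rewrite hnorm_ge0 h.
Unshelve. all: by end_near. Qed.

Lemma hcvg_heq (u_ : nat -> T -> R[i]) v w : hset H w -> heq H v w -> hcvg H u_ v -> hcvg H u_ w.
Proof.
move=> hw vw [hu hv uv]; apply: (hcvg_le hu hw _ uv) => n.
by rewrite (le_trans (hnorm_tri (hu n) hv hw))// vw addr0.
Qed.

Lemma hcvg_lin a (u_ v_ : nat -> T -> R[i]) u v : hcvg H u_ u -> hcvg H v_ v ->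
  hcvg H (fun n x => a * u_ n x + v_ n x) (fun x => a * u x + v x).
Proof.
move=> [hu_ hu uu] [hv_ hv vv].
apply: (@hcvg_le _ _ (fun n => nc a * hnorm H (u_ n \- u) + hnorm H (v_ n \- v))).
- by move=> n; exact: ph_lin.
- exact: ph_lin.
- move=> n.
  have -> : (fun x => a * u_ n x + v_ n x) \- (fun x => a * u x + v x) =
    (fun x => (a * (u_ n \- u) x) + (v_ n \- v) x).
    by apply/funext => x /=; ring.
  rewrite -hnormZ ?hnormD//; last exact: ph_sub.
    by apply: ph_scale; exact: ph_sub.
  exact: ph_sub.
- rewrite -(addr0 (0 : R)); apply: cvgD => //.
  by rewrite -(mulr0 (nc a)); exact: cvgMr.
Qed.

Lemma hcvg_dot (u_ : nat -> T -> R[i]) u w : hset H w -> hcvg H u_ u ->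
  ccvg (fun n => hdot H (u_ n) w) (hdot H u w).
Proof.
move=> hw [hu_ hu uu].
apply: (@ccvg_le _ _ _ (fun n => hnorm H (u_ n \- u) * hnorm H w)).
  by move=> n; rewrite -hdotBl//; apply: cauchy_schwarz => //; exact: ph_sub.
by rewrite -(mul0r (hnorm H w)); exact: cvgMl.
Qed.

Definition hcomplete : Prop := forall u_ : nat -> T -> R[i],
  (forall n, hset H (u_ n)) ->
  (forall e : R, 0 < e -> exists N : nat, forall m n, (N <= m <= n)%N ->
     hnorm H (u_ n \- u_ m) <= e) ->
  exists v, hcvg H u_ v.

End prehilbert.

Section ccvg_more.
Variable R : realType.

Lemma ccvg_conj (z_ : nat -> R[i]) z :
  ccvg z_ z -> ccvg (fun n => (z_ n)^*%C) z^*%C.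
Proof.
move=> h; apply: (ccvg_le _ h) => n; rewrite -(nc_conj (z_ n - z)).
by rewrite le_eqVlt; apply/orP; left; apply/eqP; congr nc;
  apply: complex_eqP; rewrite !(ReD, ReN, ReJ, ImD, ImN, ImJ); ring.
Qed.

Lemma ccvg_nondecreasing_le (c : nat -> R) z : (forall n, 0 <= c n) ->
  ccvg (fun N => (\sum_(n < N) c n)%:C%C) z ->
  forall N, \sum_(n < N) c n <= complex.Re z.
Proof.
move=> c0 h N.
have h' : (fun n => complex.Re z + nc ((\sum_(i < n) c i)%:C%C - z))
   @ \oo --> complex.Re z + 0 by apply: cvgD => //; exact: cvg_cst.
rewrite -[leRHS]addr0; apply: (ler_cvg_to (cvg_cst (\sum_(n < N) c n)) h').
near=> n.
have Nn : (N <= n)%N by near: n; exists N.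
have nd : \sum_(n < N) c n <= \sum_(i < n) c i.
  rewrite -(subnK Nn); elim: (n - N)%N => [|k IH]; first by rewrite add0n.
  by rewrite addSn big_ord_recr /= (le_trans IH)// lerDl.
have := Re_le_nc ((\sum_(i < n) c i)%:C%C - z); rewrite ReD ReN /= => /(le_trans (ler_norm _)).
by lra.
Unshelve. all: by end_near. Qed.

End ccvg_more.

(** * Frames *)

Section frames.
Variables (R : realType) (T : Type) (H : hspace R T).
Hypotheses (pH : prehilbert H) (cH : hcomplete H).
Variables (f : nat -> T -> R[i]) (A B : R).
Hypotheses (hf : forall n, hset H (f n)) (A0 : 0 < A) (AB : A < B).
Implicit Types (u v w : T -> R[i]) (a : R[i]).

(** Membership in ell_2 with an explicit bound on the squared norm; carrying M replaces computations
    with infinite sums. *)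
Definition sqsum (c : nat -> R[i]) (M : R) : Prop :=
  forall N, \sum_(n < N) nc (c n) ^+ 2 <= M.

Definition analysis u (n : nat) : R[i] := hdot H u (f n).

(** The frame inequality in terms of partial sums; in the lower bound the infinite sum is replaced
    by each of its upper bounds M. *)
Hypothesis analysis_le : forall u, hset H u ->
  sqsum (analysis u) (B * hnorm H u ^+ 2).
Hypothesis analysis_ge : forall u M, hset H u -> sqsum (analysis u) M ->
  A * hnorm H u ^+ 2 <= M.

Let B0 : 0 < B. Proof. exact: lt_trans AB. Qed.

Lemma sqsum_lin a (c c' : nat -> R[i]) (M M' : R) : sqsum c M -> sqsum c' M' ->
  sqsum (fun n => a * c n + c' n) (2 * nc a ^+ 2 * M + 2 * M').
Proof.
move=> cM cM' N.
apply: (@le_trans _ _ (2 * nc a ^+ 2 * (\sum_(n < N) nc (c n) ^+ 2)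
   + 2 * \sum_(n < N) nc (c' n) ^+ 2)).
  rewrite !mulr_sumr -big_split /=; apply: ler_sum => n _.
  rewrite (@le_trans _ _ ((nc a * nc (c n) + nc (c' n)) ^+ 2))//.
    rewrite ler_sqr ?nnegrE ?addr_ge0 ?mulr_ge0 ?nc_ge0//.
    by rewrite -Normc.normcM ncD.
  have := sqr_ge0 (nc a * nc (c n) - nc (c' n)); rewrite sqrrB sqrrD !exprMn; lra.
have := cM N; have := cM' N; have := sqr_ge0 (nc a); nra.
Qed.

(** The bound on U passes to its adjoint. In |w|^2 = sum_n c_n <f_n, w>, Young's inequality with
    weights B / 2 and 1 / (2 B) leaves at most half of |w|^2 on the right, which is absorbed. *)
Lemma hnorm_lincomb_le c N :
  hnorm H (lincomb c f N) ^+ 2 <= B * \sum_(n < N) nc (c n) ^+ 2.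
Proof.
set w := lincomb c f N; have hw : hset H w by exact: ph_lincomb.
have e : hnorm H w ^+ 2 <= \sum_(n < N) nc (c n) * nc (analysis w n).
  rewrite hnorm_sqr// {2}/w hdot_lincombl//.
  rewrite (le_trans (ler_norm _))// (le_trans (Re_le_nc _))//.
  rewrite (le_trans (nc_sum _ _))//; apply: ler_sum => n _.
  by rewrite Normc.normcM (ph_dotC pH hw (hf n)) nc_conj.
have h : \sum_(n < N) nc (c n) * nc (analysis w n) <=
    \sum_(n < N) (B / 2 * nc (c n) ^+ 2 + (2 * B)^-1 * nc (analysis w n) ^+ 2).
  apply: ler_sum => n _; rewrite -subr_ge0.
  have -> : B / 2 * nc (c n) ^+ 2 + (2 * B)^-1 * nc (analysis w n) ^+ 2 -
      nc (c n) * nc (analysis w n) =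
      (2 * B)^-1 * (B * nc (c n) - nc (analysis w n)) ^+ 2.
    by field; rewrite gt_eqF.
  by rewrite mulr_ge0 ?sqr_ge0// invr_ge0 mulr_ge0// ltW.
rewrite big_split/= -!mulr_sumr in h.
have k : (2 * B)^-1 * \sum_(n < N) nc (analysis w n) ^+ 2 <= hnorm H w ^+ 2 / 2.
  have -> : hnorm H w ^+ 2 / 2 = (2 * B)^-1 * (B * hnorm H w ^+ 2).
    by field; rewrite gt_eqF.
  by rewrite ler_pM2l ?invr_gt0 ?mulr_gt0//; exact: analysis_le.
by lra.
Qed.

(** A difference of partial sums is again a combination, with coefficients cut off below m, so
    [hnorm_lincomb_le] applies to it. *)
Lemma lincomb_tail c m k :
  lincomb (fun i => if (m <= i)%N then c i else 0) f (k + m) =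
  lincomb c f (k + m) \- lincomb c f m.
Proof.
elim: k => [|k IH].
  apply/funext => x; rewrite add0n /= subrr /lincomb big1// => i _.
  by rewrite leqNgt ltn_ord mul0r.
rewrite addSn !lincombS IH leq_addl; apply/funext => x /=; ring.
Qed.

Lemma sum_tail (c : nat -> R[i]) m k :
  \sum_(i < k + m) nc (if (m <= i)%N then c i else 0) ^+ 2 =
  \sum_(i < k + m) nc (c i) ^+ 2 - \sum_(i < m) nc (c i) ^+ 2.
Proof.
elim: k => [|k IH].
  rewrite add0n subrr big1// => i _.
  by rewrite leqNgt ltn_ord Normc.normc0 expr0n.
by rewrite addSn !big_ord_recr /= IH leq_addl; ring.
Qed.

(** The adjoint of U. On square-summable c the series converges ([synthesis_cvg]), so the default 0
    is not met there. *)
Definition synthesis (c : nat -> R[i]) : T -> R[i] :=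
  xget (fun=> 0) [set v | hcvg H (lincomb c f) v].

Lemma synthesis_cvg c M : sqsum c M -> hcvg H (lincomb c f) (synthesis c).
Proof.
move=> cM; apply: (@xgetPex _ (fun=> 0) [set v | hcvg H (lincomb c f) v]).
apply: cH => [n|e e0]; first exact: ph_lincomb.
have e20 : 0 < e ^+ 2 / B by rewrite divr_gt0// exprn_gt0.
have [N hN] := bounded_sum_tail (fun n => sqr_ge0 (nc (c n))) cM e20.
exists N => m n /andP[Nm mn].
rewrite -ler_sqr ?nnegrE ?hnorm_ge0 ?(ltW e0)//.
have := hN m n; rewrite Nm mn => /(_ isT).
rewrite -(subnK mn) -lincomb_tail => h.
rewrite (le_trans (hnorm_lincomb_le _ _))// sum_tail.
by rewrite -ler_pdivlMl// mulrC.
Qed.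

Lemma ph_synthesis c M : sqsum c M -> hset H (synthesis c).
Proof. by move=> /synthesis_cvg[]. Qed.

Lemma sqsum_ge0 c M : sqsum c M -> 0 <= M.
Proof. by move=> /(_ 0); rewrite big_ord0. Qed.

Lemma hnorm_synthesis c M : sqsum c M -> hnorm H (synthesis c) ^+ 2 <= B * M.
Proof.
move=> cM; have M0 := sqsum_ge0 cM.
have [hl hs cv] := synthesis_cvg cM.
have le1 : hnorm H (synthesis c) <= Num.sqrt (B * M) + 0.
  have h : (fun N => Num.sqrt (B * M) + hnorm H (lincomb c f N \- synthesis c))
     @ \oo --> Num.sqrt (B * M) + 0 by apply: cvgD => //; exact: cvg_cst.
  apply: (ler_cvg_to (cvg_cst (hnorm H (synthesis c))) h); near=> N.
  rewrite (le_trans (hnorm_sub_le pH hs (hl N)))// hnormN// lerD2r.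
  rewrite -ler_sqr ?nnegrE ?hnorm_ge0 ?sqrtr_ge0//.
  rewrite (@sqr_sqrtr _ (B * M)) ?mulr_ge0 ?(ltW B0)//.
  by rewrite (le_trans (hnorm_lincomb_le _ _))// ler_pM2l.
rewrite -(@sqr_sqrtr _ (B * M)) ?mulr_ge0 ?(ltW B0)//.
by rewrite ler_sqr ?nnegrE ?hnorm_ge0 ?sqrtr_ge0// -[leRHS]addr0.
Unshelve. all: by end_near. Qed.

Lemma synthesis_dot c M w : sqsum c M -> hset H w ->
  ccvg (fun N => \sum_(n < N) c n * (analysis w n)^*%C) (hdot H (synthesis c) w).
Proof.
move=> cM hw; have := hcvg_dot pH hw (synthesis_cvg cM).
congr (ccvg _ _); apply/funext => N; rewrite hdot_lincombl//.
by apply: eq_bigr => n _; rewrite -(ph_dotC pH).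
Qed.

Lemma lincomb_lin a c c' N :
  lincomb (fun n => a * c n + c' n) f N =
  (fun x => a * lincomb c f N x + lincomb c' f N x).
Proof.
apply/funext => x; rewrite /lincomb mulr_sumr -big_split/=.
by apply: eq_bigr => n _; rewrite mulrDl mulrA.
Qed.

Lemma synthesis_lin a c c' M M' : sqsum c M -> sqsum c' M' ->
  heq H (synthesis (fun n => a * c n + c' n))
        (fun x => a * synthesis c x + synthesis c' x).
Proof.
move=> cM cM'; apply: (hcvg_unique pH (synthesis_cvg (sqsum_lin a cM cM'))).
have := hcvg_lin pH a (synthesis_cvg cM) (synthesis_cvg cM').
by congr (hcvg _ _ _); apply/funext => N; rewrite lincomb_lin.
Qed.

Lemma analysis_lin a u v n : hset H u -> hset H v ->
  analysis (fun x => a * u x + v x) n = a * analysis u n + analysis v n.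
Proof. by move=> hu hv; rewrite /analysis (ph_dotl pH). Qed.

Lemma heq_analysis u v : hset H u -> hset H v -> heq H u v ->
  analysis u = analysis v.
Proof. by move=> hu hv uv; apply/funext => n; exact: heq_dotl. Qed.

(** The frame operator as a total function, where [frame_op] only describes its graph. *)
Definition frop u := synthesis (analysis u).

Lemma frop_cvg u : hset H u -> hcvg H (lincomb (analysis u) f) (frop u).
Proof. by move=> /analysis_le/synthesis_cvg. Qed.

Lemma ph_frop u : hset H u -> hset H (frop u).
Proof. by move=> /frop_cvg[]. Qed.

Lemma frop_lin a u v : hset H u -> hset H v ->
  heq H (frop (fun x => a * u x + v x)) (fun x => a * frop u x + frop v x).
Proof.
move=> hu hv; rewrite /frop.
have -> : analysis (fun x => a * u x + v x) =
    (fun n => a * analysis u n + analysis v n).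
  by apply/funext => n; exact: analysis_lin.
exact: synthesis_lin (analysis_le hu) (analysis_le hv).
Qed.

Lemma frop_ge u : hset H u ->
  A * hnorm H u ^+ 2 <= complex.Re (hdot H (frop u) u).
Proof.
move=> hu; apply: analysis_ge => //.
apply: (@ccvg_nondecreasing_le _ (fun n => nc (analysis u n) ^+ 2)) => [n|]; first exact: sqr_ge0.
have := synthesis_dot (analysis_le hu) hu; congr (ccvg _ _).
apply/funext => N; rewrite rmorph_sum /=; apply: eq_bigr => n _.
by rewrite mul_conj.
Qed.

Lemma frop_le u : hset H u -> hnorm H (frop u) <= B * hnorm H u.
Proof.
move=> hu; rewrite -ler_sqr ?nnegrE ?mulr_ge0 ?hnorm_ge0 ?(ltW B0)//.
by rewrite (le_trans (hnorm_synthesis (analysis_le hu)))// mulrA exprMn -expr2.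
Qed.

Lemma frop_sym u v : hset H u -> hset H v ->
  hdot H (frop u) v = hdot H u (frop v).
Proof.
move=> hu hv; apply: (ccvg_unique (synthesis_dot (analysis_le hu) hv)).
rewrite (ph_dotC pH (ph_frop hv) hu).
have := ccvg_conj (synthesis_dot (analysis_le hv) hu); congr (ccvg _ _).
apply/funext => N; rewrite conj_sum; apply: eq_bigr => n _.
by rewrite conjM conjK mulrC.
Qed.

Lemma frop_lower u : hset H u -> A * hnorm H u <= hnorm H (frop u).
Proof.
move=> hu; have := hnorm_ge0 H u; rewrite le_eqVlt => /predU1P[<-|u0].
  by rewrite mulr0 hnorm_ge0.
rewrite -(ler_pM2r u0) -mulrA -expr2 (le_trans (frop_ge hu))//.
rewrite (le_trans (ler_norm _))// (le_trans (Re_le_nc _))//.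
exact: cauchy_schwarz (ph_frop hu) hu.
Qed.

Lemma frop_inj u v : hset H u -> hset H v -> heq H (frop u) (frop v) ->
  heq H u v.
Proof.
move=> hu hv uv; have hd := ph_sub pH hu hv.
apply/eqP; rewrite eq_le hnorm_ge0 andbT -(ler_pM2l A0) mulr0.
rewrite (le_trans (frop_lower hd))//.
have e : heq H (frop (u \- v)) (frop u \- frop v).
  by rewrite !subE; exact: frop_lin.
by rewrite (heq_hnorm pH _ _ e) ?uv//; [exact: ph_frop|apply: ph_sub => //; exact: ph_frop].
Qed.

(* [S] is inverted by the Neumann series of [s S] with [s = A / B^2], for which
   [|x - s S x|^2 <= (1 - 2 s A + s^2 B^2) |x|^2 = (1 - A^2 / B^2) |x|^2]. *)
Section neumann.
Variable v : T -> R[i].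
Hypothesis hv : hset H v.

Let s : R := A / B ^+ 2.
(** A rational majorant of the contraction factor, by sqrt (1 - x) <= 1 - x / 2 with x = A^2 /
    B^2. *)
Let q : R := 1 - A ^+ 2 / (2 * B ^+ 2).
Let r (k : nat) : T -> R[i] :=
  iter k (fun w x => (- s%:C%C) * frop w x + w x) v.

Let B20 : 0 < B ^+ 2. Proof. by rewrite exprn_gt0. Qed.
Let s0 : 0 < s. Proof. by rewrite divr_gt0. Qed.

Let AB2 : 0 < A ^+ 2 / (2 * B ^+ 2) <= 1 / 2.
Proof.
rewrite divr_gt0 ?exprn_gt0 ?mulr_gt0//=.
rewrite ler_pdivrMr ?mulr_gt0// mul1r mulrA mulVf// mul1r.
by rewrite ler_sqr ?nnegrE ltW.
Qed.

Let q0 : 0 <= q. Proof. by have /andP[? ?] := AB2; rewrite /q; lra. Qed.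
Let q1 : 0 < 1 - q. Proof. by have /andP[? ?] := AB2; rewrite /q; lra. Qed.

Let hr k : hset H (r k).
Proof. by elim: k => [//|k IH] /=; apply: ph_lin => //; exact: ph_frop. Qed.

Let r_contract k : hnorm H (r k.+1) <= q * hnorm H (r k).
Proof.
rewrite -ler_sqr ?nnegrE ?mulr_ge0 ?hnorm_ge0//=.
rewrite hnorm_lin//; last exact: ph_frop.
have h1 := frop_ge (hr k); have h2 := frop_le (hr k).
have -> : complex.Re (- s%:C%C * hdot H (frop (r k)) (r k)) =
    - (s * complex.Re (hdot H (frop (r k)) (r k))).
  by rewrite ReM ReN ImN /=; ring.
rewrite ncN nc_real gtr0_norm//.
have h3 : hnorm H (frop (r k)) ^+ 2 <= B ^+ 2 * hnorm H (r k) ^+ 2.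
  by rewrite -exprMn ler_sqr ?nnegrE ?mulr_ge0 ?hnorm_ge0 ?(ltW B0).
have h4 : s ^+ 2 * hnorm H (frop (r k)) ^+ 2 <=
    s ^+ 2 * (B ^+ 2 * hnorm H (r k) ^+ 2) by rewrite ler_wpM2l ?sqr_ge0.
have h5 : s * (A * hnorm H (r k) ^+ 2) <=
    s * complex.Re (hdot H (frop (r k)) (r k)) by rewrite ler_wpM2l ?(ltW s0).
have e : s ^+ 2 * (B ^+ 2 * hnorm H (r k) ^+ 2) =
    s * A * hnorm H (r k) ^+ 2 by rewrite /s; field; rewrite gt_eqF.
have e2 : s * A = 2 * (1 - q) by rewrite /s /q; field; rewrite gt_eqF.
have n0 := sqr_ge0 (hnorm H (r k)); have q1' := sqr_ge0 (1 - q).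
rewrite [leRHS]exprMn; set n := hnorm H (r k) ^+ 2 in h5 e n0 *.
have : 0 <= (1 - q) ^+ 2 * n by rewrite mulr_ge0.
rewrite e e2 in h4; rewrite mulrA e2 in h5.
by rewrite sqrrB; lra.
Qed.

Let r_le k : hnorm H (r k) <= q ^+ k * hnorm H v.
Proof.
elim: k => [|k IH]; first by rewrite mul1r.
by rewrite (le_trans (r_contract k))// exprS -mulrA ler_wpM2l.
Qed.

Let u_ := lincomb (fun=> s%:C%C) r.

(** A telescoping sum: s S r_k = r_k - r_(k+1), so [r k] is the residual left by the k-th partial
    sum. *)
Let frop_u k : heq H (frop (u_ k)) (v \- r k).
Proof.
elim: k => [|k IH].
  rewrite /u_ lincomb0 /=; have -> : v \- v = (fun=> 0).
    by apply/funext => x /=; rewrite subrr.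
  have h0 := ph_0 pH; have e := frop_lin (-1) h0 h0.
  have z : (fun x : T => -1 * 0 + 0 : R[i]) = (fun=> 0).
    by apply/funext => x; rewrite mulr0 addr0.
  rewrite z in e; move: e; congr (heq H _ _).
  by apply/funext => x; rewrite mulN1r addNr.
rewrite /u_ lincombS -/u_.
have hu : hset H (u_ k) by exact: ph_lincomb.
have hvr : hset H (v \- r k) by exact: ph_sub.
apply: (heq_trans pH _ _ _ (frop_lin _ (hr k) hu)).
- by apply: ph_frop; exact: ph_lin.
- by apply: ph_lin => //; exact: ph_frop.
- exact: ph_sub.
have -> : v \- r k.+1 = (fun x => s%:C%C * frop (r k) x + (v \- r k) x).
  by apply/funext => x /=; ring.
apply: heq_lin => //; try exact: ph_frop.
exact: heq_refl.
Qed.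

Lemma frop_surj : exists2 u, hset H u & heq H (frop u) v.
Proof.
have hu k : hset H (u_ k) by exact: ph_lincomb.
(* A geometric majorant for the norms of the terms s r_j. *)
pose c j := s * (q ^+ j * hnorm H v).
have c0 j : 0 <= c j.
  by rewrite /c mulr_ge0 ?(ltW s0)// mulr_ge0 ?hnorm_ge0// exprn_ge0.
have geo N : \sum_(j < N) c j = s * hnorm H v * (1 - q ^+ N) / (1 - q).
  elim: N => [|N IH]; first by rewrite big_ord0 expr0 subrr mulr0 mul0r.
  by rewrite big_ord_recr /= IH /c exprS; field; rewrite gt_eqF.
have bd N : \sum_(j < N) c j <= s * hnorm H v / (1 - q).
  have sv : 0 <= s * hnorm H v by rewrite mulr_ge0 ?(ltW s0)// hnorm_ge0.
  rewrite geo ler_pM2r ?invr_gt0// ler_piMr//.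
  by rewrite lerBlDr lerDl exprn_ge0.
have diff m k : hnorm H (u_ (k + m) \- u_ m) <=
    \sum_(i < k + m) c i - \sum_(i < m) c i.
  elim: k => [|k IH].
    by rewrite add0n subrr; have /= -> := heq_refl pH (u_ m).
  rewrite addSn big_ord_recr /=.
  have -> : u_ (k + m).+1 \- u_ m =
    (fun x => (s%:C%C * r (k + m) x) + (u_ (k + m) \- u_ m) x).
    by rewrite /u_ lincombS; apply/funext => x /=; ring.
  rewrite (le_trans (hnormD pH (ph_scale pH _ (hr _)) (ph_sub pH (hu _) (hu _))))//.
  rewrite (hnormZ pH)// nc_real gtr0_norm//.
  have : s * hnorm H (r (k + m)) <= c (k + m)%N by rewrite /c ler_wpM2l ?(ltW s0).
  by move: IH; lra.
have [u [_ hu' cu]] : exists u, hcvg H u_ u.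
  apply: cH => // e e0; have [N hN] := bounded_sum_tail c0 bd e0.
  exists N => m n /andP[Nm mn]; have := hN m n; rewrite Nm mn => /(_ isT).
  by rewrite -(subnK mn) => /(le_trans _); apply; exact: diff.
exists u => //; apply/eqP; rewrite eq_le hnorm_ge0 andbT.
(* The norm of S u - v is at most that of S (u - u_k) plus that of the residual r_k. *)
have cq : (fun k => B * hnorm H (u_ k \- u) + q ^+ k * hnorm H v) @ \oo --> (0 : R).
  rewrite -(addr0 (0 : R)); apply: cvgD.
    by rewrite -(mulr0 B); exact: cvgMr.
  rewrite -(mul0r (hnorm H v)); apply: cvgMl; apply: cvg_expr.
  by rewrite ger0_norm// -subr_gt0.
apply: (ler_cvg_to (cvg_cst (hnorm H (frop u \- v))) cq); near=> k.
have h1 : hnorm H (frop u \- frop (u_ k)) <= B * hnorm H (u_ k \- u).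
  have hd := ph_sub pH hu' (hu k).
  have e : heq H (frop (u \- u_ k)) (frop u \- frop (u_ k)).
    by rewrite !subE; exact: frop_lin.
  rewrite -(heq_hnorm pH _ _ e); first by rewrite (hnormN pH (hu k))//; exact: frop_le.
    exact: ph_frop.
  by apply: ph_sub => //; exact: ph_frop.
have h2 : hnorm H (frop (u_ k) \- v) <= q ^+ k * hnorm H v.
  apply: le_trans (r_le k).
  have hvr : hset H (v \- r k) by exact: ph_sub.
  rewrite (le_trans (hnorm_tri pH (ph_frop (hu k)) hvr hv))//.
  rewrite frop_u add0r (hnormN pH hvr hv).
  rewrite le_eqVlt; apply/orP; left; apply/eqP; congr (hnorm H _).
  by apply/funext => x /=; rewrite opprB addrC subrK.
by rewrite (le_trans (hnorm_tri pH (ph_frop hu') (ph_frop (hu k)) hv))// lerD.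
Unshelve. all: by end_near. Qed.

End neumann.

Let Sinv := frame_op_inv H f.

Lemma frame_op_invP v : hset H v -> frame_op H f (Sinv v) v.
Proof.
move=> hv; apply: (@xgetPex _ (fun=> 0) [set u | frame_op H f u v]).
have [u hu e] := frop_surj hv; exists u; split => //.
exact: (hcvg_heq pH hv e (frop_cvg hu)).
Qed.

Lemma ph_Sinv v : hset H v -> hset H (Sinv v).
Proof. by move=> /frame_op_invP[]. Qed.

Lemma Sinv_cvg v : hset H v -> hcvg H (lincomb (analysis (Sinv v)) f) v.
Proof. by move=> /frame_op_invP[]. Qed.

Lemma frop_Sinv v : hset H v -> heq H (frop (Sinv v)) v.
Proof.
by move=> hv; apply: (hcvg_unique pH (frop_cvg (ph_Sinv hv)) (Sinv_cvg hv)).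
Qed.

Lemma Sinv_frop u : hset H u -> heq H (Sinv (frop u)) u.
Proof.
move=> hu; have hS := ph_frop hu; apply: frop_inj => //; first exact: ph_Sinv.
exact: frop_Sinv.
Qed.

Lemma Sinv_le v : hset H v -> hnorm H (Sinv v) <= hnorm H v / A.
Proof.
move=> hv; rewrite ler_pdivlMr// mulrC (le_trans (frop_lower (ph_Sinv hv)))//.
rewrite (heq_hnorm pH _ hv (frop_Sinv hv))//; apply: ph_frop; exact: ph_Sinv.
Qed.

Lemma Sinv_sym u v : hset H u -> hset H v ->
  hdot H (Sinv u) v = hdot H u (Sinv v).
Proof.
move=> hu hv; have hu' := ph_Sinv hu; have hv' := ph_Sinv hv.
have fu' := ph_frop hu'; have fv' := ph_frop hv'.
rewrite -(heq_dotr pH fv' hv hu' (frop_Sinv hv)) -frop_sym//.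
by rewrite (heq_dotl pH fu' hu hv' (frop_Sinv hu)).
Qed.

Lemma Sinv_lin a u v : hset H u -> hset H v ->
  heq H (Sinv (fun x => a * u x + v x)) (fun x => a * Sinv u x + Sinv v x).
Proof.
move=> hu hv; have hu' := ph_Sinv hu; have hv' := ph_Sinv hv.
have hl := ph_lin pH a hu hv; have hl' := ph_lin pH a hu' hv'.
have hul := ph_lin pH a (ph_frop hu') (ph_frop hv').
apply: frop_inj => //; first exact: ph_Sinv.
apply: (heq_trans pH _ hl _ (frop_Sinv hl)); try (by apply: ph_frop => //; exact: ph_Sinv).
apply: (heq_sym pH _ hl); first exact: ph_frop.
apply: (heq_trans pH _ hul hl (frop_lin a hu' hv')); first exact: ph_frop.
by apply: heq_lin => //; try exact: ph_frop; exact: frop_Sinv.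
Qed.

Lemma heq_Sinv u v : hset H u -> hset H v -> heq H u v -> heq H (Sinv u) (Sinv v).
Proof.
move=> hu hv uv; apply: frop_inj; try exact: ph_Sinv.
apply: (heq_trans pH _ hu _ (frop_Sinv hu)); try (by apply: ph_frop; exact: ph_Sinv).
apply: (heq_trans pH hu hv _ uv); first by apply: ph_frop; exact: ph_Sinv.
by apply: (heq_sym pH _ hv (frop_Sinv hv)); apply: ph_frop; exact: ph_Sinv.
Qed.

Definition dual_gram (k n : nat) : R[i] := hdot H (Sinv (f n)) (Sinv (f k)).

(** Symmetry of the inverse moves both copies of S^-1 to one side: row k of B holds the conjugate
    coefficients of S^-2 f_k, so pairing it with c gives the inner product of [synthesis c] with
    S^-2 f_k. *)
Lemma dual_gramE k n :
  dual_gram k n = (analysis (Sinv (Sinv (f k))) n)^*%C.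
Proof.
rewrite /dual_gram Sinv_sym//; last exact: ph_Sinv.
by rewrite /analysis -(ph_dotC pH)//; apply: ph_Sinv; exact: ph_Sinv.
Qed.

Lemma dual_gram_cvg c M k : sqsum c M ->
  ccvg (fun N => \sum_(n < N) dual_gram k n * c n)
       (analysis (Sinv (Sinv (synthesis c))) k).
Proof.
move=> cM; have hc := ph_synthesis cM; have hk := ph_Sinv (hf k).
have := synthesis_dot cM (ph_Sinv hk).
rewrite -Sinv_sym// -Sinv_sym//; last exact: ph_Sinv.
congr (ccvg _ _); apply/funext => N; apply: eq_bigr => n _.
by rewrite dual_gramE mulrC.
Qed.

Lemma analysis_Sinv_frop u k : hset H u ->
  analysis (Sinv (Sinv (synthesis (analysis u)))) k = analysis (Sinv u) k.
Proof.
move=> hu; have hS := ph_frop hu.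
have e := heq_Sinv (ph_Sinv hS) hu (Sinv_frop hu).
rewrite -/(frop u) (heq_analysis _ _ e)//; apply: ph_Sinv => //; exact: ph_Sinv.
Qed.

End frames.

(** * The Gram map and Riesz bases *)

Section ell2.
Variable R : realType.
Implicit Types (y z c : nat -> R[i]) (a : R[i]).

Lemma ccvgP (z_ : nat -> R[i]) (z : R[i]) :
  ccvg z_ z -> (z_ : nat -> R[i]^o) @ \oo --> (z : R[i]^o).
Proof.
(* In the order of [R[i]] a positive radius has imaginary part 0. *)
move=> h; apply/cvgrPdist_le => /= e; rewrite ltcE => /= /andP[/eqP e2 e1].
move/cvgr0_norm_le : h => /(_ _ e1); apply: filterS => n.
rewrite ger0_norm ?nc_ge0// => h; rewrite distrC.
by rewrite lecE /= e2 eqxx.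
Qed.

Lemma series_ord (u : nat -> R[i]) :
  series (u : nat -> R[i]^o) = (fun N => \sum_(n < N) u n).
Proof. by apply/funext => N; rewrite /series /= big_mkord. Qed.

Lemma ccvg_summable (u : nat -> R[i]) (z : R[i]) :
  ccvg (fun N => \sum_(n < N) u n) z -> summable_series u.
Proof.
move=> /ccvgP h; rewrite /summable_series series_ord.
by apply/cvg_ex; exists z.
Qed.

Lemma ccvg_csum (u : nat -> R[i]) (z : R[i]) :
  ccvg (fun N => \sum_(n < N) u n) z -> csum u = z.
Proof.
by move=> /ccvgP h; rewrite /csum series_ord; exact: (cvg_lim (@norm_hausdorff _ R[i]^o) h).
Qed.

Lemma nneseries_leP (c : nat -> R) M : (forall n, 0 <= c n) ->
  (\sum_(0 <= k <oo) (c k)%:E <= M%:E)%E <-> forall N, \sum_(n < N) c n <= M.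
Proof.
move=> c0; have sE N : (\sum_(0 <= k < N) (c k)%:E = (\sum_(n < N) c n)%:E)%E.
  by rewrite big_mkord sumEFin.
split => [h N|h].
  rewrite -lee_fin -sE; apply: le_trans h.
  by apply: nneseries_lim_ge => k _; rewrite lee_fin.
apply: lime_le; first by apply: is_cvg_nneseries => k _ _; rewrite lee_fin.
by apply: nearW => N; rewrite sE lee_fin.
Qed.

Lemma hset_l2P y : hset (l2 R) y <-> exists M, sqsum y M.
Proof.
have c0 n : 0 <= nc (y n) ^+ 2 by exact: sqr_ge0.
split => /= [h|[M yM]].
  exists (fine (\sum_(0 <= k <oo) (nc (y k) ^+ 2)%:E)) => N.
  apply: (iffLR (nneseries_leP _ c0)); rewrite fineK// ge0_fin_numE//.
  by apply: nneseries_ge0 => k _ _; rewrite lee_fin.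
by apply: (le_lt_trans (iffRL (nneseries_leP M c0) yM)); rewrite ltry.
Qed.

(** The squared norm is an admissible bound, and the least one; this turns estimates with an
    arbitrary M into norm estimates. *)
Lemma hnorm_l2 y M : sqsum y M ->
  sqsum y (hnorm (l2 R) y ^+ 2) /\ hnorm (l2 R) y ^+ 2 <= M.
Proof.
move=> yM; have c0 n : 0 <= nc (y n) ^+ 2 by exact: sqr_ge0.
pose s N := \sum_(n < N) nc (y n) ^+ 2.
have nd : {homo s : n m / (n <= m)%N >-> n <= m}.
  move=> n m /subnK <-; elim: (m - n)%N => [|k IH]; first by rewrite add0n.
  by rewrite addSn /s big_ord_recr /= (le_trans IH)// lerDl.
have ub : has_ubound (range s) by exists M => _ [N _ <-]; exact: yM.
have cv := nondecreasing_is_cvgn nd ub; have lub := nondecreasing_cvgn_le nd cv.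
have lM : limn s <= M by apply: limr_le => //; apply: nearW => N; exact: yM.
have l0 : 0 <= limn s.
  by apply: le_trans (lub 0%N); rewrite /s big_ord0.
have nE : hnorm (l2 R) y ^+ 2 = limn s.
  rewrite /hnorm /= (@ccvg_csum _ (limn s)%:C%C)/= ?sqr_sqrtr//.
  have : s n - limn s @[n --> \oo] --> (0 : R).
    by rewrite -(subrr (limn s)); apply: cvgB => //; exact: cvg_cst.
  move=> /cvg_norm; rewrite normr0; apply: cvg_trans.
  apply: near_eq_cvg; apply: nearW => N /=.
  have -> : \sum_(n < N) y n * (y n)^*%C = (s N)%:C%C.
    by rewrite /s rmorph_sum; apply: eq_bigr => n _; rewrite mul_conj.
  by rewrite -rmorphB nc_real.
by rewrite nE; split => // N; exact: lub.
Qed.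

(** Counting measure has no nonempty null set: each entry is dominated by the norm. *)
Lemma heq_l2 y z : hset (l2 R) y -> hset (l2 R) z -> heq (l2 R) y z -> y = z.
Proof.
move=> /hset_l2P[M yM] /hset_l2P[M' zM'] yz.
have := sqsum_lin (-1) zM' yM; have -> : (fun n => -1 * z n + y n) = y \- z.
  by apply/funext => n /=; rewrite mulN1r addrC.
move=> /hnorm_l2[h _]; apply/funext => n; apply/eqP; rewrite -subr_eq0.
apply/eqP/nc_eq0; rewrite -ler_sqr ?nnegrE ?nc_ge0//.
apply: (@le_trans _ _ (\sum_(i < n.+1) nc ((y \- z) i) ^+ 2)).
  by rewrite big_ord_recr /= lerDr sumr_ge0// => i _; exact: sqr_ge0.
by apply: le_trans (h _) _; rewrite yz.
Qed.

Lemma sqsum0 : sqsum (fun=> 0 : R[i]) 0.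
Proof. by move=> N; rewrite big1// => n _; rewrite Normc.normc0 expr0n. Qed.

Lemma heq_l2_refl y : heq (l2 R) y y.
Proof.
rewrite /heq; have -> : y \- y = (fun=> 0).
  by apply/funext => n /=; rewrite subrr.
have [_] := hnorm_l2 sqsum0; rewrite le_eqVlt ltNge sqr_ge0 orbF.
by rewrite sqrf_eq0 => /eqP.
Qed.

Lemma hnorm_l2_le y M : 0 <= M -> sqsum y (M ^+ 2) -> hnorm (l2 R) y <= M.
Proof.
by move=> M0 /hnorm_l2[_]; rewrite ler_sqr// nnegrE hnorm_ge0.
Qed.

End ell2.

(** * Orthonormal systems *)

Section orthonormal.
Variables (R : realType) (T : Type) (H : hspace R T).
Hypotheses (pH : prehilbert H) (cH : hcomplete H).
Variable e : nat -> T -> R[i].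
Hypotheses (he : forall n, hset H (e n))
  (eo : forall m n, hdot H (e m) (e n) = (m == n)%:R).
Implicit Types (u v w : T -> R[i]) (a : R[i]).

Local Notation coef := (analysis H e).

Lemma coef_lincomb c N n : hdot H (lincomb c e N) (e n) = if (n < N)%N then c n else 0.
Proof.
rewrite hdot_lincombl//; under eq_bigr do rewrite eo.
have [nN|Nn] := ltnP n N.
  rewrite (bigD1 (Ordinal nN))//= eqxx mulr1 big1 ?addr0// => i.
  by rewrite -val_eqE /= => /negPf ->; rewrite mulr0.
rewrite big1// => i _; rewrite ltn_eqF ?mulr0//.
by rewrite (leq_trans (ltn_ord i)).
Qed.

Lemma hnorm_lincomb c N :
  hnorm H (lincomb c e N) ^+ 2 = \sum_(n < N) nc (c n) ^+ 2.
Proof.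
have hl := ph_lincomb pH c N he.
rewrite hnorm_sqr// hdot_lincombl//.
have -> : \sum_(n < N) c n * hdot H (e n) (lincomb c e N) =
    (\sum_(n < N) nc (c n) ^+ 2)%:C%C.
  rewrite rmorph_sum; apply: eq_bigr => n _.
  by rewrite (ph_dotC pH hl (he n)) coef_lincomb ltn_ord mul_conj.
by [].
Qed.

(** The error of the orthogonal projection is orthogonal to the first N vectors, so Pythagoras
    applies. *)
Lemma hexpansion_best u c N : hset H u ->
  hnorm H (lincomb (coef u) e N \- u) <= hnorm H (lincomb c e N \- u).
Proof.
move=> hu.
have hp := ph_lincomb pH (coef u) N he; have hc := ph_lincomb pH c N he.
have hpu := ph_sub pH hp hu.
pose d n := c n - coef u n.
have hd := ph_lincomb pH d N he.
have -> : lincomb c e N \- u =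
    (fun x => 1 * lincomb d e N x + (lincomb (coef u) e N \- u) x).
  apply/funext => x /=; rewrite mul1r addrA; congr (_ - _).
  rewrite /lincomb -big_split/=; apply: eq_bigr => n _.
  by rewrite -mulrDl /d subrK.
rewrite -ler_sqr ?nnegrE ?hnorm_ge0// hnorm_lin//.
rewrite mul1r hdot_lincombl// [X in complex.Re X]big1 => [|n _].
  by rewrite /= mulr0 addr0 lerDr mulr_ge0 ?sqr_ge0.
rewrite (ph_dotC pH hpu (he n)) hdotBl// coef_lincomb ltn_ord.
by rewrite subrr conjc0 mulr0.
Qed.

Lemma bessel u : hset H u -> sqsum (coef u) (hnorm H u ^+ 2).
Proof.
move=> hu N; rewrite -hnorm_lincomb.
have hp := ph_lincomb pH (coef u) N he; have hpu := ph_sub pH hp hu.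
have -> : hnorm H u ^+ 2 =
    hnorm H (fun x => (-1) * (lincomb (coef u) e N \- u) x + lincomb (coef u) e N x) ^+ 2.
  by congr (hnorm H _ ^+ 2); apply/funext => x /=; ring.
rewrite hnorm_lin// (ph_dotC pH hp hpu) hdot_lincombl// [X in X^*%C]big1 => [|n _].
  by rewrite conjc0 mulr0 /= mulr0 addr0 lerDr mulr_ge0 ?sqr_ge0.
rewrite (ph_dotC pH hpu (he n)) hdotBl// coef_lincomb ltn_ord.
by rewrite subrr conjc0 mulr0.
Qed.

(** The frame lemmas ask for A < B, so an orthonormal system is fed to them with A = 1 and the
    relaxed upper bound B = 2. *)
Lemma bessel2 u : hset H u -> sqsum (coef u) (2 * hnorm H u ^+ 2).
Proof.
move=> hu N; have := bessel hu N; have := sqr_ge0 (hnorm H u); lra.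
Qed.

Lemma onb_synthesis_cvg c M : sqsum c M ->
  hcvg H (lincomb c e) (synthesis H e c).
Proof.
have : (1 : R) < 2 by rewrite ltr1n.
by move=> h; exact: (synthesis_cvg pH cH he ltr01 h bessel2).
Qed.

(** The n-th coefficient of a partial sum is constant once more than n terms are taken, and the
    inner product is continuous. *)
Lemma coef_synthesis c M n : sqsum c M -> coef (synthesis H e c) n = c n.
Proof.
move=> cM; apply: (ccvg_unique (hcvg_dot pH (he n) (onb_synthesis_cvg cM))).
apply: cvg_near_cst; near=> N; rewrite coef_lincomb ifT ?subrr ?Normc.normc0//.
by near: N; exact: nbhs_infty_gt.
Unshelve. all: by end_near. Qed.

End orthonormal.

Section bounded_linear.
Variables (R : realType) (T : Type) (H : hspace R T).
Hypothesis pH : prehilbert H.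
Variable L : (T -> R[i]) -> T -> R[i].
Hypothesis bL : is_bounded_linear H L.

Lemma bounded_linear_sub u v : hset H u -> hset H v ->
  heq H (L (u \- v)) (L u \- L v).
Proof. by move=> hu hv; case: bL => _ lL _; rewrite !subE; exact: lL. Qed.

Lemma bounded_linear_cvg (u_ : nat -> T -> R[i]) u :
  hcvg H u_ u -> hcvg H (fun n => L (u_ n)) (L u).
Proof.
move=> [hu_ hu uu]; case: (bL) => sL lL [M bM].
apply: (@hcvg_le _ _ _ _ _ (fun n => M * hnorm H (u_ n \- u))).
- by move=> n; exact: sL.
- exact: sL.
- move=> n; rewrite -(heq_hnorm pH _ _ (bounded_linear_sub (hu_ n) hu)).
  + by apply: bM; exact: ph_sub.
  + by apply: sL; exact: ph_sub.
  + by apply: ph_sub => //; exact: sL.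
- by rewrite -(mulr0 M); exact: cvgMr.
Qed.

Lemma bounded_linear_hnorm0 u : hset H u -> hnorm H u = 0 -> hnorm H (L u) = 0.
Proof.
move=> hu u0; case: bL => _ _ [M /(_ u hu)]; rewrite u0 mulr0 => h.
by apply/eqP; rewrite eq_le h hnorm_ge0.
Qed.

Lemma bounded_linear_lincomb c e f N : (forall n, hset H (e n)) ->
  (forall n, hset H (f n)) -> (forall n, heq H (L (e n)) (f n)) ->
  heq H (L (lincomb c e N)) (lincomb c f N).
Proof.
move=> he hf ef; case: (bL) => sL lL [M bM].
elim: N => [|N IH].
  rewrite !lincomb0 /heq.
  have -> : L (fun=> 0) \- (fun=> 0) = L (fun=> 0).
    by apply/funext => x /=; rewrite subr0.
  by apply: bounded_linear_hnorm0; [exact: ph_0|exact: hnorm0].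
have hl := ph_lincomb pH c N he; have hl' := ph_lincomb pH c N hf.
rewrite !lincombS; apply: (heq_trans pH _ _ _ (lL (c N) _ _ (he N) hl)).
- by apply: sL; exact: ph_lin.
- by apply: ph_lin => //; exact: sL.
- exact: ph_lin.
- by apply: heq_lin => //; exact: sL.
Qed.

End bounded_linear.

(** * Finite spans and the Gram-Schmidt process *)

Section span.
Variables (R : realType) (T : Type).
Implicit Types (f : nat -> T -> R[i]) (w : T -> R[i]).

(** Vanishing from n on lets one sequence c serve for all larger n, and makes it square-summable. *)
Definition spanned f (n : nat) w : Prop :=
  exists2 c : nat -> R[i], (forall i, (n <= i)%N -> c i = 0) & w = lincomb c f n.

Lemma lincomb_spanned0 f c n k : (forall i, (n <= i)%N -> c i = 0) ->
  lincomb c f (k + n) = lincomb c f n.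
Proof.
move=> c0; elim: k => [//|k IH]; rewrite addSn lincombS IH c0 ?leq_addl//.
by apply/funext => x; rewrite mul0r add0r.
Qed.

Lemma spanned_mono f m n w : (m <= n)%N -> spanned f m w -> spanned f n w.
Proof.
move=> mn [c c0 ->]; exists c => [i ni|]; first exact: c0 (leq_trans mn ni).
by rewrite -(subnK mn) lincomb_spanned0.
Qed.

Lemma spanned_lin f n (a : R[i]) w w' : spanned f n w -> spanned f n w' ->
  spanned f n (fun x => a * w x + w' x).
Proof.
move=> [c c0 ->] [c' c'0 ->]; exists (fun i => a * c i + c' i).
  by move=> i ni; rewrite c0// c'0// mulr0 addr0.
by rewrite lincomb_lin.
Qed.

Lemma spanned0 f n : spanned f n (fun=> 0).
Proof.
exists (fun=> 0) => //; apply/funext => x; rewrite /lincomb big1// => i _.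
by rewrite mul0r.
Qed.

Lemma spanned_gen f n : spanned f n.+1 (f n).
Proof.
exists (fun i => (i == n)%:R) => [i ni|]; first by rewrite gtn_eqF.
apply/funext => x; rewrite /lincomb big_ord_recr /= eqxx mul1r big1 ?add0r// => i _.
by rewrite ltn_eqF// mul0r.
Qed.

Lemma spanned_lincomb f g n c N : (forall k, (k < N)%N -> spanned g n (f k)) ->
  spanned g n (lincomb c f N).
Proof.
elim: N => [_|N IH h]; first by rewrite lincomb0; exact: spanned0.
rewrite lincombS; apply: spanned_lin; first exact: h.
by apply: IH => k kN; apply: h; exact: leqW.
Qed.

End span.

Section gram_schmidt.
Variables (R : realType) (T : Type) (H : hspace R T).
Hypothesis pH : prehilbert H.
Variable f : nat -> T -> R[i].
Hypothesis hf : forall n, hset H (f n).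
Hypothesis f_indep : forall n w, spanned f n w -> hnorm H (f n \- w) != 0.

Let gs_step (l : seq (T -> R[i])) (u : T -> R[i]) : T -> R[i] :=
  u \- (fun x => \sum_(k < size l) hdot H u (nth (fun=> 0) l k) * nth (fun=> 0) l k x).

(** Each step refers to all earlier vectors, so the recursion produces their list and [gram_schmidt]
    reads off its last entry. *)
Fixpoint gs_seq n : seq (T -> R[i]) :=
  if n is m.+1 then
    let g := gs_step (gs_seq m) (f m) in
    rcons (gs_seq m) (fun x => ((hnorm H g)^-1)%:C%C * g x)
  else [::].

Definition gram_schmidt n : T -> R[i] := nth (fun=> 0) (gs_seq n.+1) n.

Let size_gs n : size (gs_seq n) = n.
Proof. by elim: n => //= n IH; rewrite size_rcons IH. Qed.

Let nth_gs n k : (k < n)%N -> nth (fun=> 0) (gs_seq n) k = gram_schmidt k.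
Proof.
elim: n => // n IH kn; rewrite /= nth_rcons size_gs.
move: kn; rewrite ltnS leq_eqVlt => /predU1P[->|kn].
  by rewrite ltnn eqxx /gram_schmidt /= nth_rcons size_gs ltnn eqxx.
by rewrite kn IH.
Qed.

Let g n : T -> R[i] :=
  f n \- lincomb (fun k => hdot H (f n) (gram_schmidt k)) gram_schmidt n.

Lemma gram_schmidtE n : gram_schmidt n =
  (fun x => ((hnorm H (g n))^-1)%:C%C * g n x).
Proof.
have gE : gs_step (gs_seq n) (f n) = g n.
  apply/funext => x; rewrite /gs_step /g /lincomb size_gs /=; congr (_ - _).
  by apply: eq_bigr => k _; rewrite nth_gs.
by rewrite /gram_schmidt /= nth_rcons size_gs ltnn eqxx gE.
Qed.

Lemma ph_gram_schmidt n : hset H (gram_schmidt n).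
Proof.
have [m] := ubnP n; elim: m n => // m IH n nm; rewrite gram_schmidtE.
apply: ph_scale => //; apply: ph_sub => //.
elim: n nm => [|n IHn] nm; first by rewrite lincomb0; exact: ph_0.
suff h N : (N <= n.+1)%N ->
  hset H (lincomb (fun k => hdot H (f n.+1) (gram_schmidt k)) gram_schmidt N).
  exact: h.
elim: N => [|N IHN] Nn; first by rewrite lincomb0; exact: ph_0.
rewrite lincombS; apply: ph_lin => //; last by apply: IHN; exact: ltnW.
by apply: IH; apply: leq_trans Nn _.
Qed.

Let hg n : hset H (g n).
Proof. by apply: ph_sub => //; apply: ph_lincomb => // k; exact: ph_gram_schmidt. Qed.

Lemma gram_schmidt_spanned n : spanned f n.+1 (gram_schmidt n).
Proof.
have [m] := ubnP n; elim: m n => // m IH n nm; rewrite gram_schmidtE.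
have s k : (k < n)%N -> spanned f n.+1 (gram_schmidt k).
  move=> kn; apply: (@spanned_mono _ _ _ k.+1); first by rewrite ltnS ltnW.
  by apply: IH; apply: leq_trans kn _.
have : spanned f n.+1 (g n).
  rewrite /g subE; apply: spanned_lin; last exact: spanned_gen.
  exact: spanned_lincomb.
move=> /(spanned_lin ((hnorm H (g n))^-1)%:C%C)/(_ (spanned0 f n.+1)).
by congr (spanned _ _ _); apply/funext => x; rewrite addr0.
Qed.

Let g_neq0 n : hnorm H (g n) != 0.
Proof.
apply: f_indep; apply: spanned_lincomb => k kn.
exact: spanned_mono (gram_schmidt_spanned k).
Qed.

Lemma spanned_gram_schmidt n : spanned gram_schmidt n.+1 (f n).
Proof.
have -> : f n = (fun x => (hnorm H (g n))%:C%C * gram_schmidt n x +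
    lincomb (fun k => hdot H (f n) (gram_schmidt k)) gram_schmidt n x).
  apply/funext => x; rewrite gram_schmidtE mulrA -rmorphM /= divff//.
  by rewrite mul1r /g /= subrK.
apply: spanned_lin; first exact: spanned_gen.
apply: spanned_lincomb => k kn; apply: (@spanned_mono _ _ _ k.+1).
  by rewrite ltnS ltnW.
exact: spanned_gen.
Qed.

Lemma gram_schmidt_orthonormal m n :
  hdot H (gram_schmidt m) (gram_schmidt n) = (m == n)%:R.
Proof.
have he := ph_gram_schmidt.
(* Induction on a common bound of both indices: orthogonality of the new vector to an old one uses
   that of all old pairs. *)
suff h N : forall m n, (m < N)%N -> (n < N)%N ->
    hdot H (gram_schmidt m) (gram_schmidt n) = (m == n)%:R.
  by apply: (h (maxn m n).+1); rewrite ltnS ?leq_maxl ?leq_maxr.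
elim: N => // N IH {m n}.
have lt k : (k < N)%N -> hdot H (gram_schmidt N) (gram_schmidt k) = 0.
  move=> kN; rewrite gram_schmidtE hdotZl// hdotBl//; last exact: ph_lincomb.
  rewrite hdot_lincombl// (bigD1 (Ordinal kN))//= IH// eqxx mulr1.
  rewrite big1 ?addr0 ?subrr ?mulr0// => i.
  by rewrite -val_eqE /= => ik; rewrite IH// (negPf ik) mulr0.
have diag : hdot H (gram_schmidt N) (gram_schmidt N) = 1.
  rewrite hdot_self// gram_schmidtE hnormZ//.
  by rewrite nc_real ger0_norm ?invr_ge0 ?hnorm_ge0// mulVf// expr1n.
move=> m n; rewrite !ltnS leq_eqVlt => /predU1P[->|mN];
  rewrite leq_eqVlt => /predU1P[->|nN].
- by rewrite eqxx.
- by rewrite lt// gtn_eqF.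
- by rewrite (ph_dotC pH (he N) (he m)) lt// conjc0 ltn_eqF.
- exact: IH.
Qed.

End gram_schmidt.

(** * The operator B and the Riesz basis property *)

Section riesz.
Variables (R : realType) (T : Type) (H : hspace R T).
Hypotheses (pH : prehilbert H) (cH : hcomplete H).
Variables (f : nat -> T -> R[i]) (A B : R).
Hypotheses (hf : forall n, hset H (f n)) (A0 : 0 < A) (AB : A < B).
Hypothesis analysis_le : forall u, hset H u ->
  sqsum (analysis H f u) (B * hnorm H u ^+ 2).
Hypothesis analysis_ge : forall u M, hset H u -> sqsum (analysis H f u) M ->
  A * hnorm H u ^+ 2 <= M.

Local Notation Sinv := (frame_op_inv H f).
Local Notation syn := (synthesis H f).
Local Notation ana := (analysis H f).
Local Notation hSinv := (ph_Sinv pH cH hf A0 AB analysis_le analysis_ge).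
Local Notation hsyn := (ph_synthesis pH cH hf A0 AB analysis_le).

Let B0 : 0 < B. Proof. exact: lt_trans AB. Qed.

Definition gram_map (y : nat -> R[i]) (k : nat) : R[i] :=
  csum (fun n => dual_gram H f k n * y n).

Lemma gram_map_summable y k : hset (l2 R) y ->
  summable_series (fun n => dual_gram H f k n * y n).
Proof.
move=> /hset_l2P[M yM].
exact: ccvg_summable (dual_gram_cvg pH cH hf A0 AB analysis_le analysis_ge k yM).
Qed.

Lemma gram_mapE y : hset (l2 R) y -> gram_map y = ana (Sinv (Sinv (syn y))).
Proof.
move=> /hset_l2P[M yM]; apply/funext => k; apply: ccvg_csum.
exact: (dual_gram_cvg pH cH hf A0 AB analysis_le analysis_ge k yM).
Qed.

Lemma hset_l2_analysis u : hset H u -> hset (l2 R) (ana u).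
Proof. by move=> /analysis_le h; apply/hset_l2P; exists (B * hnorm H u ^+ 2). Qed.

Lemma gram_map_analysis u : hset H u -> gram_map (ana u) = ana (Sinv u).
Proof.
move=> hu; rewrite gram_mapE; last exact: hset_l2_analysis.
apply/funext => k.
exact: (analysis_Sinv_frop pH cH hf A0 AB analysis_le analysis_ge k hu).
Qed.

Lemma gram_map_bounded_linear : is_bounded_linear (l2 R) gram_map.
Proof.
split.
- move=> y hy; rewrite gram_mapE//; apply: hset_l2_analysis.
  by have /hset_l2P[M yM] := hy; do 2 apply: hSinv; exact: hsyn yM.
- move=> a y z hy hz; have /hset_l2P[M yM] := hy; have /hset_l2P[N zN] := hz.
  have yzl : hset (l2 R) (fun x => a * y x + z x).
    by apply/hset_l2P; exists (2 * nc a ^+ 2 * M + 2 * N); exact: sqsum_lin.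
  suff -> : gram_map (fun x => a * y x + z x) =
      (fun x => a * gram_map y x + gram_map z x) by exact: heq_l2_refl.
  rewrite !gram_mapE//; apply/funext => k.
  have sy := hsyn yM; have sz := hsyn zN.
  have syz := hsyn (sqsum_lin a yM zN).
  have hl := ph_lin pH a sy sz.
  rewrite -analysis_lin//; try by do 2 apply: hSinv.
  congr (_ k); apply: (heq_analysis pH hf); first by do 2 apply: hSinv.
    by apply: ph_lin => //; do 2 apply: hSinv.
  have e1 := synthesis_lin pH cH hf A0 AB analysis_le a yM zN.
  have e2 := heq_Sinv pH cH hf A0 AB analysis_le analysis_ge syz hl e1.
  have e3 := Sinv_lin pH cH hf A0 AB analysis_le analysis_ge a sy sz.
  have hl' := ph_lin pH a (hSinv sy) (hSinv sz).
  have e4 := heq_trans pH (hSinv syz) (hSinv hl) hl' e2 e3.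
  have e5 := heq_Sinv pH cH hf A0 AB analysis_le analysis_ge (hSinv syz) hl' e4.
  have e6 := Sinv_lin pH cH hf A0 AB analysis_le analysis_ge a (hSinv sy) (hSinv sz).
  apply: heq_trans e5 e6 => //; first by do 2 apply: hSinv.
    exact: hSinv.
  by apply: ph_lin => //; do 2 apply: hSinv.
(* U and its adjoint contribute sqrt B each, and each of the two inverses of S contributes 1 / A. *)
- exists (B / A ^+ 2) => y hy; have /hset_l2P[M yM] := hy.
  have [yl _] := hnorm_l2 yM; have sy := hsyn yM.
  have sle := Sinv_le pH cH hf A0 AB analysis_le analysis_ge.
  rewrite gram_mapE//; apply: hnorm_l2_le.
    by rewrite mulr_ge0 ?hnorm_ge0// divr_ge0 ?(ltW B0)// exprn_ge0// ltW.
  have h1 : hnorm H (Sinv (Sinv (syn y))) <= hnorm H (syn y) / A ^+ 2.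
    rewrite (le_trans (sle _ (hSinv sy)))//.
    rewrite expr2 invfM mulrA ler_pM2r ?invr_gt0//; exact: sle.
  have h2 := hnorm_synthesis pH cH hf A0 AB analysis_le yl.
  move=> N; apply: le_trans (analysis_le (hSinv (hSinv sy)) N) _.
  have h3 : hnorm H (Sinv (Sinv (syn y))) ^+ 2 <= (hnorm H (syn y) / A ^+ 2) ^+ 2.
    rewrite ler_sqr ?nnegrE ?hnorm_ge0// mulr_ge0 ?hnorm_ge0// invr_ge0.
    by rewrite exprn_ge0// ltW.
  apply: (@le_trans _ _ (B * ((hnorm H (syn y) / A ^+ 2) ^+ 2))).
    by rewrite ler_pM2l.
  have An0 : A != 0 by rewrite gt_eqF.
  have -> : B * (hnorm H (syn y) / A ^+ 2) ^+ 2 =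
    B / A ^+ 4 * hnorm H (syn y) ^+ 2 by field.
  have -> : (B / A ^+ 2 * hnorm (l2 R) y) ^+ 2 =
    B / A ^+ 4 * (B * hnorm (l2 R) y ^+ 2) by field.
  by rewrite ler_pM2l// divr_gt0// exprn_gt0.
Qed.

Definition synthesis_injective : Prop :=
  forall c M, sqsum c M -> hnorm H (syn c) = 0 -> c = (fun=> 0).

(** Synthesis sends both c and the frame coefficients of [syn c] to [syn c], so it kills their
    difference. *)
Lemma synthesis_injective_analysis c M : synthesis_injective -> sqsum c M ->
  ana (Sinv (syn c)) = c.
Proof.
move=> inj cM; have sc := hsyn cM; have hS := hSinv sc.
have dM := sqsum_lin (-1) cM (analysis_le hS).
have e := synthesis_lin pH cH hf A0 AB analysis_le (-1) cM (analysis_le hS).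
have e' := frop_Sinv pH cH hf A0 AB analysis_le analysis_ge sc.
have hf' := ph_frop pH cH hf A0 AB analysis_le hS.
have := inj _ _ dM.
rewrite (heq_hnorm pH (hsyn dM) _ e); last exact: ph_lin.
rewrite (_ : (fun x => _) = frop H f (Sinv (syn c)) \- syn c); last by rewrite subE.
move=> /(_ e') h; apply/funext => n.
by have := congr1 (fun g => g n) h; rewrite /= mulN1r addrC => /eqP; rewrite subr_eq0 => /eqP.
Qed.

Lemma hset_l20 : hset (l2 R) (fun=> 0).
Proof. by apply/hset_l2P; exists 0; exact: sqsum0. Qed.

Lemma hnorm_l20 : hnorm (l2 R) (fun=> 0) = 0.
Proof.
have := heq_l2_refl (fun=> 0 : R[i]); rewrite /heq => h.
rewrite -[RHS]h; congr (hnorm _ _).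
by apply/funext => n /=; rewrite subrr.
Qed.

(** Synthesis is the first factor of B, so its kernel lies in that of B. *)
Lemma gram_map_iso_injective :
  is_onto_isomorphism (l2 R) gram_map -> synthesis_injective.
Proof.
move=> [_ [L' [bL' L'B _]]] c M cM c0.
have hc : hset (l2 R) c by apply/hset_l2P; exists M.
have sc := hsyn cM.
have sle := Sinv_le pH cH hf A0 AB analysis_le analysis_ge.
have n1 : hnorm H (Sinv (syn c)) = 0.
  by apply/eqP; rewrite eq_le hnorm_ge0 andbT (le_trans (sle _ sc))// c0 mul0r.
have n2 : hnorm H (Sinv (Sinv (syn c))) = 0.
  by apply/eqP; rewrite eq_le hnorm_ge0 andbT (le_trans (sle _ (hSinv sc)))// n1 mul0r.
have Bc : gram_map c = (fun=> 0).
  rewrite gram_mapE//; apply/funext => k; apply: nc_eq0.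
  by rewrite (le_trans (cauchy_schwarz pH (hSinv (hSinv sc)) (hf k)))// n2 mul0r.
case: bL' => sL' _ [K bK].
have h0 := bK _ hset_l20; rewrite hnorm_l20 mulr0 in h0.
have := L'B _ hc; rewrite Bc => e.
rewrite -(heq_l2 (sL' _ hset_l20) hc e); apply: heq_l2.
- exact: sL' hset_l20.
- exact: hset_l20.
rewrite /heq (_ : _ \- _ = L' (fun=> 0)); last first.
  by apply/funext => n /=; rewrite subr0.
by apply/eqP; rewrite eq_le h0 hnorm_ge0.
Qed.

(** The inverse of B is the Gram operator of the frame itself, c to [ana (syn c)]. Composed with B
    on either side it gives [ana (Sinv (syn c))], which is c by [synthesis_injective_analysis]. *)
Lemma injective_gram_map_iso :
  synthesis_injective -> is_onto_isomorphism (l2 R) gram_map.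
Proof.
move=> inj; split; first exact: gram_map_bounded_linear.
exists (fun c => ana (syn c)); split.
- split.
  + by move=> c /hset_l2P[M cM]; apply: hset_l2_analysis; exact: hsyn cM.
  + move=> a y z /hset_l2P[M yM] /hset_l2P[N zN].
    rewrite (_ : ana _ = (fun x => a * ana (syn y) x + ana (syn z) x)).
      exact: heq_l2_refl.
    have sy := hsyn yM; have sz := hsyn zN.
    apply/funext => k; rewrite -analysis_lin//; congr (_ k).
    apply: (heq_analysis pH hf (hsyn (sqsum_lin a yM zN)) (ph_lin pH a sy sz)).
    exact: (synthesis_lin pH cH hf A0 AB analysis_le a yM zN).
  + exists B => y /hset_l2P[M yM]; have [yl _] := hnorm_l2 yM.
    have h := hnorm_synthesis pH cH hf A0 AB analysis_le yl.
    apply: hnorm_l2_le; first by rewrite mulr_ge0 ?hnorm_ge0// ltW.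
    move=> N; rewrite (le_trans (analysis_le (hsyn yM) N))//.
    by rewrite exprMn expr2 -mulrA ler_pM2l.
- move=> c hc; have /hset_l2P[M cM] := hc; have sc := hsyn cM.
  rewrite gram_mapE// (_ : ana _ = c); first exact: heq_l2_refl.
  have hSS := hSinv (hSinv sc).
  rewrite -[RHS](synthesis_injective_analysis inj cM).
  apply: (heq_analysis pH hf) => //.
  + by apply: hsyn; exact: analysis_le hSS.
  + exact: hSinv.
  + exact: (frop_Sinv pH cH hf A0 AB analysis_le analysis_ge (hSinv sc)).
- move=> c /hset_l2P[M cM]; rewrite gram_map_analysis; last exact: hsyn cM.
  by rewrite (synthesis_injective_analysis inj cM); exact: heq_l2_refl.
Qed.

(** L maps sum_n c_n e_n to sum_n c_n f_n. If the latter is null then so is the former, L being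
    invertible, and its coefficients c vanish. *)
Lemma riesz_injective : is_riesz_basis H f -> synthesis_injective.
Proof.
move=> [_ [e [L [[he eo ee] [bL [L' [bL' L'L _]]] Lef]]]] c M cM c0.
have wc := onb_synthesis_cvg pH cH he eo cM; set w := synthesis H e c in wc.
have [_ hw _] := wc; have sc := hsyn cM.
have hLw : hset H (L w) by case: bL => + _ _; apply.
have Lw : hcvg H (lincomb c f) (L w).
  have [h1 h2 h3] := bounded_linear_cvg pH bL wc.
  apply: (hcvg_le _ _ _ h3) => // [n|n]; first exact: ph_lincomb.
  have hl := ph_lincomb pH c n hf.
  rewrite (le_trans (hnorm_tri pH hl (h1 n) hLw))// (hnormN pH hl (h1 n)).
  by rewrite (bounded_linear_lincomb pH bL c n he hf Lef) add0r.
have e1 := hcvg_unique pH Lw (synthesis_cvg pH cH hf A0 AB analysis_le cM).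
have Lw0 : hnorm H (L w) = 0 by rewrite (heq_hnorm pH hLw sc e1).
have L'Lw0 := bounded_linear_hnorm0 bL' hLw Lw0.
have hL'Lw : hset H (L' (L w)) by case: bL' => + _ _; apply.
have w0 : hnorm H w = 0 by rewrite -(heq_hnorm pH hL'Lw hw (L'L _ hw)).
apply/funext => n; rewrite -(coef_synthesis pH cH he eo n cM).
by apply: nc_eq0; rewrite (le_trans (cauchy_schwarz pH hw (he n)))// w0 mul0r.
Qed.

Lemma synthesis_finite c n : (forall i, (n <= i)%N -> c i = 0) ->
  exists M, sqsum c M /\ heq H (syn c) (lincomb c f n).
Proof.
move=> c0; exists (\sum_(i < n) nc (c i) ^+ 2).
have cM : sqsum c (\sum_(i < n) nc (c i) ^+ 2).
  move=> N; have [Nn|/ltnW nN] := leqP N n.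
    rewrite -(subnK Nn); elim: (n - N)%N => // k IH.
    by rewrite addSn big_ord_recr /= (le_trans IH)// lerDl sqr_ge0.
  rewrite -(subnK nN); elim: (N - n)%N => // k IH.
  rewrite addSn big_ord_recr /= c0 ?leq_addl// Normc.normc0 expr0n addr0.
  exact: IH.
split => //.
apply: (hcvg_unique pH (synthesis_cvg pH cH hf A0 AB analysis_le cM)).
split; [by move=> ?; exact: ph_lincomb|exact: ph_lincomb|].
apply: cvg_near_cst; near=> N.
have nN : (n <= N)%N by near: N; exact: nbhs_infty_ge.
by rewrite -(subnK nN) lincomb_spanned0//; exact: heq_refl.
Unshelve. all: by end_near. Qed.

(** L expands in the orthonormal basis and synthesises with the frame; its inverse takes the frame
    coefficients of S^-1 v and synthesises with the basis. *)
Lemma injective_riesz : synthesis_injective -> is_riesz_basis H f.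
Proof.
move=> inj; split => //.
(* A dependence of f_n on earlier vectors would be a finite sequence with n-th entry 1 that
   synthesis kills. *)
have f_indep n w : spanned f n w -> hnorm H (f n \- w) != 0.
  move=> [c c0 ->]; apply/eqP => fw.
  pose d i := if i == n then 1 else - c i.
  have d0 i : (n.+1 <= i)%N -> d i = 0.
    by move=> ni; rewrite /d gtn_eqF// c0 ?oppr0// ltnW.
  have [M [dM e]] := synthesis_finite d0.
  have lE : lincomb d f n.+1 = f n \- lincomb c f n.
    rewrite lincombS /d eqxx; apply/funext => x /=; rewrite mul1r; congr (_ + _).
    rewrite /lincomb -sumrN; apply: eq_bigr => i _.
    by rewrite ltn_eqF// mulNr.
  have hl : hset H (lincomb d f n.+1) by exact: ph_lincomb.
  have := inj _ _ dM; rewrite (heq_hnorm pH (hsyn dM) hl e) lE => /(_ fw).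
  by move=> /(congr1 (fun g => g n)); rewrite /d eqxx => /eqP; rewrite oner_eq0.
pose e := gram_schmidt H f.
have he n : hset H (e n) by exact: ph_gram_schmidt.
have eo m n : hdot H (e m) (e n) = (m == n)%:R by exact: gram_schmidt_orthonormal.
(* The partial sums of the frame expansion lie in the spans of the e_k, and orthogonal projections
   approximate at least as well. *)
have ee u : hset H u -> hcvg H (lincomb (analysis H e u) e) u.
  move=> hu.
  have [h1 h2 h3] := Sinv_cvg pH cH hf A0 AB analysis_le analysis_ge hu.
  apply: (hcvg_le _ hu _ h3) => n; first exact: ph_lincomb.
  have : spanned e n (lincomb (ana (Sinv u)) f n).
    apply: spanned_lincomb => k kn.
    apply: (@spanned_mono _ _ _ k.+1) => //.
    exact: spanned_gram_schmidt.
  by move=> [c _ ->]; exact: hexpansion_best.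
pose coef := analysis H e.
have cM u : hset H u -> sqsum (coef u) (hnorm H u ^+ 2) by exact: bessel.
pose L u := syn (coef u).
pose L' v := synthesis H e (ana (Sinv v)).
have hL u : hset H u -> hset H (L u) by move=> /cM/hsyn.
have L'c v : hset H v -> hcvg H (lincomb (ana (Sinv v)) e) (L' v).
  move=> hv; exact: (onb_synthesis_cvg pH cH he eo (analysis_le (hSinv hv))).
have hL' v : hset H v -> hset H (L' v) by move=> /L'c[].
exists e, L; split.
- by split.
- split; first split => //.
  + move=> a u v hu hv.
    rewrite /L (_ : coef _ = (fun n => a * coef u n + coef v n)).
      exact: (synthesis_lin pH cH hf A0 AB analysis_le a (cM _ hu) (cM _ hv)).
    by apply/funext => n; exact: analysis_lin.
  + exists (Num.sqrt B) => u hu.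
    rewrite -ler_sqr ?nnegrE ?mulr_ge0 ?sqrtr_ge0 ?hnorm_ge0// exprMn.
    rewrite (@sqr_sqrtr _ B) ?(ltW B0)//.
    exact: (hnorm_synthesis pH cH hf A0 AB analysis_le (cM _ hu)).
  exists L'; split.
  + split => //.
    * move=> a u v hu hv.
      have hSu := hSinv hu; have hSv := hSinv hv; have hl := ph_lin pH a hu hv.
      have e1 := Sinv_lin pH cH hf A0 AB analysis_le analysis_ge a hu hv.
      rewrite /L' (heq_analysis pH hf (hSinv hl) (ph_lin pH a hSu hSv) e1).
      rewrite (_ : ana _ = (fun n => a * ana (Sinv u) n + ana (Sinv v) n)).
        have h2 : (1 : R) < 2 by rewrite ltr1n.
        exact: (synthesis_lin pH cH he ltr01 h2 (bessel2 pH he eo) a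
                 (analysis_le hSu) (analysis_le hSv)).
      by apply/funext => n; exact: analysis_lin.
    (* The factor 2 is the relaxed bound of [bessel2]; sqrt B bounds the analysis map and 1 / A
       bounds S^-1. *)
    * exists (Num.sqrt (2 * B) / A) => u hu.
      have h2 : (1 : R) < 2 by rewrite ltr1n.
      have h := hnorm_synthesis pH cH he ltr01 h2 (bessel2 pH he eo) (analysis_le (hSinv hu)).
      have B20 : 0 <= 2 * B by rewrite mulr_ge0// ltW.
      have sle := Sinv_le pH cH hf A0 AB analysis_le analysis_ge hu.
      rewrite -mulrA [A^-1 * _]mulrC.
      apply: (@le_trans _ _ (Num.sqrt (2 * B) * hnorm H (Sinv u))).
        rewrite -ler_sqr ?nnegrE ?mulr_ge0 ?sqrtr_ge0 ?hnorm_ge0// exprMn.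
        by rewrite (@sqr_sqrtr _ (2 * B))// -mulrA.
      by rewrite ler_wpM2l// sqrtr_ge0.
  + move=> u hu; rewrite /L' /L (synthesis_injective_analysis inj (cM _ hu)).
    exact: (hcvg_unique pH (onb_synthesis_cvg pH cH he eo (cM _ hu)) (ee u hu)).
  + move=> v hv; rewrite /L /L'.
    rewrite (_ : coef _ = ana (Sinv v)).
      exact: (frop_Sinv pH cH hf A0 AB analysis_le analysis_ge hv).
    apply/funext => n.
    exact: (coef_synthesis pH cH he eo n (analysis_le (hSinv hv))).
- move=> n; rewrite /L.
  have d0 i : (n.+1 <= i)%N -> coef (e n) i = 0.
    by move=> ni; rewrite /coef /analysis eo ltn_eqF.
  have [M [dM h]] := synthesis_finite d0.
  move: h; congr (heq H _ _); rewrite lincombS; apply/funext => x.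
  rewrite /lincomb big1 => [|i _]; last by rewrite /coef /analysis eo gtn_eqF ?mul0r.
  by rewrite addr0 /coef /analysis eo eqxx mul1r.
Qed.

Lemma gram_map_iso_riesz :
  is_onto_isomorphism (l2 R) gram_map <-> is_riesz_basis H f.
Proof.
split; first by move=> /gram_map_iso_injective; exact: injective_riesz.
by move=> /riesz_injective; exact: injective_gram_map_iso.
Qed.

End riesz.

Section frame_bounds.
Variables (R : realType) (T : Type) (H : hspace R T) (f : nat -> T -> R[i]).

Lemma is_frameP : is_frame H f -> exists A B : R,
  [/\ 0 < A, A < B, forall n, hset H (f n),
    forall u, hset H u -> sqsum (analysis H f u) (B * hnorm H u ^+ 2) &
    forall u M, hset H u -> sqsum (analysis H f u) M -> A * hnorm H u ^+ 2 <= M].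
Proof.
move=> [hf [A [B [A0 AB fb]]]]; exists A, B.
have c0 u n : 0 <= nc (hdot H u (f n)) ^+ 2 by exact: sqr_ge0.
split => // u => [hu|M hu uM].
  by have /andP[_ h] := fb u hu; exact: (iffLR (nneseries_leP _ (c0 u)) h).
have /andP[h _] := fb u hu; rewrite -lee_fin (le_trans h)//.
exact: (iffRL (nneseries_leP _ (c0 u)) uM).
Qed.

End frame_bounds.

(** * Integration of complex functions on R^d *)

Section complex_integral.
Context d (T : measurableType d) (R : realType).
Implicit Types (D : set T) (f g : T -> R[i]) (a : R[i]).

Definition cmeas D f : Prop :=
  measurable_fun D (fun x => complex.Re (f x)) /\
  measurable_fun D (fun x => complex.Im (f x)).

Lemma cmeas_cst D a : cmeas D (fun=> a).
Proof. by split; exact: measurable_cst. Qed.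

Lemma cmeas_add D f g : cmeas D f -> cmeas D g -> cmeas D (fun x => f x + g x).
Proof.
move=> [f1 f2] [g1 g2]; split.
- by under eq_fun do rewrite ReD; exact: measurable_funD.
- by under eq_fun do rewrite ImD; exact: measurable_funD.
Qed.

Lemma cmeas_mul D f g : cmeas D f -> cmeas D g -> cmeas D (fun x => f x * g x).
Proof.
move=> [f1 f2] [g1 g2]; split.
- by under eq_fun do rewrite ReM; apply: measurable_funB; exact: measurable_funM.
- by under eq_fun do rewrite ImM; apply: measurable_funD; exact: measurable_funM.
Qed.

Lemma cmeas_conj D f : cmeas D f -> cmeas D (fun x => (f x)^*%C).
Proof.
move=> [f1 f2]; split.
- by under eq_fun do rewrite ReJ.
- by under eq_fun do rewrite ImJ; exact: measurable_funN.
Qed.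

Lemma cmeas_real D (h : T -> R) : measurable_fun D h ->
  cmeas D (fun x => (h x)%:C%C).
Proof. by move=> mh; split => //=; exact: measurable_cst. Qed.

Lemma cmeas_lin D a f g : cmeas D f -> cmeas D g ->
  cmeas D (fun x => a * f x + g x).
Proof. by move=> mf mg; apply: cmeas_add => //; apply: cmeas_mul => //; exact: cmeas_cst. Qed.

Lemma cmeas_nc D f : cmeas D f -> measurable_fun D (fun x => nc (f x)).
Proof.
move=> [f1 f2].
have -> : (fun x => nc (f x)) = (@Num.sqrt R) \o
    (fun x => complex.Re (f x) ^+ 2 + complex.Im (f x) ^+ 2).
  by apply/funext => x /=; case: (f x).
apply: measurableT_comp.
  by apply: continuous_measurable_fun; exact: sqrt_continuous.
by apply: measurable_funD; exact: measurable_funX.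
Qed.

Lemma cmeas_nc2 D f : cmeas D f -> measurable_fun D (fun x => (nc (f x) ^+ 2)%:E).
Proof. by move=> /cmeas_nc mf; apply/measurable_EFinP; exact: measurable_funX. Qed.

Lemma cmeas_sub D D' f : measurable D -> D' `<=` D -> cmeas D f -> cmeas D' f.
Proof. by move=> mD DD [f1 f2]; split; apply: measurable_funS DD _. Qed.

Variable mu : {measure set T -> \bar R}.

(** For [lebesgue_rV] this is convertible to [cRintegral]; the general measure makes room for
    products. *)
Definition cint D f : R[i] :=
  ((\int[mu]_(x in D) complex.Re (f x)) +i* (\int[mu]_(x in D) complex.Im (f x)))%C.

Definition cintegrable D f : Prop :=
  cmeas D f /\ (\int[mu]_(x in D) (nc (f x))%:E < +oo)%E.

Lemma eq_cint D f g : (forall x, D x -> f x = g x) -> cint D f = cint D g.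
Proof.
by move=> fg; congr (_ +i* _)%C; apply: eq_Rintegral => x; rewrite inE => /fg ->.
Qed.

Variable D : set T.
Hypothesis mD : measurable D.

Lemma cintegrable_nc f : cintegrable D f ->
  mu.-integrable D (fun x => (nc (f x))%:E).
Proof.
move=> [mf lf]; apply/integrableP; split.
  by apply/measurable_EFinP; exact: cmeas_nc.
by under eq_integral do rewrite gee0_abs ?lee_fin ?nc_ge0//.
Qed.

Lemma cintegrable_Re f : cintegrable D f ->
  mu.-integrable D (EFin \o (fun x => complex.Re (f x))).
Proof.
move=> fi; have [[m1 m2] _] := fi; apply: le_integrable (cintegrable_nc fi) => //.
  exact/measurable_EFinP.
by move=> x Dx /=; rewrite lee_fin (ger0_norm (nc_ge0 _)) Re_le_nc.
Qed.

Lemma cintegrable_Im f : cintegrable D f ->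
  mu.-integrable D (EFin \o (fun x => complex.Im (f x))).
Proof.
move=> fi; have [[m1 m2] _] := fi; apply: le_integrable (cintegrable_nc fi) => //.
  exact/measurable_EFinP.
by move=> x Dx /=; rewrite lee_fin (ger0_norm (nc_ge0 _)) Im_le_nc.
Qed.

Lemma cintegrable_le f (h : T -> R) : cmeas D f ->
  (forall x, D x -> nc (f x) <= h x) ->
  mu.-integrable D (EFin \o h) -> cintegrable D f.
Proof.
move=> mf fh hi; split => //.
have : mu.-integrable D (fun x => (nc (f x))%:E).
  apply: le_integrable hi => //; first by apply/measurable_EFinP; exact: cmeas_nc.
  move=> x Dx /=; rewrite lee_fin (ger0_norm (nc_ge0 _)).
  by rewrite (le_trans (fh _ Dx))// ler_norm.
move=> /integrableP[_]; under eq_integral do rewrite gee0_abs ?lee_fin ?nc_ge0//.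
by [].
Qed.

Lemma cintegrable_real (h : T -> R) : mu.-integrable D (EFin \o h) ->
  cintegrable D (fun x => (h x)%:C%C).
Proof.
move=> hi; have mh : measurable_fun D h by apply/measurable_EFinP; exact: measurable_int hi.
apply: (@cintegrable_le _ (fun x => `|h x|)); first exact: cmeas_real.
  by move=> x _; rewrite nc_real.
exact: integrable_norm.
Qed.

Lemma cintegrable_lin a f g : cintegrable D f -> cintegrable D g ->
  cintegrable D (fun x => a * f x + g x).
Proof.
move=> fi gi; have [mf _] := fi; have [mg _] := gi.
apply: (@cintegrable_le _ (fun x => nc a * nc (f x) + nc (g x))).
- exact: cmeas_lin.
- by move=> x Dx; rewrite -Normc.normcM; exact: ncD.
- have := integrableD mD (integrableZl mD (nc a) (cintegrable_nc fi)) (cintegrable_nc gi).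
  by apply: eq_integrable.
Qed.

Lemma cint_lin a f g : cintegrable D f -> cintegrable D g ->
  cint D (fun x => a * f x + g x) = a * cint D f + cint D g.
Proof.
move=> fi gi.
have fr := cintegrable_Re fi; have fm := cintegrable_Im fi.
have gr := cintegrable_Re gi; have gm := cintegrable_Im gi.
have zi (c : R) h : mu.-integrable D (EFin \o h) -> mu.-integrable D (EFin \o (fun x => c * h x)).
  by move=> /(integrableZl mD c); apply: eq_integrable.
have di h k : mu.-integrable D (EFin \o h) -> mu.-integrable D (EFin \o k) ->
    mu.-integrable D (EFin \o (fun x => h x + k x)).
  by move=> hi ki; have := integrableD mD hi ki; apply: eq_integrable.
have bi h k : mu.-integrable D (EFin \o h) -> mu.-integrable D (EFin \o k) ->
    mu.-integrable D (EFin \o (fun x => h x - k x)).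
  by move=> hi ki; have := integrableB mD hi ki; apply: eq_integrable.
apply: complex_eqP; rewrite !(ReD, ReM, ImD, ImM) /=.
- under eq_Rintegral do rewrite ReD ReM.
  rewrite RintegralD//; last by apply: bi; exact: zi.
  by rewrite RintegralB//; try exact: zi; rewrite !RintegralZl.
- under eq_Rintegral do rewrite ImD ImM.
  rewrite RintegralD//; last by apply: di; exact: zi.
  by rewrite RintegralD//; try exact: zi; rewrite !RintegralZl.
Qed.

Lemma cint0 : cint D (fun=> 0) = 0.
Proof. by apply: complex_eqP; rewrite /= Rintegral_cst// mul0r. Qed.

Lemma cintegrable0 : cintegrable D (fun=> 0).
Proof. by split; [exact: cmeas_cst|rewrite integral0_eq// => x _; rewrite Normc.normc0]. Qed.

Lemma cintegrableZ a f : cintegrable D f -> cintegrable D (fun x => a * f x).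
Proof.
by move=> fi; have := cintegrable_lin a fi cintegrable0; under eq_fun do rewrite addr0.
Qed.

Lemma cintZ a f : cintegrable D f -> cint D (fun x => a * f x) = a * cint D f.
Proof.
move=> fi; have := cint_lin a fi cintegrable0.
by under eq_cint do rewrite addr0; rewrite cint0 addr0.
Qed.

Lemma cintegrableD f g : cintegrable D f -> cintegrable D g ->
  cintegrable D (fun x => f x + g x).
Proof.
by move=> fi gi; have := cintegrable_lin 1 fi gi; under eq_fun do rewrite mul1r.
Qed.

Lemma cintD f g : cintegrable D f -> cintegrable D g ->
  cint D (fun x => f x + g x) = cint D f + cint D g.
Proof.
by move=> fi gi; have := cint_lin 1 fi gi; under eq_cint do rewrite mul1r; rewrite mul1r.
Qed.

Lemma cintegrableB f g : cintegrable D f -> cintegrable D g ->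
  cintegrable D (fun x => f x - g x).
Proof.
move=> fi gi; have := cintegrable_lin (-1) gi fi.
by under eq_fun do rewrite mulN1r addrC.
Qed.

Lemma cintB f g : cintegrable D f -> cintegrable D g ->
  cint D (fun x => f x - g x) = cint D f - cint D g.
Proof.
move=> fi gi; have := cint_lin (-1) gi fi.
by under eq_cint do rewrite mulN1r addrC; rewrite mulN1r addrC.
Qed.

Lemma cintegrable_sum (N : nat) (F : nat -> T -> R[i]) :
  (forall n, cintegrable D (F n)) -> cintegrable D (fun x => \sum_(n < N) F n x).
Proof.
move=> Fi; elim: N => [|N IH].
  by under eq_fun do rewrite big_ord0; exact: cintegrable0.
by under eq_fun do rewrite big_ord_recr; exact: cintegrableD.
Qed.

Lemma cint_sum (N : nat) (F : nat -> T -> R[i]) :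
  (forall n, cintegrable D (F n)) ->
  cint D (fun x => \sum_(n < N) F n x) = \sum_(n < N) cint D (F n).
Proof.
move=> Fi; elim: N => [|N IH].
  by under eq_cint do rewrite big_ord0; rewrite big_ord0 cint0.
under eq_cint do rewrite big_ord_recr.
by rewrite cintD//= ?big_ord_recr ?IH//; exact: cintegrable_sum.
Qed.

Lemma cint_conj f : cintegrable D f ->
  cint D (fun x => (f x)^*%C) = (cint D f)^*%C.
Proof.
move=> fi; apply: complex_eqP; rewrite ?ReJ ?ImJ /=.
  by apply: eq_Rintegral => x _; rewrite ReJ.
under eq_Rintegral do rewrite ImJ -mulN1r.
by rewrite RintegralZl ?mulN1r//; exact: cintegrable_Im.
Qed.

Lemma cintegrable_conj f : cintegrable D f -> cintegrable D (fun x => (f x)^*%C).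
Proof.
move=> [mf fi]; split; first exact: cmeas_conj.
by under eq_integral do rewrite nc_conj.
Qed.

(** Real and imaginary parts are bounded separately, whence the factor 2 that recurs in later
    estimates. *)
Lemma nc_cint f : cintegrable D f ->
  nc (cint D f) <= 2 * \int[mu]_(x in D) nc (f x).
Proof.
move=> fi; rewrite (le_trans (nc_le_ReIm _))// mulr_natl mulr2n.
have ni := cintegrable_nc fi.
have fr := cintegrable_Re fi; have fm := cintegrable_Im fi.
apply: lerD.
- rewrite (le_trans (le_normr_Rintegral mD fr))// le_Rintegral//.
    exact: integrable_norm.
  by move=> x _; exact: Re_le_nc.
- rewrite (le_trans (le_normr_Rintegral mD fm))// le_Rintegral//.
    exact: integrable_norm.
  by move=> x _; exact: Im_le_nc.
Qed.

Lemma cintegrable_bounded_mul f g (M : R) : cintegrable D f -> cmeas D g ->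
  (forall x, D x -> nc (g x) <= M) -> cintegrable D (fun x => f x * g x).
Proof.
move=> fi mg gM; have [mf _] := fi.
apply: (@cintegrable_le _ (fun x => M * nc (f x))).
- exact: cmeas_mul.
- by move=> x Dx; rewrite Normc.normcM mulrC ler_wpM2r ?nc_ge0// gM.
- by have := integrableZl mD M (cintegrable_nc fi); apply: eq_integrable.
Qed.

Lemma cint_mkcond f : cint D f = cint setT (fun x => if x \in D then f x else 0).
Proof.
apply: complex_eqP => /=; rewrite Rintegral_mkcond; apply: eq_Rintegral => x _;
  by rewrite /patch; case: ifP.
Qed.

Lemma cmeas_mkcond f : cmeas D f -> cmeas setT (fun x => if x \in D then f x else 0).
Proof.
move=> [f1 f2]; split.
- have := (measurable_restrictT _ mD).1 f1; congr (measurable_fun _ _).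
  by apply/funext => x; rewrite /patch; case: ifP.
- have := (measurable_restrictT _ mD).1 f2; congr (measurable_fun _ _).
  by apply/funext => x; rewrite /patch; case: ifP.
Qed.

End complex_integral.

(** * Fubini's theorem for complex functions *)

Section complex_fubini.
Context d1 d2 (T1 : measurableType d1) (T2 : measurableType d2) (R : realType).
Variables (m1 : {sigma_finite_measure set T1 -> \bar R})
          (m2 : {sigma_finite_measure set T2 -> \bar R}).

(** The inner real integral is [fine] of an extended one that is finite only almost everywhere,
    hence the use of [ae_eq_integral]. *)
Lemma Rintegral_fubini1 (f : T1 * T2 -> R) :
  (m1 \x m2)%E.-integrable setT (EFin \o f) ->
  \int[m1]_x \int[m2]_y f (x, y) = \int[(m1 \x m2)%E]_z f z.
Proof.
move=> fi; rewrite [RHS]/Rintegral -(integral12_prod_meas1 fi).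
have Fi := integrable_fubini_F fi.
rewrite /Rintegral; congr fine; apply: ae_eq_integral => //.
- apply/measurable_EFinP; apply: (measurableT_comp (@fine_measurable R setT measurableT)).
  exact: measurable_int Fi.
- exact: measurable_int Fi.
- have := integrable_ae measurableT Fi; apply: filterS => x /(_ I) xF _.
  by rewrite /= fineK.
Qed.

Lemma Rintegral_fubini2 (f : T1 * T2 -> R) :
  (m1 \x m2)%E.-integrable setT (EFin \o f) ->
  \int[m2]_y \int[m1]_x f (x, y) = \int[(m1 \x m2)%E]_z f z.
Proof.
move=> fi; rewrite [RHS]/Rintegral -(integral21_prod_meas1 fi).
have mf := measurable_int _ fi.
have Fi : m2.-integrable setT (fubini_G m1 (EFin \o f)).
  apply/integrableP; split; first exact: (measurable_fubini_G fi).
  apply: (le_lt_trans _ ((integrable21ltyP m1 m2 mf).1 fi)).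
  apply: ge0_le_integral => //.
  - by apply: measurableT_comp => //; exact: (measurable_fubini_G fi).
  - apply: (measurable_fun_fubini_tonelli_G (abse \o (EFin \o f))).
      exact: measurableT_comp.
    by move=> z; rewrite /= lee_fin normr_ge0.
  - move=> y _; apply: le_abse_integral => //.
    exact: (measurableT_comp mf (pair2_measurable y)).
rewrite /Rintegral; congr fine; apply: ae_eq_integral => //.
- apply/measurable_EFinP; apply: (measurableT_comp (@fine_measurable R setT measurableT)).
  exact: measurable_int Fi.
- exact: measurable_int Fi.
- have := integrable_ae measurableT Fi; apply: filterS => x /(_ I) xF _.
  by rewrite /= fineK.
Qed.

Lemma cint_fubini1 (w : T1 * T2 -> R[i]) : cintegrable (m1 \x m2)%E setT w ->
  cint m1 setT (fun x => cint m2 setT (fun y => w (x, y))) = cint (m1 \x m2)%E setT w.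
Proof.
move=> wi; apply: complex_eqP => /=.
- by rewrite -Rintegral_fubini1//; exact: cintegrable_Re.
- by rewrite -Rintegral_fubini1//; exact: cintegrable_Im.
Qed.

Lemma cint_fubini2 (w : T1 * T2 -> R[i]) : cintegrable (m1 \x m2)%E setT w ->
  cint m2 setT (fun y => cint m1 setT (fun x => w (x, y))) = cint (m1 \x m2)%E setT w.
Proof.
move=> wi; apply: complex_eqP => /=.
- by rewrite -Rintegral_fubini2//; exact: cintegrable_Re.
- by rewrite -Rintegral_fubini2//; exact: cintegrable_Im.
Qed.

Lemma cmeas_comp d (T : measurableType d) d' (T' : measurableType d')
  (h : T -> T') (f : T' -> R[i]) :
  measurable_fun setT h -> cmeas setT f -> cmeas setT (f \o h).
Proof. by move=> mh [f1 f2]; split; [exact: measurableT_comp f1 mh|exact: measurableT_comp f2 mh]. Qed.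

(** A product of two integrable functions times a bounded kernel: characters and triangles are both
    used as k. *)
Lemma cintegrable_prod (u : T1 -> R[i]) (v : T2 -> R[i]) (k : T1 * T2 -> R[i]) (M : R) :
  cintegrable m1 setT u -> cintegrable m2 setT v -> cmeas setT k ->
  (forall z, nc (k z) <= M) ->
  cintegrable (m1 \x m2)%E setT (fun z => u z.1 * v z.2 * k z).
Proof.
move=> [mu ui] [mv vi] mk kM.
have mu1 : cmeas setT (fun z : T1 * T2 => u z.1) by exact: (cmeas_comp measurable_fst mu).
have mv2 : cmeas setT (fun z : T1 * T2 => v z.2) by exact: (cmeas_comp measurable_snd mv).
have muv := cmeas_mul mu1 mv2.
suff : cintegrable (m1 \x m2)%E setT (fun z => u z.1 * v z.2).
  by move=> h; apply: (cintegrable_bounded_mul (M := M) measurableT h mk).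
split => //.
have mn : measurable_fun setT (fun z : T1 * T2 => (nc (u z.1 * v z.2))%:E).
  by apply/measurable_EFinP; exact: cmeas_nc.
rewrite fubini_tonelli1//; last by move=> z; rewrite lee_fin nc_ge0.
have mv' : measurable_fun setT (fun y => (nc (v y))%:E).
  by apply/measurable_EFinP; exact: cmeas_nc.
have mu' : measurable_fun setT (fun y => (nc (u y))%:E).
  by apply/measurable_EFinP; exact: cmeas_nc.
rewrite /fubini_F /=.
under eq_integral => x _.
  under eq_integral => y _ do rewrite Normc.normcM EFinM.
  rewrite ge0_integralZl//; last 2 first.
    by move=> y _; rewrite lee_fin nc_ge0.
    by rewrite lee_fin nc_ge0.
  over.
rewrite ge0_integralZr//; last 2 first.
  by move=> x _; rewrite lee_fin nc_ge0.
  by apply: integral_ge0 => y _; rewrite lee_fin nc_ge0.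
rewrite lte_mul_pinfty//; first by apply: integral_ge0 => y _; rewrite lee_fin nc_ge0.
by rewrite ge0_fin_numE//; apply: integral_ge0 => y _; rewrite lee_fin nc_ge0.
Qed.

Lemma cint_mul_swap (u : T1 -> R[i]) (v : T2 -> R[i]) (k : T1 * T2 -> R[i]) (M : R) :
  cintegrable m1 setT u -> cintegrable m2 setT v -> cmeas setT k ->
  (forall z, nc (k z) <= M) ->
  cint m1 setT (fun x => u x * cint m2 setT (fun y => v y * k (x, y))) =
  cint m2 setT (fun y => v y * cint m1 setT (fun x => u x * k (x, y))).
Proof.
move=> ui vi mk kM; have wi := cintegrable_prod ui vi mk kM.
have k1 x : cmeas setT (fun y => k (x, y)).
  exact: (cmeas_comp (pair1_measurable x) mk).
have k2 y : cmeas setT (fun x => k (x, y)).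
  exact: (cmeas_comp (pair2_measurable y) mk).
transitivity (cint (m1 \x m2)%E setT (fun z => u z.1 * v z.2 * k z)).
- rewrite -cint_fubini1//; apply: eq_cint => x _ /=.
  rewrite -cintZ//; first by apply: eq_cint => y _; rewrite mulrA.
  by apply: (@cintegrable_bounded_mul _ _ _ _ _ _ _ _ M).
- rewrite -cint_fubini2//; apply: eq_cint => y _ /=.
  rewrite -cintZ//; first by apply: eq_cint => x _; rewrite mulrCA mulrA.
  by apply: (@cintegrable_bounded_mul _ _ _ _ _ _ _ _ M).
Qed.

Lemma cint_mul_prod (u : T1 -> R[i]) (v : T2 -> R[i]) :
  cintegrable m1 setT u -> cintegrable m2 setT v ->
  cintegrable (m1 \x m2)%E setT (fun z => u z.1 * v z.2) /\
  cint (m1 \x m2)%E setT (fun z => u z.1 * v z.2) = cint m1 setT u * cint m2 setT v.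
Proof.
move=> ui vi.
have wi : cintegrable (m1 \x m2)%E setT (fun z => u z.1 * v z.2).
  have := @cintegrable_prod u v (fun=> 1) 1 ui vi (cmeas_cst _ _).
  under eq_fun do rewrite mulr1.
  by apply => z; rewrite Normc.normc1.
split => //; rewrite -cint_fubini1//=.
under eq_cint do rewrite cintZ// mulrC.
by rewrite cintZ// mulrC.
Qed.

End complex_fubini.

(** * The Hilbert space L_2(D) and its completeness *)

Section L2_hilbert.
Variables (R : realType) (d : nat) (D : set 'rV[R]_d).
Hypothesis mD : measurable D.
Implicit Types (u v w : 'rV[R]_d -> R[i]) (a : R[i]).

Local Notation mu := (lebesgue_rV R d).
Local Notation L2D := (L2 D).

Lemma hset_L2P u : hset L2D u <->
  cmeas D u /\ (\int[mu]_(x in D) (nc (u x) ^+ 2)%:E < +oo)%E.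
Proof. by split => [[]//|[[]//]]. Qed.

Lemma nc2_integrable u : hset L2D u ->
  mu.-integrable D (fun x => (nc (u x) ^+ 2)%:E).
Proof.
move=> /hset_L2P[mu' ui]; apply/integrableP; split; first exact: cmeas_nc2.
by under eq_integral do rewrite gee0_abs ?lee_fin ?sqr_ge0//.
Qed.

Lemma L2_mul_integrable u v : hset L2D u -> hset L2D v ->
  cintegrable mu D (fun x => u x * (v x)^*%C).
Proof.
move=> hu hv; have /hset_L2P[mu' _] := hu; have /hset_L2P[mv _] := hv.
apply: (@cintegrable_le _ _ _ _ _ mD _ (fun x => nc (u x) ^+ 2 + nc (v x) ^+ 2)).
- by apply: cmeas_mul => //; exact: cmeas_conj.
- move=> x Dx; rewrite Normc.normcM nc_conj.
  have := sqr_ge0 (nc (u x) - nc (v x)); rewrite sqrrB.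
  by have := sqr_ge0 (nc (u x)); have := sqr_ge0 (nc (v x)); lra.
- have := integrableD mD (nc2_integrable hu) (nc2_integrable hv).
  by apply: eq_integrable.
Qed.

Lemma L2_lin a u v : hset L2D u -> hset L2D v ->
  hset L2D (fun x => a * u x + v x).
Proof.
move=> hu hv; have /hset_L2P[mu' _] := hu; have /hset_L2P[mv _] := hv.
have ml := cmeas_lin a mu' mv; apply/hset_L2P; split => //.
have h : mu.-integrable D
    (fun x => (2 * nc a ^+ 2 * nc (u x) ^+ 2 + 2 * nc (v x) ^+ 2)%:E).
  have := integrableD mD (integrableZl mD (2 * nc a ^+ 2) (nc2_integrable hu))
    (integrableZl mD 2 (nc2_integrable hv)).
  by apply: eq_integrable.
have /integrableP[_] : mu.-integrable D (fun x => (nc (a * u x + v x) ^+ 2)%:E).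
  apply: le_integrable h => //; first exact: cmeas_nc2.
  move=> x Dx; rewrite /= lee_fin ger0_norm ?sqr_ge0// (le_trans _ (ler_norm _))//.
  rewrite (@le_trans _ _ ((nc a * nc (u x) + nc (v x)) ^+ 2))//.
    rewrite ler_sqr ?nnegrE ?addr_ge0 ?mulr_ge0 ?nc_ge0//.
    by rewrite -Normc.normcM ncD.
  by have := sqr_ge0 (nc a * nc (u x) - nc (v x)); rewrite sqrrB sqrrD !exprMn; lra.
by under eq_integral do rewrite gee0_abs ?lee_fin ?sqr_ge0//.
Qed.

Lemma L2_dot_self u : hset L2D u ->
  complex.Re (hdot L2D u u) = \int[mu]_(x in D) (nc (u x) ^+ 2).
Proof. by move=> hu /=; apply: eq_Rintegral => x _; rewrite mul_conj. Qed.

Lemma L2_prehilbert : prehilbert L2D.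
Proof.
split.
- apply/hset_L2P; split; first exact: cmeas_cst.
  by rewrite integral0_eq// => x _; rewrite Normc.normc0 expr0n.
- by move=> a u v; exact: L2_lin.
- move=> a u v w hu hv hw.
  transitivity (cint mu D (fun x => a * (u x * (w x)^*%C) + v x * (w x)^*%C)).
    by apply: eq_cint => x _; rewrite mulrDl mulrA.
  by rewrite cint_lin//; exact: L2_mul_integrable.
- move=> u v hu hv.
  transitivity (cint mu D (fun x => (u x * (v x)^*%C)^*%C)).
    by apply: eq_cint => x _; rewrite conjM conjK mulrC.
  by rewrite cint_conj//; exact: L2_mul_integrable.
- move=> u hu; rewrite L2_dot_self//; apply: Rintegral_ge0 => x _.
  exact: sqr_ge0.
Qed.

Lemma L2_normE u : hset L2D u ->
  ((hnorm L2D u ^+ 2)%:E = \int[mu]_(x in D) (nc (u x) ^+ 2)%:E)%E.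
Proof.
move=> hu; rewrite (hnorm_sqr L2_prehilbert hu) L2_dot_self// /Rintegral fineK//.
apply: integrable_fin_num => //; exact: nc2_integrable.
Qed.

Lemma limn_einf_le (a : nat -> \bar R) (c : \bar R) K :
  (forall k, (K <= k)%N -> (a k <= c)%E) -> (limn_einf a <= c)%E.
Proof.
move=> h; rewrite limn_einf_lim; apply: lime_le; first exact: is_cvg_einfs.
near=> n; apply: (@le_trans _ _ (a n)).
  by apply: ereal_inf_lbound; exists n => //=.
by apply: h; near: n; exact: nbhs_infty_ge.
Unshelve. all: by end_near. Qed.

Lemma limn_einf_ge0 (a : nat -> \bar R) : (forall k, 0 <= a k)%E ->
  (0 <= limn_einf a)%E.
Proof.
move=> a0; rewrite limn_einf_lim; apply: lime_ge; first exact: is_cvg_einfs.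
apply: nearW => n; apply: le_ereal_inf_tmp => _ [k _ <-]; exact: a0.
Qed.

Lemma geometric_cvg (b : nat -> R) (C : R) :
  (forall k, `|b k.+1 - b k| <= C * 2^-1 ^+ k) -> cvgn b.
Proof.
move=> h; have C0 : 0 <= C by apply: le_trans (normr_ge0 _) _; have := h 0%N; rewrite mulr1; exact.
have : cvgn [series b k.+1 - b k]_k.
  apply: normed_cvg; apply: (series_le_cvg (v_ := geometric C 2^-1)).
  - by move=> k; exact: normr_ge0.
  - by move=> k; rewrite /= mulr_ge0// exprn_ge0.
  - by move=> k; exact: h.
  - by apply: is_cvg_geometric_series; rewrite ger0_norm// invf_lt1// ltr1n.
have -> : [series b k.+1 - b k]_k = (fun n => b n - b 0%N).
  by apply/funext => n; rewrite /series /= telescope_sumr.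
move=> /cvg_ex[/= l bl]; apply/cvg_ex; exists (l + b 0%N).
have : (fun n => b n - b 0%N + b 0%N) @ \oo --> l + b 0%N.
  by apply: cvgD => //; exact: cvg_cst.
by under eq_fun do rewrite subrK.
Qed.

(** Riesz-Fischer. Along a subsequence with increments of norm at most 4^-k, the sum [phi] of the
    4^k |dl_k|^2 is integrable, since its k-th term has integral at most 4^k 16^-k. Where [phi] is
    finite, |dl_k| <= sqrt(phi) 2^-k, so the subsequence converges pointwise. *)
Lemma L2_complete : hcomplete L2D.
Proof.
have pH := L2_prehilbert.
move=> u_ hu_ cau.
have /choice[N hN] : forall k : nat, exists N : nat, forall m n, (N <= m <= n)%N ->
    hnorm L2D (u_ n \- u_ m) <= 4^-1 ^+ k.
  by move=> k; apply: cau; rewrite exprn_gt0.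
(* Summing the thresholds makes the indices monotone and at least both [N k] and k. *)
pose nk k := (\sum_(j < k.+1) (N j).+1)%N.
have nkS k : (nk k <= nk k.+1)%N by rewrite /nk [leqRHS]big_ord_recr leq_addr.
have Nnk k : (N k <= nk k)%N.
  by rewrite /nk big_ord_recr /= (leq_trans (leqnSn _))// leq_addl.
have knk k : (k <= nk k)%N.
  by elim: k => // k IH; rewrite /nk big_ord_recr /= addnS ltnS (leq_trans IH)// leq_addr.
pose v k := u_ (nk k).
have hv k : hset L2D (v k) by exact: hu_.
have mv k : cmeas D (v k) by have /hset_L2P[] := hv k.
pose dl k := v k.+1 \- v k.
have hdl k : hset L2D (dl k) by exact: ph_sub.
have ndl k : hnorm L2D (dl k) <= 4^-1 ^+ k by apply: hN; rewrite Nnk nkS.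
pose phi x : \bar R := (\sum_(0 <= k <oo) (4 ^+ k * nc (dl k x) ^+ 2)%:E)%E.
have p0 k x : (0 <= (4 ^+ k * nc (dl k x) ^+ 2)%:E)%E.
  by rewrite lee_fin mulr_ge0 ?sqr_ge0// exprn_ge0.
have mp k : measurable_fun D (fun x => (4 ^+ k * nc (dl k x) ^+ 2)%:E).
  have /hset_L2P[md _] := hdl k; apply/measurable_EFinP.
  by apply: measurable_funM => //; apply: measurable_funX; exact: cmeas_nc.
have phi_int : (\int[mu]_(x in D) phi x < +oo)%E.
  rewrite /phi integral_nneseries//.
  apply: (@le_lt_trans _ _ (\sum_(0 <= k <oo) (4^-1 ^+ k)%:E)%E).
    apply: lee_nneseries => [k _ _|k _].
      by apply: integral_ge0 => x _; exact: p0.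
    under eq_integral do rewrite EFinM.
    have md2 : measurable_fun D (fun x => (nc (dl k x) ^+ 2)%:E).
      by apply: cmeas_nc2; have /hset_L2P[] := hdl k.
    have k4 : 0 <= 4 ^+ k :> R by rewrite exprn_ge0.
    rewrite (ge0_integralZl_EFin _ _ _ md2 k4)//; last first.
      by move=> x _; rewrite lee_fin sqr_ge0.
    rewrite -L2_normE// -EFinM lee_fin.
    have h : hnorm L2D (dl k) ^+ 2 <= (4^-1 ^+ k) ^+ 2.
      by rewrite ler_sqr ?nnegrE ?hnorm_ge0// exprn_ge0.
    rewrite (le_trans (ler_wpM2l _ h)) ?exprn_ge0//.
    by rewrite expr2 mulrA -exprMn divff// expr1n mul1r.
  apply: (@le_lt_trans _ _ 2%:E); last exact: ltry.
  apply: (iffRL (@nneseries_leP _ (fun k => 4^-1 ^+ k) 2 _)) => [k|n]; first by rewrite exprn_ge0.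
  have -> : \sum_(k < n) 4^-1 ^+ k = (4 / 3) * (1 - 4^-1 ^+ n) :> R.
    elim: n => [|n IH]; first by rewrite big_ord0 expr0 subrr mulr0.
    by rewrite big_ord_recr /= IH exprS; field.
  have : 0 <= 4^-1 ^+ n :> R by rewrite exprn_ge0.
  by lra.
have mphi : measurable_fun D phi.
  by apply: ge0_emeasurable_sum => // k x _ _; exact: p0.
have phi0 x : (0 <= phi x)%E by apply: nneseries_ge0 => k _ _; exact: p0.
have phi_ae : {ae mu, forall x, D x -> phi x \is a fin_num}.
  apply: integrable_ae => //; apply/integrableP; split => //.
  by under eq_integral do rewrite gee0_abs//.
(* An upper limit is defined and measurable everywhere, and equals the limit wherever [phi] is
   finite. *)
pose wr x : R := fine (limn_esup (fun k => (complex.Re (v k x))%:E)).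
pose wi x : R := fine (limn_esup (fun k => (complex.Im (v k x))%:E)).
pose w x : R[i] := (wr x +i* wi x)%C.
have mw : cmeas D w.
  have fm (g : 'rV[R]_d -> \bar R) : measurable_fun D g ->
      measurable_fun D (fun x => fine (g x)).
    move=> mg; exact: (measurableT_comp (@fine_measurable R setT measurableT) mg).
  split; apply: fm; apply: measurable_fun_limn_esup => k.
  - by apply/measurable_EFinP; case: (mv k).
  - by apply/measurable_EFinP; case: (mv k).
have esupE (b : nat -> R) : cvgn b -> b @ \oo --> fine (limn_esup (EFin \o b)).
  move=> /cvg_ex[l bl].
  have el : (EFin \o b) @ \oo --> l%:E by apply: cvg_EFin => //; exact: nearW.
  by rewrite (cvg_limn_einf_sup el).
have w_cvg x : D x -> phi x \is a fin_num -> ccvg (v ^~ x) (w x).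
  move=> Dx phx.
  have tb k : 4 ^+ k * nc (dl k x) ^+ 2 <= fine (phi x).
    rewrite -lee_fin fineK//.
    apply: le_trans (nneseries_lim_ge k.+1 (fun n _ _ => p0 n x)).
    rewrite big_mkord big_ord_recr /= leeDr//.
    by apply: sume_ge0 => i _; exact: p0.
  have sp : 0 <= fine (phi x) by rewrite fine_ge0.
  have tb2 k : nc (dl k x) <= Num.sqrt (fine (phi x)) * 2^-1 ^+ k.
    rewrite -ler_sqr ?nnegrE ?nc_ge0 ?mulr_ge0 ?sqrtr_ge0 ?exprn_ge0//.
    rewrite exprMn (@sqr_sqrtr _ (fine _))//.
    have p4 : 0 < 4 ^+ k :> R by rewrite exprn_gt0.
    rewrite -(ler_pM2l p4) (le_trans (tb k))// -exprM mulnC exprM.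
    rewrite mulrCA -exprMn (_ : 4 * 2^-1 ^+ 2 = 1 :> R) ?expr1n ?mulr1//.
    by field.
  have cr : cvgn (fun k => complex.Re (v k x)).
    apply: (@geometric_cvg _ (Num.sqrt (fine (phi x)))) => k.
    by apply: le_trans (tb2 k); rewrite -ReN -ReD; exact: Re_le_nc.
  have ci : cvgn (fun k => complex.Im (v k x)).
    apply: (@geometric_cvg _ (Num.sqrt (fine (phi x)))) => k.
    by apply: le_trans (tb2 k); rewrite -ImN -ImD; exact: Im_le_nc.
  have cr' := esupE _ cr; have ci' := esupE _ ci.
  apply: (@ccvg_le _ _ _ (fun k => `|complex.Re (v k x) - wr x| +
      `|complex.Im (v k x) - wi x|)).
    by move=> k; rewrite (le_trans (nc_le_ReIm _))// !(ReD, ReN, ImD, ImN).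
  have sub0 (b : nat -> R) l : b @ \oo --> l -> (fun k => `|b k - l|) @ \oo --> (0 : R).
    by move=> bl; rewrite -(normr0 R) -(subrr l); apply: cvg_norm; apply: cvgB => //; exact: cvg_cst.
  rewrite -(addr0 (0 : R)); apply: cvgD; exact: sub0.
(* Fatou's lemma in k, for fixed m: a bound on the distance from [u_ m] to [v k] passes to the
   pointwise limit w. *)
have key e m K : 0 < e -> (forall k, (K <= k)%N -> hnorm L2D (v k \- u_ m) <= e) ->
    (\int[mu]_(x in D) (nc (w x - u_ m x) ^+ 2)%:E <= (e ^+ 2)%:E)%E.
  move=> e0 hK.
  have /hset_L2P[mum _] := hu_ m.
  have mvm k : cmeas D (v k \- u_ m) by have /hset_L2P[] := ph_sub pH (hv k) (hu_ m).
  have mwm : cmeas D (w \- u_ m) by rewrite subE; exact: cmeas_lin.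
  pose F k x := (nc (v k x - u_ m x) ^+ 2)%:E.
  have mF k : measurable_fun D (F k) by exact: (cmeas_nc2 (mvm k)).
  have F0 k x : (0 <= F k x)%E by rewrite lee_fin sqr_ge0.
  have -> : (\int[mu]_(x in D) (nc (w x - u_ m x) ^+ 2)%:E =
      \int[mu]_(x in D) limn_einf (F ^~ x))%E.
    apply: ge0_ae_eq_integral => //.
    - exact: (cmeas_nc2 mwm).
    - rewrite /limn_einf; apply: measurableT_comp => //.
      by apply: measurable_fun_limn_esup => k; exact: measurableT_comp.
    - by move=> x _; rewrite lee_fin sqr_ge0.
    - by move=> x _; apply: limn_einf_ge0.
    apply: filterS phi_ae => x h Dx; have {h} cw := w_cvg x Dx (h Dx).
    have : F ^~ x @ \oo --> (nc (w x - u_ m x) ^+ 2)%:E.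
      apply: cvg_EFin; first exact: nearW.
      have : (fun k => nc (v k x - u_ m x)) @ \oo --> nc (w x - u_ m x).
        apply/cvgrPdist_le => e1 e10; have /cvgr0_norm_le/(_ e1 e10) := cw.
        apply: filterS => k; rewrite ger0_norm ?nc_ge0// => h.
        apply: le_trans h; rewrite ler_norml.
        have t1 := ncD (v k x - w x) (w x - u_ m x).
        have t2 := ncD (w x - v k x) (v k x - u_ m x).
        rewrite addrA subrK in t1; rewrite addrA subrK in t2.
        by rewrite (ncB (w x)) in t2; apply/andP; split; lra.
      by move=> h; apply: (cvgM h h).
    by move=> /cvg_limn_einf_sup ->.
  apply: le_trans (fatou mu mD mF (fun n x _ => F0 n x)) _.
  apply: (@limn_einf_le _ _ K) => k Kk.
  rewrite -(@L2_normE (v k \- u_ m)); last exact: ph_sub.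
  by rewrite lee_fin ler_sqr ?nnegrE ?hnorm_ge0 ?(ltW e0)// hK.
have cauv e : 0 < e -> exists K, forall m, (K <= m)%N ->
    forall k, (m <= k)%N -> hnorm L2D (v k \- u_ m) <= e.
  move=> e0; have [K hK] := cau e e0; exists K => m Km k mk.
  by apply: hK; rewrite Km (leq_trans mk).
have hw : hset L2D w.
  have [K /(_ K (leqnn _)) hK] := cauv 1 ltr01.
  have wu : hset L2D (w \- u_ K).
    apply/hset_L2P; split.
      by rewrite subE; apply: cmeas_lin => //; have /hset_L2P[] := hu_ K.
    by apply: le_lt_trans (key 1 K K ltr01 hK) _; rewrite ltry.
  have := L2_lin 1 wu (hu_ K); congr (hset _ _); apply/funext => x /=.
  by rewrite mul1r subrK.
exists w; split => //; apply/cvgr0Pnorm_le => e e0.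
have [K hK] := cauv e e0; near=> m.
have Km : (K <= m)%N by near: m; exact: nbhs_infty_ge.
rewrite ger0_norm ?hnorm_ge0// (hnormN pH)// -ler_sqr ?nnegrE ?hnorm_ge0 ?(ltW e0)//.
rewrite -lee_fin L2_normE; last exact: ph_sub.
exact: key (hK m Km).
Unshelve. all: by end_near. Qed.

End L2_hilbert.

(** * Borel sets of R^d *)

Section rV_borel.
Variables (R : realType) (d : nat).
Implicit Types (x y : 'rV[R]_d) (A U : set 'rV[R]_d).

Lemma rV_norm_leP x (r : R) : 0 <= r -> `|x| <= r <-> forall i, `|x ord0 i| <= r.
Proof.
move=> r0; rewrite /Num.norm /= mx_normrE; split.
  move=> /bigmax_leP[_ h] i; exact: (h (ord0, i)).
move=> h; apply/bigmax_leP; split => // -[i j] _ /=.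
by rewrite (ord1 i) h.
Qed.

Lemma measurable_coords (B : 'I_d -> set R) :
  (forall i, measurable (B i : set (measurableTypeR R))) ->
  measurable [set x : 'rV[R]_d | forall i, B i (x ord0 i)].
Proof.
move=> mB; rewrite (_ : [set x | _] =
    \bigcap_(i in [set: 'I_d]) ((fun x : 'rV[R]_d =>
    x ord0 i : measurableTypeR R) @^-1` B i)).
  apply: fin_bigcap_measurable => // i _; rewrite -[X in measurable X]setTI.
  by apply: measurable_coord.
by apply/seteqP; split => x /= H i; [move=> _; exact: H|exact: (H i I)].
Qed.

Let rbox (p : 'rV[rat]_d * nat) : set 'rV[R]_d :=
  [set x | forall i, ball (ratr (p.1 ord0 i) : R) (p.2.+1%:R^-1) (x ord0 i)].

Let measurable_rbox p : measurable (rbox p).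
Proof. by apply: (measurable_coords (B := fun i => ball (ratr (p.1 ord0 i) : R) p.2.+1%:R^-1)) => i; exact: measurable_ball. Qed.

(** The sigma-algebra is generated by coordinates, so U is written as the countable union of the
    boxes inside it that have rational centre and radius 1 / (n + 1). *)
Lemma open_measurable_rV U : open U -> measurable U.
Proof.
move=> oU.
have -> : U = \bigcup_(p : 'rV[rat]_d * nat) (if `[< rbox p `<=` U >] then rbox p else set0).
  apply/seteqP; split => [x Ux|x [p _]]; last by case: asboolP => // h /h.
  have /nbhs_ballP[e /= e0 eU] : nbhs x U by exact: open_nbhs_nbhs.
  (* Half of e, because x and y each lie within 1 / (n + 1) of the rational centre. *)
  have [n ne] : exists n : nat, n.+1%:R^-1 < e / 2.
    have e20 : 0 < e / 2 by rewrite divr_gt0.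
    exists (Num.truncn (e / 2)^-1); rewrite invf_plt ?posrE//.
    by rewrite truncnS_gt.
  have /choice[q hq] : forall i : 'I_d, exists q : rat, ball (ratr q : R) (n.+1%:R^-1) (x ord0 i).
    move=> i; have : x ord0 i - n.+1%:R^-1 < x ord0 i + n.+1%:R^-1.
      by rewrite ltrD2l gt0_cp// invr_gt0.
    move=> /rat_in_itvoo[q]; rewrite in_itv /= => /andP[h1 h2].
    exists q; rewrite /ball /=; move: h1 h2.
    move: (ratr q) (x ord0 i) (n.+1%:R^-1) => a b c h1 h2.
    by rewrite ltr_norml; apply/andP; split; lra.
  exists (\row_i q i, n) => //; case: asboolP => [_ i|]; first by rewrite mxE.
  case=> y hy; apply: eU; split => // i j; rewrite (ord1 i).
  have := hy j; have := hq j; rewrite /= mxE /ball /=; move: ne.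
  move: (ratr (q j)) (x ord0 j) (y ord0 j) (n.+1%:R^-1) => a b c r ne.
  rewrite !ltr_norml => /andP[h1 h2] /andP[h3 h4].
  by apply/andP; split; lra.
apply: countable_bigcupT_measurable; first exact: countableP.
by move=> p; case: asboolP.
Qed.

Lemma closed_measurable_rV A : closed A -> measurable A.
Proof.
by move=> cA; rewrite -(setCK A); apply: measurableC; apply: open_measurable_rV; exact: closed_openC.
Qed.

Lemma compact_measurable_rV A : compact A -> measurable A.
Proof.
by move/compact_closed => /(_ (@norm_hausdorff _ _)); exact: closed_measurable_rV.
Qed.

Lemma continuous_measurable_rV (f : 'rV[R]_d -> R) :
  continuous f -> measurable_fun setT f.
Proof.
move=> /continuousP cf; apply: (measurability _ (RGenOpens.measurableE R)).
move=> _ [_ [a [b ->] <-]]; rewrite setTI; apply: open_measurable_rV.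
exact/cf/interval_open.
Qed.

End rV_borel.

(** * Lebesgue measure on R^d: dilations and tensor products *)

Section rV_measure.
Variable R : realType.

Definition cube (d : nat) (r : R) : set 'rV[R]_d := [set x | `|x| <= r].
Arguments cube : clear implicits.

Lemma cubeE d (r : R) : 0 <= r ->
  cube d r = [set x | forall i, `[- r, r]%classic (x ord0 i)].
Proof.
move=> r0; apply/seteqP; split => x /=.
  by move=> /(rV_norm_leP _ r0) h i; rewrite in_itv /= -ler_norml.
by move=> h; apply/(rV_norm_leP _ r0) => i; have := h i; rewrite in_itv /= -ler_norml.
Qed.

Lemma cube_measurable d (r : R) : measurable (cube d r).
Proof.
have [r0|r0] := leP 0 r; first by rewrite cubeE//; exact: (measurable_coords (B := fun=> `[- r, r]%classic)).
rewrite (_ : cube d r = set0)//; apply/seteqP; split => // x /= xr.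
by have := lt_le_trans r0 (normr_ge0 x); rewrite ltNge xr.
Qed.

Lemma lebesgue_cube d (r : R) : 0 <= r ->
  lebesgue_rV R d (cube d r) = ((2 * r) ^+ d)%:E.
Proof.
move=> r0; rewrite cubeE// (lebesgue_rV_box (A := fun=> `[- r, r]%classic))//.
under eq_bigr do rewrite lebesgue_measure_itv /= lte_fin.
have -> : (if (- r < r)%R then r%:E - (- r)%R%:E else 0)%E = (2 * r)%:E.
  case: ifPn => [_|]; first by rewrite -EFinB opprK mulr_natl mulr2n.
  by rewrite -leNgt => h; congr EFin; lra.
by rewrite prodEFin prodr_const card_ord.
Qed.

Lemma lebesgue_rV_sigma_finite d : sigma_finite setT (lebesgue_rV R d).
Proof.
exists (fun n => cube d n%:R).
  apply/seteqP; split => // x _; exists (Num.truncn `|x|).+1 => //=.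
  by rewrite /cube /= ltW// truncnS_gt.
by move=> n; split; [exact: cube_measurable|rewrite lebesgue_cube// ltry].
Qed.

(* [lebesgue_rV R d] is a fixpoint and cannot carry a sigma-finite instance. *)
Definition leb (d : nat) : set 'rV[R]_d -> \bar R := lebesgue_rV R d.
Arguments leb : clear implicits.
HB.instance Definition _ d := Measure.copy (leb d) (lebesgue_rV R d).
HB.instance Definition _ d := Measure_isSigmaFinite.Build _ _ _ (leb d)
  (lebesgue_rV_sigma_finite d).

Local Notation l1 := (@lebesgue_measure R).

Lemma ge0_integral_snoc d (F : 'rV[R]_d.+1 -> \bar R) : measurable_fun setT F ->
  (forall x, 0 <= F x)%E ->
  (\int[leb d.+1]_x F x = \int[leb d]_x \int[l1]_y F (rV_snoc (x, y)))%E.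
Proof.
move=> mF F0.
transitivity (\int[(leb d \x l1)%E]_z (F \o @rV_snoc R d) z)%E.
  exact: (ge0_integral_pushforward (@measurable_rV_snoc R d) (leb d \x l1)%E measurableT mF (fun x _ => F0 x)).
rewrite fubini_tonelli1//; last by move=> x; exact: F0.
exact: (measurableT_comp mF (@measurable_rV_snoc R d)).
Qed.

(** The image measure multiplied by a agrees with Lebesgue measure on half-open intervals, hence on
    all measurable sets. *)
Lemma lebesgue_measure_scale (a : R) (A : set (measurableTypeR R)) : 0 < a ->
  measurable A -> (l1 ((fun x => (a * x)%R) @^-1` A) = a^-1%:E * l1 A)%E.
Proof.
move=> a0 mA; have an0 : a != 0 by rewrite gt_eqF.
have ma : measurable_fun setT (fun x : measurableTypeR R => a * x : measurableTypeR R).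
  exact: mulrl_measurable.
pose nn := NngNum (ltW a0).
pose pm := measure_function_pushforward__canonical__measure_function_Measure l1 ma.
have key (X : set (measurableTypeR R)) : ocitv X -> l1 X = mscale nn pm X.
  move=> [[x y] _ <-] /=; rewrite /mscale /= /pushforward.
  have -> : (fun x => a * x) @^-1` `]x, y] = `]x / a, y / a]%classic.
    apply/seteqP; split => z /=; rewrite !in_itv /= ltr_pdivrMr// ler_pdivlMr//;
      by rewrite (mulrC a).
  rewrite !lebesgue_measure_itv /= !lte_fin ltr_pM2r ?invr_gt0//.
  case: ifP => _; last by rewrite mule0.
  by rewrite -!EFinB -EFinM; congr EFin; field.
rewrite (lebesgue_measure_unique key mA) /mscale /= muleA -EFinM mulVf// mul1e.
by [].
Qed.

Lemma ge0_integral_scale1 (a : R) (h : R -> \bar R) : 0 < a ->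
  measurable_fun setT h -> (forall x, 0 <= h x)%E ->
  (\int[l1]_x h (a * x)%R = a^-1%:E * \int[l1]_x h x)%E.
Proof.
move=> a0 mh h0; have ai : 0 <= a^-1 by rewrite invr_ge0 ltW.
have ma : measurable_fun setT (fun x : measurableTypeR R => a * x : measurableTypeR R).
  exact: mulrl_measurable.
pose nn := NngNum ai.
transitivity (\int[pushforward l1 (fun x : measurableTypeR R => (a * x)%R : measurableTypeR R)]_x h x)%E.
  exact/esym/(ge0_integral_pushforward ma l1 measurableT mh (fun x _ => h0 x)).
rewrite (_ : a^-1 = nn%:num)// -ge0_integral_mscale//.
apply: eq_measure_integral => A mA _.
exact: lebesgue_measure_scale.
Qed.

Lemma rV_snoc_scale d (a : R) (x : 'rV[R]_d) (y : measurableTypeR R) :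
  a *: rV_snoc (x, y) = rV_snoc (a *: x, a * y).
Proof. by apply/rowP => i; rewrite !mxE; case: unlift => // j; rewrite mxE. Qed.

Lemma measurable_rVP d d' (T : measurableType d') (f : T -> 'rV[R]_d) :
  (forall i, measurable_fun setT (fun x => f x ord0 i : measurableTypeR R)) ->
  measurable_fun setT f.
Proof.
move=> mf _ Y mY; rewrite setTI.
suff : g_sigma_preimage (fun (i : 'I_d) (x : 'rV[R]_d) =>
    x ord0 i : measurableTypeR R) `<=` [set A | measurable (f @^-1` A)].
  exact.
apply: smallest_sub.
  split => /=.
  - by rewrite preimage_set0.
  - by move=> A mA; rewrite setTD preimage_setC; exact: measurableC.
  - by move=> F mF; rewrite preimage_bigcup; exact: bigcup_measurable.
rewrite -bigcup_seq => _ [i _ [B mB <-]] /=; rewrite setTI -comp_preimage.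
by rewrite -[X in measurable X]setTI; exact: mf.
Qed.

Lemma measurable_rV_scale d (a : R) :
  measurable_fun setT (fun x : 'rV[R]_d => a *: x).
Proof.
apply: measurable_rVP => i; under eq_fun do rewrite mxE.
exact: (measurableT_comp (@mulrl_measurable R setT a) (@measurable_coord R d i)).
Qed.

Lemma ge0_integral_scale d (a : R) (F : 'rV[R]_d -> \bar R) : 0 < a ->
  measurable_fun setT F -> (forall x, 0 <= F x)%E ->
  (\int[leb d]_x F (a *: x)%R = ((a ^+ d)^-1)%:E * \int[leb d]_x F x)%E.
Proof.
move=> a0; elim: d F => [|d IH] F mF F0.
  rewrite expr0 invr1 mul1e; apply: eq_integral => x _; congr F.
  by apply/rowP => -[].
have ai : 0 <= a^-1 by rewrite invr_ge0 ltW.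
have mFs : measurable_fun setT (fun z : 'rV[R]_d * measurableTypeR R => F (rV_snoc z)).
  exact: (measurableT_comp mF (@measurable_rV_snoc R d)).
pose Phi x := (\int[l1]_y F (rV_snoc (x, y)))%E.
have mPhi : measurable_fun setT Phi.
  by apply: (measurable_fun_fubini_tonelli_F (m2 := l1) _ mFs) => z; exact: F0.
have Phi0 x : (0 <= Phi x)%E by apply: integral_ge0 => y _; exact: F0.
rewrite ge0_integral_snoc//; first last.
  exact: (measurableT_comp mF (@measurable_rV_scale d.+1 a)).
rewrite ge0_integral_snoc// -/(Phi _).
transitivity (\int[leb d]_x (a^-1%:E * Phi (a *: x)%R))%E.
  apply: eq_integral => x _.
  under eq_integral do rewrite rV_snoc_scale.
  rewrite (ge0_integral_scale1 (h := fun y => F (rV_snoc (a *: x, y))))//.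
  exact: (measurableT_comp mFs (pair1_measurable _)).
have mPhia : measurable_fun setT (fun x : 'rV[R]_d => Phi (a *: x)).
  exact: (measurableT_comp mPhi (@measurable_rV_scale d a)).
rewrite (ge0_integralZl_EFin _ measurableT (fun z _ => Phi0 (a *: (z : 'rV[R]_d))) mPhia ai).
rewrite (IH _ mPhi Phi0) muleA -EFinM; congr (_%:E * _)%E.
by rewrite exprS invfM.
Qed.

Lemma cintegrable_snoc d (f : 'rV[R]_d.+1 -> R[i]) : cmeas setT f ->
  cintegrable (leb d \x l1)%E setT (f \o @rV_snoc R d) ->
  cintegrable (leb d.+1) setT f /\
  cint (leb d.+1) setT f = cint (leb d \x l1)%E setT (f \o @rV_snoc R d).
Proof.
move=> mf fi; have ms := @measurable_rV_snoc R d.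
split.
  split => //; case: fi => _; congr (_ < _)%E; symmetry.
  apply: (ge0_integral_pushforward ms (leb d \x l1)%E measurableT).
    by apply/measurable_EFinP; exact: cmeas_nc.
  by move=> x _; rewrite lee_fin nc_ge0.
have fr := cintegrable_Re measurableT fi; have fm := cintegrable_Im measurableT fi.
case: mf => mf1 mf2; apply: complex_eqP => /=; congr fine.
- apply: (integral_pushforward ms (mu := (leb d \x l1)%E)
    (f := EFin \o (fun x => complex.Re (f x)))) => //; exact/measurable_EFinP.
- apply: (integral_pushforward ms (mu := (leb d \x l1)%E)
    (f := EFin \o (fun x => complex.Im (f x)))) => //; exact/measurable_EFinP.
Qed.

Lemma cmeas_prod d (T : measurableType d) (I : finType) (F : I -> T -> R[i]) :
  (forall i, cmeas setT (F i)) -> cmeas setT (fun x => \prod_i F i x).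
Proof.
move=> mF; elim: (index_enum I) => [|i s IH].
  by under eq_fun do rewrite big_nil; exact: cmeas_cst.
by under eq_fun do rewrite big_cons; exact: cmeas_mul.
Qed.

(** Reduces kernels of product form on R^d to the line, by Fubini and induction; for d = 0 the
    measure is a unit mass and the product is empty. *)
Lemma cint_tensor d (u : 'I_d -> R -> R[i]) :
  (forall i, cintegrable l1 setT (u i)) ->
  cintegrable (leb d) setT (fun x => \prod_i u i (x ord0 i)) /\
  cint (leb d) setT (fun x => \prod_i u i (x ord0 i)) =
    \prod_i cint l1 setT (u i).
Proof.
elim: d u => [|d IH] u ui.
  have e : (fun x : 'rV[R]_0 => \prod_(i < 0) u i (x ord0 i)) = (fun=> 1).
    by apply/funext => x; rewrite big_ord0.
  have i1 : lebesgue_rV R 0 setT = 1%E by rewrite /= diracT.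
  rewrite e big_ord0; split.
    split; first exact: cmeas_cst.
    rewrite Normc.normc1 integral_cst// mul1e.
    by rewrite -[X in (X < _)%E]/(lebesgue_rV R 0 setT) i1 ltry.
  apply: complex_eqP; rewrite /= Rintegral_cst// ?mul0r//.
  by rewrite mul1r -[X in fine X]/(lebesgue_rV R 0 setT) i1.
have [vi vE] := IH (fun i => u (widen_ord (leqnSn d) i)) (fun i => ui _).
have [wi wE] := cint_mul_prod vi (ui ord_max).
have e : (fun x : 'rV[R]_d.+1 => \prod_i u i (x ord0 i)) \o @rV_snoc R d =
  (fun z => (\prod_i u (widen_ord (leqnSn d) i) (z.1 ord0 i)) * u ord_max z.2).
  apply/funext => -[x y] /=; rewrite big_ord_recr /= mxE unlift_none; congr (_ * _).
  apply: eq_bigr => i _; rewrite mxE.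
  have -> : widen_ord (leqnSn d) i = lift ord_max i.
    by apply/val_inj; rewrite /= /bump leqNgt ltn_ord.
  by rewrite liftK.
have mf : cmeas setT (fun x : 'rV[R]_d.+1 => \prod_i u i (x ord0 i)).
  apply: (cmeas_prod (F := fun i (x : 'rV[R]_d.+1) => u i (x ord0 i))) => i.
  exact: (cmeas_comp (@measurable_coord R d.+1 i) (proj1 (ui i))).
rewrite -e in wi wE; have [h1 h2] := cintegrable_snoc mf wi.
by split => //; rewrite h2 wE vE big_ord_recr.
Qed.

End rV_measure.
Arguments cube {R} d r.
Arguments leb {R} d.

(** * The Fejer kernel *)

Section calculus.
Variable R : realType.
Implicit Types (f g F : R -> R) (x : R).

Lemma is_derive_add f g x df dg : is_derive x 1 f df -> is_derive x 1 g dg ->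
  is_derive x 1 (fun y => f y + g y) (df + dg).
Proof. exact: is_deriveD. Qed.

Lemma is_derive_mul f g x df dg : is_derive x 1 f df -> is_derive x 1 g dg ->
  is_derive x 1 (fun y => f y * g y) (df * g x + f x * dg).
Proof.
move=> hf hg; have := is_deriveM hf hg; rewrite addrC [g x *: _]mulrC; exact.
Qed.

Lemma is_derive_comp f g x df dg : is_derive (g x) 1 f df -> is_derive x 1 g dg ->
  is_derive x 1 (fun y => f (g y)) (df * dg).
Proof. exact: is_derive1_comp. Qed.

Lemma is_derive_const (c : R) x : is_derive x 1 (fun=> c) 0.
Proof. exact: is_derive_cst. Qed.

Lemma is_derive_continuous f (df : R -> R) : (forall x, is_derive x 1 f (df x)) ->
  continuous f.
Proof.
move=> h x; apply/differentiable_continuous/derivable1_diffP.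
by case: (h x).
Qed.

Lemma FTC_half_line f F (l : R) : (forall x, 0 <= x -> 0 <= f x) -> continuous f ->
  (forall x, is_derive x 1 F (f x)) -> F x @[x --> +oo] --> l ->
  (\int[lebesgue_measure]_(x in `[0%R, +oo[) (f x)%:E = (l - F 0)%:E)%E.
Proof.
move=> f0 cf dF Fl; have cF := is_derive_continuous dF.
have wf : {within `[0, +oo[, continuous f} by exact: continuous_subspaceT.
have rF : F x @[x --> 0^'+] --> F 0 by apply: cvg_at_right_filter; exact: cF.
have derF x : 0 < x -> derivable F x 1 by move=> _; case: (dF x).
have dE : {in `]0, +oo[, F^`()%classic =1 f} by move=> x _; rewrite derive1E; case: (dF x).
by rewrite (ge0_continuous_FTC2y f0 wf Fl derF rF dE).
Qed.

Lemma cvg_expR_bound F (C k : R) : 0 < k ->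
  (forall x, 0 <= x -> `|F x| <= C * expR (- (k * x))) ->
  F x @[x --> +oo] --> (0 : R).
Proof.
move=> k0 h.
have e0 : C * expR (- (k * x)) @[x --> +oo] --> (0 : R).
  rewrite -(mulr0 C); apply: cvgMr.
  apply: (@cvg_comp _ _ _ (fun x => k * x) (fun y => expR (- y)) _ (pinfty_nbhs R)).
    exact: (gt0_cvgMry k0 (@cvg_id _ _)).
  exact: cvgr_expR.
apply/norm_cvg0P; apply: (squeeze_cvgr _ (cvg_cst 0) e0).
near=> x; rewrite normr_ge0 /=; apply: h.
by near: x; exact: nbhs_pinfty_ge.
Unshelve. all: by end_near. Qed.

Lemma integral_sq_inv (xi : R) : 0 < xi ->
  (\int[lebesgue_measure]_(s in `[0%R, +oo[) (s * expR (- (xi * s)))%:E =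
   (xi ^- 2)%:E)%E.
Proof.
move=> x0; have xn0 : xi != 0 by rewrite gt_eqF.
have dexp (s : R) : is_derive s 1 (fun s => expR (- (xi * s))) (- xi * expR (- (xi * s))).
  rewrite mulrC; apply: (is_derive_comp (f := expR)).
  have -> : (fun s => - (xi * s)) = (fun s => (- xi) * s) :> (R -> R).
    by apply/funext => y; rewrite mulNr.
  have := is_derive_mul (is_derive_const (- xi) s) (is_derive_id s 1).
  by rewrite mul0r add0r mulr1.
pose F (s : R) := (- (s / xi) - xi ^- 2) * expR (- (xi * s)).
have dF (s : R) : is_derive s 1 F (s * expR (- (xi * s))).
  have h : is_derive s 1 (fun s => - (s / xi) - xi ^- 2) (- xi^-1).
    have h1 := is_derive_add (is_derive_mul (is_derive_id s 1) (is_derive_const (- xi^-1) s))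
       (is_derive_const (- xi ^- 2) s).
    rewrite mul1r mulr0 !addr0 in h1; move: h1; congr (is_derive _ _ _ _).
    by apply/funext => y; rewrite mulrN.
  have := is_derive_mul h (dexp s); congr (is_derive _ _ _ _).
  by rewrite /=; field.
have Fl : F x @[x --> +oo] --> (0 : R).
  apply: (@cvg_expR_bound _ (2 * xi ^- 2) (xi / 2)); first by rewrite divr_gt0.
  move=> s s0; rewrite normrM (ger0_norm (expR_ge0 _)).
  (* One half of the exponential decay absorbs the linear factor, by 1 + y <= exp y; the other half
     remains. *)
  have -> : - (xi * s) = - (xi / 2 * s) + - (xi / 2 * s) by field.
  rewrite expRD mulrA ler_wpM2r ?expR_ge0//.
  rewrite -opprD normrN ger0_norm; last first.
    by rewrite addr_ge0 ?invr_ge0 ?sqr_ge0// mulr_ge0// invr_ge0 ltW.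
  rewrite expRN ler_pdivrMr ?expR_gt0//.
  have e := expR_ge1Dx (xi / 2 * s).
  have x2 : 0 < xi ^- 2 by rewrite invr_gt0 exprn_gt0.
  apply: (@le_trans _ _ (xi ^- 2 * (2 * (1 + xi / 2 * s)))); last first.
    by rewrite mulrA [xi ^- 2 * 2]mulrC ler_pM2l// mulr_gt0.
  have -> : s / xi + xi ^- 2 = xi ^- 2 * (1 + xi * s) by field.
  rewrite ler_pM2l//.
  have : 0 <= xi * s by rewrite mulr_ge0// ltW.
  by lra.
have cf : continuous (fun s : R => s * expR (- (xi * s))).
  move=> s; apply: cvgM; first exact: cvg_id.
  exact: (is_derive_continuous dexp).
have f0 s : 0 <= s -> 0 <= s * expR (- (xi * s)).
  by move=> s0; rewrite mulr_ge0// expR_ge0.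
rewrite (FTC_half_line f0 cf dF Fl).
by rewrite /F mul0r mulr0 oppr0 expR0 mulr1 !sub0r opprK.
Qed.

(** The Laplace transform of 1 - cos, namely 1 / s - s / (s^2 + 1); the primitive [F] comes from
    integrating by parts twice. *)
Lemma integral_one_sub_cos_exp (s : R) : 0 < s ->
  (\int[lebesgue_measure]_(x in `[0%R, +oo[) ((1 - cos x) * expR (- (s * x)))%:E =
   ((s * (s ^+ 2 + 1))^-1)%:E)%E.
Proof.
move=> s0; have sn0 : s != 0 by rewrite gt_eqF.
have s21 : s ^+ 2 + 1 != 0 by rewrite gt_eqF// ltr_wpDl// sqr_ge0.
have dexp (x : R) : is_derive x 1 (fun x => expR (- (s * x))) (- s * expR (- (s * x))).
  rewrite mulrC; apply: (is_derive_comp (f := expR)).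
  have -> : (fun x => - (s * x)) = (fun x => (- s) * x) :> (R -> R).
    by apply/funext => y; rewrite mulNr.
  have := is_derive_mul (is_derive_const (- s) x) (is_derive_id x 1).
  by rewrite mul0r add0r mulr1.
pose H (x : R) := - s^-1 + - (s ^+ 2 + 1)^-1 * (sin x + - s * cos x).
pose F (x : R) := H x * expR (- (s * x)).
have dH (x : R) : is_derive x 1 H (- (s ^+ 2 + 1)^-1 * (cos x + s * sin x)).
  have h1 := is_derive_mul (is_derive_const (- s) x) (is_derive_cos x).
  have h2 := is_derive_add (is_derive_sin x) h1.
  have h3 := is_derive_mul (is_derive_const (- (s ^+ 2 + 1)^-1) x) h2.
  have h4 := is_derive_add (is_derive_const (- s^-1) x) h3.
  move: h4; congr (is_derive _ _ _ _); rewrite !(mul0r, add0r).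
  by rewrite mulrNN.
have dF (x : R) : is_derive x 1 F ((1 - cos x) * expR (- (s * x))).
  have := is_derive_mul (dH x) (dexp x); congr (is_derive _ _ _ _).
  by rewrite /H; field; rewrite sn0 s21.
have Fl : F x @[x --> +oo] --> (0 : R).
  apply: (@cvg_expR_bound _ (s^-1 + (s ^+ 2 + 1)^-1 * (1 + s)) s) => // x x0.
  rewrite normrM (ger0_norm (expR_ge0 _)) ler_wpM2r ?expR_ge0//.
  have s2p : 0 <= (s ^+ 2 + 1)^-1 by rewrite invr_ge0 addr_ge0// sqr_ge0.
  rewrite (le_trans (ler_normD _ _))// normrN ger0_norm ?invr_ge0 ?(ltW s0)//.
  rewrite lerD2l normrM normrN (ger0_norm s2p) ler_wpM2l//.
  rewrite (le_trans (ler_normD _ _))// lerD//.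
    by rewrite ler_norml sin_geN1 sin_le1.
  rewrite normrM normrN (gtr0_norm s0) ler_piMr ?(ltW s0)//.
  by rewrite ler_norml cos_geN1 cos_le1.
have cexp := is_derive_continuous dexp.
have cf : continuous (fun x : R => (1 - cos x) * expR (- (s * x))).
  move=> x; apply: cvgM; last exact: cexp.
  by apply: cvgB; [exact: cvg_cst|exact: continuous_cos].
have f0 x : 0 <= x -> 0 <= (1 - cos x) * expR (- (s * x)).
  by move=> _; rewrite mulr_ge0 ?expR_ge0// subr_ge0 cos_le1.
rewrite (FTC_half_line f0 cf dF Fl); congr EFin.
rewrite /F /H mulr0 oppr0 expR0 sin0 cos0 mulr1 add0r; field.
by rewrite sn0 s21.
Qed.

Lemma integral_cauchy :
  (\int[lebesgue_measure]_(x in `[0%R, +oo[) (2 * (1 + x ^+ 2)^-1)%:E =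
   (pi : R)%:E)%E.
Proof.
have p0 (x : R) : 0 < 1 + x ^+ 2 by rewrite ltr_pwDl// sqr_ge0.
have dF (x : R) : is_derive x 1 (fun x => 2 * atan x) (2 * (1 + x ^+ 2)^-1).
  have := is_derive_mul (is_derive_const 2 x) (is_derive1_atan x).
  by rewrite mul0r add0r.
have Fl : 2 * atan x @[x --> +oo] --> (pi : R).
  have -> : (pi : R) = 2 * (pi / 2) by field.
  by apply: cvgMr; exact: cvgy_atan.
have cf : continuous (fun x : R => 2 * (1 + x ^+ 2)^-1).
  move=> x; apply: cvgMr; apply: cvgV; first by rewrite gt_eqF.
  by apply: cvgD; [exact: cvg_cst|exact: exprn_continuous].
have f0 (x : R) : 0 <= x -> 0 <= 2 * (1 + x ^+ 2)^-1.
  by move=> _; rewrite mulr_ge0// invr_ge0 ltW.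
by rewrite (FTC_half_line f0 cf dF Fl) atan0 mulr0 subr0.
Qed.

End calculus.

(** * The Fejer kernel on the line *)

Section fejer_kernel.
Variable R : realType.
Implicit Types (s x a : R).
Local Notation l1 := (@lebesgue_measure R).

(** This is the square of sin (s / 2) / (s / 2), completed by its limit at 0. *)
Definition fejer s : R := if s == 0 then 1 else 2 * (1 - cos s) / s ^+ 2.

Lemma fejerE s : s != 0 -> fejer s = 2 * (1 - cos s) / s ^+ 2.
Proof. by rewrite /fejer => /negPf ->. Qed.

Lemma fejerN s : fejer (- s) = fejer s.
Proof. by rewrite /fejer oppr_eq0 cosN sqrrN. Qed.

(* [1 - cos s = 2 (sin (s / 2)) ^ 2], and [sin u = u * cos c] by the mean value
   theorem. *)
Lemma fejer_cos s : exists2 c, `|c| <= `|s| & fejer s = cos c ^+ 2.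
Proof.
wlog s0 : s / 0 <= s => [h|].
  have [/h//|/ltW s0] := leP 0 s.
  have [|c cs e] := h (- s); first by rewrite oppr_ge0.
  by exists c; [rewrite -(normrN s)|rewrite -fejerN].
move: s0; rewrite le_eqVlt => /predU1P[<-|s0].
  by exists 0; rewrite ?normr0// /fejer eqxx cos0 expr1n.
have s20 : 0 < s / 2 by rewrite divr_gt0.
have [|c] := @MVT R sin cos 0 (s / 2) s20 (fun x _ => is_derive_sin x).
  by apply: continuous_subspaceT; exact: continuous_sin.
rewrite in_itv /= sin0 !subr0 => /andP[c0 cs] e; exists c.
  by rewrite (gtr0_norm c0) (gtr0_norm s0) (le_trans (ltW cs))// ler_pdivrMr// ler_pMr// ler1n.
rewrite fejerE ?gt_eqF//.
have -> : cos s = 1 - 2 * sin (s / 2) ^+ 2.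
  rewrite {1}(_ : s = s / 2 + s / 2); last by field.
  by rewrite cosD -!expr2 cos2sin2; ring.
by rewrite e; field; rewrite gt_eqF.
Qed.

Lemma fejer_ge0 s : 0 <= fejer s.
Proof. by have [c _ ->] := fejer_cos s; exact: sqr_ge0. Qed.

Lemma fejer_le1 s : fejer s <= 1.
Proof.
by have [c _ ->] := fejer_cos s; rewrite cos2sin2 gerBl sqr_ge0.
Qed.

Lemma continuous_fejer : continuous fejer.
Proof.
move=> s; have [->|s0] := eqVneq s 0.
  (* At 0, [fejer_cos] reduces the claim to the continuity of cos^2, as the intermediate point is no
     farther from 0 than x. *)
  apply/cvgrPdist_lt => e e0.
  have : cos x ^+ 2 @[x --> (0 : R)] --> cos (0 : R) ^+ 2.
    apply: (@continuous_comp _ _ _ (@cos R) (fun y => y ^+ 2) 0).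
      exact: continuous_cos.
    exact: exprn_continuous.
  rewrite cos0 expr1n => /cvgrPdist_lt/(_ e e0)/nbhs_ballP[r /= r0 hr].
  apply/nbhs_ballP; exists r => // x; rewrite /ball /= sub0r normrN => xr.
  have [c cx ->] := fejer_cos x; rewrite {1}/fejer eqxx.
  by apply: hr; rewrite /ball /= sub0r normrN (le_lt_trans cx).
have h : 2 * (1 - cos x) / x ^+ 2 @[x --> s] --> fejer s.
  rewrite fejerE//; apply: cvgM.
    apply: cvgMr; apply: cvgB; first exact: cvg_cst.
    exact: continuous_cos.
  by apply: cvgV; [rewrite sqrf_eq0|exact: exprn_continuous].
apply: cvg_trans h; apply: near_eq_cvg.
have : \forall x \near s, x != 0 by apply: open_nbhs_nbhs; split => //; exact: open_neq.
by apply: filterS => x x0; rewrite fejerE.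
Qed.

Lemma measurable_fejer : measurable_fun setT fejer.
Proof. by apply: continuous_measurable_fun; exact: continuous_fejer. Qed.

(** As a factor of the integrand it turns integrals over half-lines into integrals over the whole
    line, the form in which Tonelli is applied. *)
Let p x : R := \1_(`]0, +oo[%classic) x.

Let p_gt0 x : 0 < x -> p x = 1.
Proof. by move=> x0; rewrite /p indicE mem_set//= in_itv /= x0. Qed.

Let p_le0 x : x <= 0 -> p x = 0.
Proof.
move=> x0; rewrite /p indicE memNset//= in_itv /= andbT => h.
by move: x0; rewrite leNgt h.
Qed.

Let p_ge0 x : 0 <= p x.
Proof. by rewrite /p indicE. Qed.

Let mp : measurable_fun setT p.
Proof. exact: measurable_indic. Qed.

Let integral_p (h : R -> R) : measurable_fun setT h ->
  (\int[l1]_x (p x * h x)%:E = \int[l1]_(x in `[0%R, +oo[) (h x)%:E)%E.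
Proof.
move=> mh; rewrite -integral_itv_obnd_cbnd; last first.
  by apply/measurable_EFinP; exact: measurable_funTS.
rewrite [RHS]integral_mkcond; apply: eq_integral => x _.
rewrite /patch; case: ifPn => [|].
  by rewrite inE /= in_itv /= andbT => x0; rewrite p_gt0// mul1r.
move=> /negP; rewrite inE /= in_itv /= andbT => /negP; rewrite -leNgt => x0.
by rewrite p_le0// mul0r.
Qed.

(* Tonelli with [x^-2 = \int_0^oo s * exp (- x s) ds]. *)
Lemma integral_fejer_half :
  (\int[l1]_(x in `[0%R, +oo[) (fejer x)%:E = (pi : R)%:E)%E.
Proof.
rewrite -integral_p; last exact: measurable_fejer.
pose w (z : measurableTypeR R * measurableTypeR R) : R :=
  (p z.1 * p z.2) * ((2 * (1 - cos z.1)) * (z.2 * expR (- (z.1 * z.2)))).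
have m1 : measurable_fun setT (fun z : measurableTypeR R * measurableTypeR R => z.1 : R).
  exact: measurable_fst.
have m2 : measurable_fun setT (fun z : measurableTypeR R * measurableTypeR R => z.2 : R).
  exact: measurable_snd.
have mcos : measurable_fun setT (@cos R).
  by apply: continuous_measurable_fun; exact: continuous_cos.
have mw : measurable_fun setT (fun z => (w z)%:E).
  apply/measurable_EFinP; apply: measurable_funM.
    by apply: measurable_funM; [exact: (measurableT_comp mp m1)|exact: (measurableT_comp mp m2)].
  apply: measurable_funM.
    apply: measurable_funM => //; apply: measurable_funB => //.
    exact: (measurableT_comp mcos m1).
  apply: measurable_funM => //; apply: (measurableT_comp (@measurable_expR R)).
  by apply: measurable_funN; exact: measurable_funM.
have w0 z : (0 <= (w z)%:E)%E.
  rewrite lee_fin /w; have [z2|z2] := leP z.2 0; first by rewrite (p_le0 z2) mulr0 mul0r.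
  apply: mulr_ge0; first exact: mulr_ge0.
  apply: mulr_ge0; first by rewrite mulr_ge0// subr_ge0 cos_le1.
  by rewrite mulr_ge0 ?expR_ge0// ltW.
have mexp (c : R) : measurable_fun setT (fun s : R => expR (- (c * s))).
  apply: (measurableT_comp (@measurable_expR R)); apply: measurable_funN.
  exact: mulrl_measurable.
have := fubini_tonelli1 (m1 := l1) (m2 := l1) _ mw w0.
rewrite (fubini_tonelli2 (m1 := l1) (m2 := l1) _ mw w0) /fubini_F /fubini_G /=.
(* Integrating in x first leaves 2 s / (s (s^2 + 1)) = 2 / (1 + s^2), whose integral is pi. *)
have -> : (\int[l1]_y \int[l1]_x (w (x, y))%:E = (pi : R)%:E)%E.
  rewrite -integral_cauchy -integral_p; last first.
    apply: continuous_measurable_fun => x; apply: cvgMr; apply: cvgV.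
      by rewrite gt_eqF// ltr_pwDl// sqr_ge0.
    by apply: cvgD; [exact: cvg_cst|exact: exprn_continuous].
  apply: eq_integral => s _; have [s0|s0] := leP s 0.
    rewrite (p_le0 s0) mul0r; apply: integral0_eq => x _.
    by rewrite /w /= (p_le0 s0) mulr0 mul0r.
  have -> : (fun x => (w (x, s))%:E) =
     (fun x => ((2 * s)%:E * (p x * ((1 - cos x) * expR (- (s * x))))%:E)%E).
    apply/funext => x; rewrite /w /= (p_gt0 s0) -EFinM; congr EFin.
    by rewrite mulr1 (mulrC x s); ring.
  have mh : measurable_fun setT (fun x : R => (1 - cos x) * expR (- (s * x))).
    by apply: measurable_funM => //; exact: measurable_funB.
  rewrite ge0_integralZl_EFin//.
  - rewrite integral_p// integral_one_sub_cos_exp// (p_gt0 s0) mul1r -EFinM.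
    have sn0 : s != 0 by rewrite gt_eqF.
    have s1 : s ^+ 2 + 1 != 0 by rewrite gt_eqF// ltr_wpDl// sqr_ge0.
    have s2 : 1 + s ^+ 2 != 0 by rewrite addrC.
    by congr EFin; field; rewrite ?sn0 ?s1 ?s2.
  - move=> x _; rewrite lee_fin; apply: mulr_ge0; first exact: p_ge0.
    by apply: mulr_ge0; rewrite ?expR_ge0// subr_ge0 cos_le1.
  - by apply/measurable_EFinP; exact: measurable_funM.
  - by rewrite mulr_ge0// ltW.
(* Integrating in s first gives x^-2 and so restores the kernel. *)
move=> ->; apply: eq_integral => x _; have [x0|x0] := leP x 0.
  rewrite (p_le0 x0) mul0r; symmetry; apply: integral0_eq => s _.
  by rewrite /w /= (p_le0 x0) !mul0r.
have -> : (fun s => (w (x, s))%:E) =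
   (fun s => ((2 * (1 - cos x))%:E * (p s * (s * expR (- (x * s))))%:E)%E).
  apply/funext => s; rewrite /w /= (p_gt0 x0) -EFinM; congr EFin.
  by rewrite mul1r; ring.
have mh : measurable_fun setT (fun s : R => s * expR (- (x * s))).
  by apply: measurable_funM => //.
rewrite ge0_integralZl_EFin//.
- by rewrite integral_p// integral_sq_inv// (p_gt0 x0) mul1r -EFinM fejerE ?gt_eqF.
- move=> s _; rewrite lee_fin; have [s0|s0] := leP s 0; first by rewrite (p_le0 s0) mul0r.
  by rewrite mulr_ge0// mulr_ge0 ?expR_ge0// ltW.
- by apply/measurable_EFinP; exact: measurable_funM.
Qed.

Lemma integral_fejer : (\int[l1]_x (fejer x)%:E = (2 * pi : R)%:E)%E.
Proof.
rewrite ge0_symfun_integralT; first last.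
- by move=> x /=; rewrite fejerN.
- exact: continuous_fejer.
- exact: fejer_ge0.
rewrite (_ : [set x | 0 <= x] = `[0, +oo[%classic) ?integral_fejer_half//.
by apply/seteqP; split => x /=; rewrite in_itv /= andbT.
Qed.

(** The weight a^2 makes the formula valid for zero and negative a too, as the arguments a + x and a
    - x of [fejer_cosE] require. *)
Lemma integral_fejer_scale a : (\int[l1]_x (a ^+ 2 * fejer (a * x))%:E = (2 * pi * `|a|)%:E)%E.
Proof.
wlog a0 : a / 0 <= a => [h|].
  have [/h//|/ltW a0] := leP 0 a.
  rewrite -normrN -h ?oppr_ge0//; apply: eq_integral => x _.
  by rewrite sqrrN mulNr fejerN.
move: a0; rewrite le_eqVlt => /predU1P[<-|a0].
  by rewrite normr0 mulr0; apply: integral0_eq => x _; rewrite expr0n mul0r.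
have mf : measurable_fun setT (fun x => (fejer x)%:E).
  by apply/measurable_EFinP; exact: measurable_fejer.
under eq_integral do rewrite EFinM.
rewrite ge0_integralZl_EFin//.
- rewrite (ge0_integral_scale1 a0 mf) ?integral_fejer//; last first.
    by move=> x; rewrite lee_fin fejer_ge0.
  rewrite -!EFinM gtr0_norm//; congr EFin; field; by rewrite gt_eqF.
- by move=> x _; rewrite lee_fin fejer_ge0.
- by apply: (measurableT_comp mf); exact: mulrl_measurable.
- exact: sqr_ge0.
Qed.

Lemma integrable_fejer_scale a :
  l1.-integrable setT (EFin \o (fun x => a ^+ 2 * fejer (a * x))).
Proof.
apply/integrableP; split.
  apply/measurable_EFinP; apply: measurable_funM => //.
  by apply: (measurableT_comp measurable_fejer); exact: mulrl_measurable.
rewrite [X in (X < _)%E](_ : _ = (2 * pi * `|a|)%:E) ?ltry//.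
rewrite -integral_fejer_scale; apply: eq_integral => x _ /=.
by rewrite ger0_norm// mulr_ge0 ?sqr_ge0 ?fejer_ge0.
Qed.

Lemma Rintegral_fejer_scale a :
  \int[l1]_x (a ^+ 2 * fejer (a * x)) = 2 * pi * `|a|.
Proof. by rewrite /Rintegral integral_fejer_scale. Qed.

Definition tri a x : R := Num.max 0 (a - `|x|).

(** The second difference of the absolute value: from it the transform of the kernel gets its
    triangular shape. *)
Lemma triE a x : 0 <= a -> `|a + x| + `|a - x| - 2 * `|x| = 2 * tri a x.
Proof.
move=> a0; rewrite /tri.
have [x0|x0] := leP 0 x; [rewrite (ger0_norm x0)|rewrite (ltr0_norm x0)].
- rewrite ger0_norm ?addr_ge0//; have [ax|ax] := leP x a.
    by rewrite ger0_norm ?subr_ge0// max_r ?subr_ge0//; ring.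
  by rewrite ltr0_norm ?subr_lt0// max_l ?subr_le0 ?(ltW ax)//; ring.
- rewrite [`|a - x|]ger0_norm; last by rewrite subr_ge0 (le_trans (ltW x0)).
  have [ax|ax] := leP 0 (a + x).
    by rewrite ger0_norm// opprK max_r//; ring.
  by rewrite ltr0_norm// opprK max_l ?(ltW ax)//; ring.
Qed.

(** From (1 - cos as) cos xs = (1 - cos (a+x)s) / 2 + (1 - cos (a-x)s) / 2 - (1 - cos xs): the
    integrand of the cosine transform is a combination of scaled kernels with known integrals. *)
Lemma fejer_cosE a x s : a ^+ 2 * fejer (a * s) * cos (x * s) =
  2^-1 * ((a + x) ^+ 2 * fejer ((a + x) * s)) +
  2^-1 * ((a - x) ^+ 2 * fejer ((a - x) * s)) - x ^+ 2 * fejer (x * s).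
Proof.
have [->|s0] := eqVneq s 0.
  have f0 : fejer 0 = 1 by rewrite /fejer eqxx.
  by rewrite !mulr0 f0 (@cos0 R) !mulr1; field.
have h b : b ^+ 2 * fejer (b * s) = 2 * (1 - cos (b * s)) / s ^+ 2.
  have [->|b0] := eqVneq b 0; first by rewrite expr2 !mul0r cos0 subrr mulr0 mul0r.
  by rewrite fejerE ?mulf_neq0//; field; rewrite s0 b0.
rewrite !h.
have -> : (a + x) * s = a * s + x * s by ring.
have -> : (a - x) * s = a * s - x * s by ring.
by rewrite cosD cosB; field.
Qed.

Lemma cintegrable_fejer a x : 0 < a ->
  cintegrable l1 setT (fun s => (fejer (a * s))%:C%C * expi (x * s)).
Proof.
move=> a0.
have fi : cintegrable l1 setT (fun s => (fejer (a * s))%:C%C).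
  apply: cintegrable_real => //.
  have := integrableZl measurableT (a ^- 2) (integrable_fejer_scale a).
  apply: eq_integrable => // s _ /=; congr EFin; field.
  by rewrite gt_eqF.
have ms : measurable_fun setT (fun s : R => x * s) by exact: mulrl_measurable.
apply: (@cintegrable_bounded_mul _ _ _ _ _ _ _ _ 1) => //.
  split => /=.
    apply: (measurableT_comp _ ms); apply: continuous_measurable_fun.
    exact: continuous_cos.
  apply: (measurableT_comp _ ms); apply: continuous_measurable_fun.
  exact: continuous_sin.
by move=> s _; rewrite /= cos2Dsin2 sqrtr1.
Qed.

Lemma Rintegral_odd (h : R -> R) : l1.-integrable setT (EFin \o h) ->
  (forall s, h (- s) = - h s) -> \int[l1]_s h s = 0.
Proof.
move=> hi ho.
have mN : measurable_fun setT (-%R : measurableTypeR R -> measurableTypeR R).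
  exact: oppr_measurable.
have mh := measurable_int _ hi.
have e : (\int[l1]_s (h s)%:E = \int[l1]_s (h (- s))%:E)%E.
  transitivity (\int[pushforward l1 (-%R : measurableTypeR R -> measurableTypeR R)]_s (h s)%:E)%E.
    apply: eq_measure_integral => A mA _; exact/esym/lebesgue_measureN.
  apply: (integral_pushforward mN mh (mu := l1) (D := setT)) => //.
  have := integrableN hi; apply: eq_integrable => // s _.
  by rewrite /= ho.
have : \int[l1]_s h s = - \int[l1]_s h s.
  rewrite {1}/Rintegral e -mulN1r -RintegralZl//.
  by apply: eq_Rintegral => s _; rewrite ho mulN1r.
by move=> h2; apply/eqP; rewrite -[_ == _](mulrn_eq0 _ 2) mulr2n {1}h2 addNr.
Qed.

(** Integrating [fejer_cosE] gives pi (|a + x| + |a - x| - 2 |x|), which [triE] evaluates; the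
    imaginary part is odd. *)
Lemma fejer_fourier a x : 0 < a ->
  cint l1 setT (fun s => (fejer (a * s))%:C%C * expi (x * s)) =
  (2 * pi * a ^- 2 * tri a x)%:C%C.
Proof.
move=> a0; have an0 : a != 0 by rewrite gt_eqF.
have ci := cintegrable_fejer x a0.
apply: complex_eqP => /=.
- under eq_Rintegral do rewrite mul0r subr0.
  transitivity (\int[l1]_s (a ^- 2 * (2^-1 * ((a + x) ^+ 2 * fejer ((a + x) * s)) +
     2^-1 * ((a - x) ^+ 2 * fejer ((a - x) * s)) - x ^+ 2 * fejer (x * s)))).
    by apply: eq_Rintegral => s _; rewrite -fejer_cosE; field.
  have zi c b : l1.-integrable setT (EFin \o (fun s => c * (b ^+ 2 * fejer (b * s)))).
    by have := integrableZl measurableT c (integrable_fejer_scale b); apply: eq_integrable.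
  have di : l1.-integrable setT (EFin \o (fun s =>
      2^-1 * ((a + x) ^+ 2 * fejer ((a + x) * s)) +
      2^-1 * ((a - x) ^+ 2 * fejer ((a - x) * s)))).
    by have := integrableD measurableT (zi 2^-1 (a + x)) (zi 2^-1 (a - x)); apply: eq_integrable.
  have xi := integrable_fejer_scale x.
  have bi : l1.-integrable setT (EFin \o (fun s =>
      2^-1 * ((a + x) ^+ 2 * fejer ((a + x) * s)) +
      2^-1 * ((a - x) ^+ 2 * fejer ((a - x) * s)) - x ^+ 2 * fejer (x * s))).
    by have := integrableB measurableT di xi; apply: eq_integrable.
  rewrite (RintegralZl _ measurableT bi) (RintegralB measurableT di xi).
  rewrite (RintegralD measurableT (zi _ _) (zi _ _)).
  rewrite !(RintegralZl _ measurableT (integrable_fejer_scale _)).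
  rewrite !Rintegral_fejer_scale.
  have := triE x (ltW a0).
  move: (`|a + x|) (`|a - x|) (`|x|) (tri a x) => u v w t h.
  have -> : t = (u + v - 2 * w) / 2 by rewrite h; field.
  by field.
- under eq_Rintegral do rewrite mul0r addr0.
  apply: Rintegral_odd.
    have := cintegrable_Im measurableT ci; apply: eq_integrable => // s _ /=.
    by rewrite mul0r addr0.
  by move=> s; rewrite !mulrN fejerN sinN mulrN.
Qed.

Lemma tri_ge0 a x : 0 <= tri a x. Proof. by rewrite le_max lexx. Qed.

Lemma tri_le a x : 0 <= a -> tri a x <= a.
Proof. by move=> a0; rewrite ge_max a0 gerBl normr_ge0. Qed.

Lemma tri_eq0 a x : a <= `|x| -> tri a x = 0.
Proof. by move=> ax; apply/max_idPl; rewrite subr_le0. Qed.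

Lemma continuous_tri a : continuous (tri a).
Proof.
have -> : tri a = (fun x => 2^-1 * (`|a - `|x| | + (a - `|x|))).
  apply/funext => x; rewrite /tri; have [h|h] := leP (a - `|x|) 0.
    by rewrite (ler0_norm h) addNr mulr0.
  by rewrite (gtr0_norm h); field.
have c x : a - `|y| @[y --> x] --> a - `|x|.
  by apply: cvgB; [exact: cvg_cst|exact: norm_continuous].
by move=> x; apply: cvgMr; apply: cvgD; [apply: cvg_norm; exact: c|exact: c].
Qed.

Lemma integral_tri a : 0 < a -> (\int[l1]_x (tri a x)%:E = (a ^+ 2)%:E)%E.
Proof.
move=> a0; rewrite ge0_symfun_integralT; first last.
- by move=> x /=; rewrite /tri normrN.
- exact: continuous_tri.
- exact: tri_ge0.
have -> : (\int[l1]_(x in [set x | (0 <= x)%R]) (tri a x)%:E =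
    \int[l1]_(x in `[0%R, a]) (a - x)%:E)%E.
  rewrite integral_mkcond [RHS]integral_mkcond; apply: eq_integral => x _.
  have e1 : (x \in [set x : R | 0 <= x]) = (0 <= x) by apply/idP/idP; rewrite inE.
  have e2 : (x \in `[0, a]%classic) = (0 <= x <= a).
    by apply/idP/idP; rewrite inE /= in_itv.
  rewrite /patch e1 e2; have [x0|//] := boolP (0 <= x).
  rewrite /tri (ger0_norm x0) /=; have [xa|xa] := leP x a.
    by rewrite max_r// subr_ge0.
  by rewrite max_l// subr_le0 ltW.
pose F x := a * x - 2^-1 * (x * x).
have dF x : is_derive x 1 F (a - x).
  have h1 := is_derive_mul (is_derive_const a x) (is_derive_id x 1).
  have h2 := is_derive_mul (is_derive_const (- 2^-1) x)
     (is_derive_mul (is_derive_id x 1) (is_derive_id x 1)).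
  have := is_derive_add h1 h2; congr (is_derive _ _ _ _).
    by apply/funext => y; rewrite /F mulNr.
  by field.
have cF := is_derive_continuous dF.
rewrite (@continuous_FTC2 _ (fun x => a - x) F 0 a)//.
- by rewrite -EFinB -EFinM; congr EFin; rewrite /F; field.
- apply: continuous_subspaceT => x.
  by apply: cvgB; [exact: cvg_cst|exact: cvg_id].
- split.
  + by move=> x _; case: (dF x).
  + by apply: cvg_at_right_filter; exact: cF.
  + by apply: cvg_at_left_filter; exact: cF.
- by move=> x _; rewrite derive1E; case: (dF x).
Qed.

End fejer_kernel.

(** * Characters of R^d *)

Section exponentials.
Variables (R : realType) (d : nat).
Implicit Types (x y : 'rV[R]_d) (a b : R).

Lemma expiD a b : expi (a + b) = expi a * expi b.
Proof. by apply: complex_eqP; rewrite /= ?cosD ?sinD//; ring. Qed.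

Lemma expi0 : expi 0 = 1 :> R[i].
Proof. by apply: complex_eqP; rewrite /= ?cos0 ?sin0. Qed.

Lemma expi_conj a : (expi a)^*%C = expi (- a).
Proof. by apply: complex_eqP; rewrite /= ?cosN ?sinN. Qed.

Lemma nc_expi a : nc (expi a) = 1.
Proof. by rewrite /= cos2Dsin2 sqrtr1. Qed.

Lemma expi_sum (I : finType) (F : I -> R) : expi (\sum_i F i) = \prod_i expi (F i).
Proof.
elim: (index_enum I) => [|i s IH]; first by rewrite !big_nil expi0.
by rewrite !big_cons expiD IH.
Qed.

Lemma dotvC x y : dotv x y = dotv y x.
Proof. by apply: eq_bigr => i _; rewrite mulrC. Qed.

Lemma dotvDl x y z : dotv (x + y) z = dotv x z + dotv y z.
Proof. by rewrite /dotv -big_split/=; apply: eq_bigr => i _; rewrite mxE mulrDl. Qed.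

Lemma dotvNl x z : dotv (- x) z = - dotv x z.
Proof. by rewrite /dotv -sumrN; apply: eq_bigr => i _; rewrite mxE mulNr. Qed.

Lemma dotvBl x y z : dotv (x - y) z = dotv x z - dotv y z.
Proof. by rewrite dotvDl dotvNl. Qed.

Lemma dotvZl a x z : dotv (a *: x) z = a * dotv x z.
Proof. by rewrite /dotv mulr_sumr; apply: eq_bigr => i _; rewrite mxE mulrA. Qed.

Lemma dotvZr a x z : dotv x (a *: z) = a * dotv x z.
Proof. by rewrite dotvC dotvZl dotvC. Qed.

Lemma cmeas_expi d' (T : measurableType d') (h : T -> R) :
  measurable_fun setT h -> cmeas setT (fun w => expi (h w)).
Proof.
move=> mh; split => /=.
  apply: (measurableT_comp _ mh); apply: continuous_measurable_fun.
  exact: continuous_cos.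
apply: (measurableT_comp _ mh); apply: continuous_measurable_fun.
exact: continuous_sin.
Qed.

Lemma cmeas_kernel :
  cmeas setT (fun z : 'rV[R]_d * 'rV[R]_d => expi (dotv z.1 z.2)).
Proof.
rewrite (_ : (fun z => _) = (fun z : 'rV[R]_d * 'rV[R]_d =>
    \prod_i expi (z.1 ord0 i * z.2 ord0 i))); last first.
  by apply/funext => z; rewrite /dotv expi_sum.
apply: (cmeas_prod (F := fun i (z : 'rV[R]_d * 'rV[R]_d) =>
   expi (z.1 ord0 i * z.2 ord0 i))) => i.
apply: cmeas_expi; apply: measurable_funM.
- exact: (measurableT_comp (@measurable_coord R d i) measurable_fst).
- exact: (measurableT_comp (@measurable_coord R d i) measurable_snd).
Qed.

Lemma cmeas_kernelN :
  cmeas setT (fun z : 'rV[R]_d * 'rV[R]_d => expi (- dotv z.1 z.2)).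
Proof.
by have := cmeas_conj cmeas_kernel; under eq_fun do rewrite expi_conj.
Qed.

Lemma cmeas_character x : cmeas setT (fun xi => expi (dotv x xi)).
Proof. exact: (cmeas_comp (pair1_measurable x) cmeas_kernel). Qed.

Lemma cmeas_characterN x : cmeas setT (fun xi => expi (- dotv x xi)).
Proof. exact: (cmeas_comp (pair1_measurable x) cmeas_kernelN). Qed.

End exponentials.

(** * The Fejer kernel on R^d *)

Section fejer_rV.
Variables (R : realType) (d : nat).
Implicit Types (x y xi eta : 'rV[R]_d) (a : R).
Local Notation l1 := (@lebesgue_measure R).
Local Notation mu := (@leb R d).

Definition fejer_rV a x : R := \prod_i fejer (a * x ord0 i).
Definition tri_rV a x : R := \prod_i tri a (x ord0 i).

Lemma fejer_rV_ge0 a x : 0 <= fejer_rV a x.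
Proof. by apply: prodr_ge0 => i _; exact: fejer_ge0. Qed.

Lemma fejer_rV_le1 a x : fejer_rV a x <= 1.
Proof.
by apply: prodr_ile1 => i; rewrite fejer_ge0 fejer_le1.
Qed.

Lemma tri_rV_ge0 a x : 0 <= tri_rV a x.
Proof. by apply: prodr_ge0 => i _; exact: tri_ge0. Qed.

Lemma tri_rV_le a x : 0 <= a -> tri_rV a x <= a ^+ d.
Proof.
move=> a0; rewrite -[X in _ <= a ^+ X]card_ord -prodr_const.
by apply: ler_prod => i _; rewrite tri_ge0 tri_le.
Qed.

Lemma tri_rV_eq0 a x : a < `|x| -> 0 <= a -> tri_rV a x = 0.
Proof.
move=> ax a0.
have [i xi] : exists i, a < `|x ord0 i|.
  apply: contrapT => h; move: ax; rewrite ltNge => /negP; apply.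
  apply/rV_norm_leP => // i; rewrite leNgt; apply/negP => h'.
  by apply: h; exists i.
by rewrite /tri_rV (bigD1 i)//= tri_eq0 ?mul0r// ltW.
Qed.

Lemma prodr_real_complex (I : finType) (F : I -> R) :
  (\prod_i F i)%:C%C = \prod_i (F i)%:C%C.
Proof. exact: rmorph_prod. Qed.

Lemma fejer_rV_fourier a x : 0 < a ->
  cintegrable mu setT (fun xi => (fejer_rV a xi)%:C%C * expi (dotv x xi)) /\
  cint mu setT (fun xi => (fejer_rV a xi)%:C%C * expi (dotv x xi)) =
    ((2 * pi * a ^- 2) ^+ d * tri_rV a x)%:C%C.
Proof.
move=> a0; have e : (fun xi => (fejer_rV a xi)%:C%C * expi (dotv x xi)) =
   (fun xi : 'rV[R]_d => \prod_i ((fejer (a * xi ord0 i))%:C%C * expi (x ord0 i * xi ord0 i))).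
  apply/funext => xi; rewrite /fejer_rV prodr_real_complex /dotv expi_sum.
  by rewrite -big_split.
have [h1 h2] := cint_tensor (fun i : 'I_d => cintegrable_fejer (x ord0 i) a0).
rewrite e; split => //; rewrite h2.
under eq_bigr do rewrite fejer_fourier//.
rewrite -prodr_real_complex; congr (_%:C%C).
by rewrite big_split /= prodr_const card_ord.
Qed.

Lemma fejer_rV_integrable a : 0 < a ->
  cintegrable mu setT (fun xi => (fejer_rV a xi)%:C%C).
Proof.
move=> a0; have [h _] := fejer_rV_fourier 0 a0; move: h.
congr (cintegrable _ _ _); apply/funext => xi.
by rewrite /dotv big1 ?expi0 ?mulr1// => i _; rewrite mxE mul0r.
Qed.

Lemma ge0_integral_shift1 (c : R) (h : R -> \bar R) :
  measurable_fun setT h -> (forall s, 0 <= h s)%E ->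
  (\int[l1]_s h (s + c)%R = \int[l1]_s h s)%E.
Proof.
move=> mh h0.
have mc : measurable_fun setT (fun x : measurableTypeR R => x + c : measurableTypeR R).
  by apply: measurable_funD.
pose pm := measure_function_pushforward__canonical__measure_function_Measure l1 mc.
have key (X : set (measurableTypeR R)) : ocitv X -> l1 X = pm X.
  move=> [[x y] _ <-] /=; rewrite /pushforward.
  have -> : (fun s : R => s + c) @^-1` `]x, y] = `]x - c, y - c]%classic.
    by apply/seteqP; split => z /=; rewrite !in_itv /= ltrBlDr lerBrDr.
  rewrite !lebesgue_measure_itv /= !lte_fin ltrD2r.
  by case: ifP => // _; rewrite -!EFinB; congr EFin; ring.
transitivity (\int[pushforward l1 (fun s : measurableTypeR R => (s + c)%R : measurableTypeR R)]_s h s)%E.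
  exact/esym/(ge0_integral_pushforward mc l1 measurableT mh (fun s _ => h0 s)).
by apply: eq_measure_integral => A mA _; exact/esym/(lebesgue_measure_unique key mA).
Qed.

Lemma integral_tri_rV a xi : 0 < a ->
  cintegrable mu setT (fun eta => (tri_rV a (eta - xi))%:C%C) /\
  cint mu setT (fun eta => (tri_rV a (eta - xi))%:C%C) = (a ^+ (2 * d))%:C%C.
Proof.
move=> a0; have e : (fun eta => (tri_rV a (eta - xi))%:C%C) =
   (fun eta : 'rV[R]_d => \prod_i (tri a (eta ord0 i - xi ord0 i))%:C%C).
  apply/funext => eta; rewrite /tri_rV prodr_real_complex.
  by apply: eq_bigr => i _; rewrite !mxE.
have mt (c : R) : measurable_fun setT (fun s : R => tri a (s - c)).
  apply: continuous_measurable_fun => s.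
  apply: (@continuous_comp _ _ _ (fun s : R => s - c) (tri a)).
    by apply: cvgB; [exact: cvg_id|exact: cvg_cst].
  exact: continuous_tri.
have it (c : R) : (\int[l1]_s (tri a (s - c))%:E = (a ^+ 2)%:E)%E.
  rewrite -integral_tri// -(ge0_integral_shift1 (- c) (h := fun s => (tri a s)%:E))//.
    by apply/measurable_EFinP; apply: continuous_measurable_fun; exact: continuous_tri.
  by move=> s; rewrite lee_fin tri_ge0.
have ci (c : R) : cintegrable l1 setT (fun s : R => (tri a (s - c))%:C%C).
  split; first by apply: (cmeas_real (h := fun s : R => tri a (s - c))); exact: mt.
  rewrite [X in (X < _)%E](_ : _ = (a ^+ 2)%:E) ?ltry// -(it c).
  by apply: eq_integral => s _; rewrite nc_real ger0_norm// tri_ge0.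
have [h1 h2] := cint_tensor (fun i : 'I_d => ci (xi ord0 i)).
rewrite e; split => //; rewrite h2.
under eq_bigr => i _.
  rewrite (_ : cint _ _ _ = (a ^+ 2)%:C%C).
    over.
  apply: complex_eqP => /=; first by rewrite /Rintegral it.
  by rewrite Rintegral_cst// mul0r.
by rewrite -prodr_real_complex prodr_const card_ord exprM.
Qed.

Lemma measurable_prod_fin d' (T : measurableType d') (I : finType) (F : I -> T -> R) :
  (forall i, measurable_fun setT (F i)) -> measurable_fun setT (fun w => \prod_i F i w).
Proof.
move=> mF; elim: (index_enum I) => [|i s IH].
  by under eq_fun do rewrite big_nil; exact: measurable_cst.
by under eq_fun do rewrite big_cons; exact: measurable_funM.
Qed.

Lemma measurable_tri_diff a : measurable_fun setT
  (fun z : 'rV[R]_d * 'rV[R]_d => tri_rV a (z.2 - z.1)).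
Proof.
apply: (measurable_prod_fin (F := fun i (z : 'rV[R]_d * 'rV[R]_d) =>
  tri a ((z.2 - z.1) ord0 i))) => i.
have mt : measurable_fun setT (tri a).
  by apply: continuous_measurable_fun; exact: continuous_tri.
apply: (measurableT_comp mt).
rewrite (_ : (fun z => _) = (fun z : 'rV[R]_d * 'rV[R]_d => z.2 ord0 i - z.1 ord0 i)); last first.
  by apply/funext => z; rewrite !mxE.
apply: measurable_funB.
- exact: (measurableT_comp (@measurable_coord R d i) measurable_snd).
- exact: (measurableT_comp (@measurable_coord R d i) measurable_fst).
Qed.

Lemma measurable_fejer_rV a : measurable_fun setT (fejer_rV a).
Proof.
apply: (measurable_prod_fin (F := fun i (z : 'rV[R]_d) => fejer (a * z ord0 i))) => i.
apply: (measurableT_comp (@measurable_fejer R)).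
exact: (measurableT_comp (@mulrl_measurable R setT a) (@measurable_coord R d i)).
Qed.

Lemma fejer_rV_cvg x : fejer_rV (n.+1%:R^-1) x @[n --> \oo] --> (1 : R).
Proof.
rewrite /fejer_rV; elim: (index_enum 'I_d) => [|i s IH].
  by under eq_fun do rewrite big_nil; exact: cvg_cst.
under eq_fun do rewrite big_cons.
have h : n.+1%:R^-1 * x ord0 i @[n --> \oo] --> (0 : R).
  by rewrite -(mul0r (x ord0 i)); apply: cvgMl; exact: cvg_harmonic.
have := cvg_comp _ _ h (@continuous_fejer R 0).
rewrite [fejer 0](_ : _ = 1) => [{}h|]; last by rewrite /fejer eqxx.
have := cvgM h IH; rewrite mulr1; exact.
Qed.

End fejer_rV.

(** * The Fourier transform *)

Section fourier_transform.
Variables (R : realType) (d : nat).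
Implicit Types (x y xi eta : 'rV[R]_d) (a : R) (phi u v : 'rV[R]_d -> R[i]).
Local Notation mu := (@leb R d).

(** The absolutely convergent transform: it is applied to integrable functions, such as those of L_2
    with bounded support. *)
Definition fourier phi x : R[i] := cint mu setT (fun xi => phi xi * expi (- dotv x xi)).

Lemma cintegrable_fourier phi x : cintegrable mu setT phi ->
  cintegrable mu setT (fun xi => phi xi * expi (- dotv x xi)).
Proof.
move=> hp; apply: (@cintegrable_bounded_mul _ _ _ _ _ _ _ _ 1) => //.
  exact: cmeas_characterN.
by move=> xi _; rewrite nc_expi.
Qed.

Lemma cintegrable_inv_fourier phi x : cintegrable mu setT phi ->
  cintegrable mu setT (fun xi => phi xi * expi (dotv x xi)).
Proof.
move=> hp; apply: (@cintegrable_bounded_mul _ _ _ _ _ _ _ _ 1) => //.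
  exact: cmeas_character.
by move=> xi _; rewrite nc_expi.
Qed.

Lemma fourier_le phi x : cintegrable mu setT phi ->
  nc (fourier phi x) <= 2 * \int[mu]_xi nc (phi xi).
Proof.
move=> hp; rewrite (le_trans (nc_cint measurableT (cintegrable_fourier x hp)))//.
by under eq_Rintegral do rewrite Normc.normcM nc_expi mulr1.
Qed.

Lemma mul_fourier_swap u v : cintegrable mu setT u -> cintegrable mu setT v ->
  cint mu setT (fun x => u x * cint mu setT (fun y => v y * expi (dotv x y))) =
  cint mu setT (fun y => v y * cint mu setT (fun x => u x * expi (dotv x y))).
Proof.
move=> hu hv; apply: (cint_mul_swap (k := fun z => expi (dotv z.1 z.2)) (M := 1)) => //.
  exact: cmeas_kernel.
by move=> z; rewrite nc_expi.
Qed.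

Lemma mul_fourierN_swap u v : cintegrable mu setT u -> cintegrable mu setT v ->
  cint mu setT (fun x => u x * cint mu setT (fun y => v y * expi (- dotv x y))) =
  cint mu setT (fun y => v y * cint mu setT (fun x => u x * expi (- dotv x y))).
Proof.
move=> hu hv; apply: (cint_mul_swap (k := fun z => expi (- dotv z.1 z.2)) (M := 1)) => //.
  exact: cmeas_kernelN.
by move=> z; rewrite nc_expi.
Qed.

Let C a : R := (2 * pi * a ^- 2) ^+ d.

Let C_ge0 a : 0 <= C a.
Proof. by rewrite exprn_ge0// mulr_ge0 ?invr_ge0 ?sqr_ge0// mulr_ge0// pi_ge0. Qed.

(** The squared modulus is a product of two integrals, and x is integrated first: the damped
    character at xi - eta becomes a triangle. Damping by the kernel provides the integrability for
    Fubini. *)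
Lemma fejer_fourier_double phi a : cintegrable mu setT phi -> cmeas setT (fourier phi) ->
  0 < a ->
  cint mu setT (fun x => (fejer_rV a x * nc (fourier phi x) ^+ 2)%:C%C) =
  cint mu setT (fun xi => (phi xi)^*%C *
     cint mu setT (fun eta => phi eta * (C a * tri_rV a (eta - xi))%:C%C)).
Proof.
move=> hp mF a0.
pose M := 2 * \int[mu]_xi nc (phi xi).
have hK := fejer_rV_integrable d a0.
have hu : cintegrable mu setT (fun x => (fejer_rV a x)%:C%C * fourier phi x).
  apply: (@cintegrable_bounded_mul _ _ _ _ _ _ _ _ M) => // x _.
  exact: fourier_le.
transitivity (cint mu setT (fun x => ((fejer_rV a x)%:C%C * fourier phi x) *
    cint mu setT (fun xi => (phi xi)^*%C * expi (dotv x xi)))).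
  apply: eq_cint => x _; rewrite rmorphM -[RHS]mulrA; congr (_ * _).
  rewrite -[LHS](mul_conj (fourier phi x)); congr (_ * _); rewrite -cint_conj//; last exact: cintegrable_fourier.
  by apply: eq_cint => xi _; rewrite conjM expi_conj opprK.
have hpc : cintegrable mu setT (fun xi => (phi xi)^*%C) by exact: cintegrable_conj.
rewrite (mul_fourier_swap hu hpc).
apply: eq_cint => xi _; congr (_ * _).
have hKe : cintegrable mu setT (fun x => (fejer_rV a x)%:C%C * expi (dotv xi x)).
  exact: cintegrable_inv_fourier.
transitivity (cint mu setT (fun x => ((fejer_rV a x)%:C%C * expi (dotv xi x)) *
   cint mu setT (fun eta => phi eta * expi (- dotv x eta)))).
  by apply: eq_cint => x _; rewrite mulrAC dotvC.
rewrite mul_fourierN_swap//; apply: eq_cint => eta _; congr (_ * _).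
have [_ e] := fejer_rV_fourier (xi - eta) a0.
rewrite (_ : tri_rV a (eta - xi) = tri_rV a (xi - eta)); last first.
  by apply: eq_bigr => i _; rewrite !mxE /tri distrC.
rewrite /C -e; apply: eq_cint => x _.
by rewrite -mulrA -expiD dotvBl (dotvC x eta).
Qed.

Lemma ge0_tri_rV_integral a xi : 0 < a ->
  (\int[mu]_eta (tri_rV a (eta - xi))%:E = (a ^+ (2 * d))%:E)%E.
Proof.
move=> a0; have [h1 h2] := integral_tri_rV xi a0.
have := congr1 (fun z : R[i] => complex.Re z) h2; rewrite /= /Rintegral => <-.
rewrite fineK//; apply: integrable_fin_num => //.
exact: (cintegrable_Re measurableT h1).
Qed.

(** A Schur test on the double integral: |phi(xi) phi(eta)| is at most half the sum of the squares,
    and the triangle has the same integral in either variable. *)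
Lemma plancherel_fejer phi a : cintegrable mu setT phi ->
  (\int[mu]_xi (nc (phi xi) ^+ 2)%:E < +oo)%E -> cmeas setT (fourier phi) -> 0 < a ->
  (\int[mu]_x (fejer_rV a x * nc (fourier phi x) ^+ 2)%:E <=
    (2 * (2 * pi) ^+ d)%:E * \int[mu]_xi (nc (phi xi) ^+ 2)%:E)%E.
Proof.
move=> hp p2 mF a0; have [mp _] := hp.
pose M := 2 * \int[mu]_xi nc (phi xi).
have an0 : a != 0 by rewrite gt_eqF.
have hL : cintegrable mu setT (fun x => (fejer_rV a x * nc (fourier phi x) ^+ 2)%:C%C).
  have hM : cintegrable mu setT (fun x => (M ^+ 2)%:C%C * (fejer_rV a x)%:C%C).
    by apply: cintegrableZ => //; exact: fejer_rV_integrable.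
  apply: (@cintegrable_le _ _ _ mu setT measurableT _
    (fun x => nc ((M ^+ 2)%:C%C * (fejer_rV a x)%:C%C))).
  - apply: cmeas_real; apply: measurable_funM; first exact: measurable_fejer_rV.
    by apply: measurable_funX; exact: cmeas_nc.
  - move=> x _; rewrite Normc.normcM !nc_real.
    rewrite (ger0_norm (sqr_ge0 M)) (ger0_norm (fejer_rV_ge0 a x)).
    rewrite ger0_norm; last by rewrite mulr_ge0 ?fejer_rV_ge0 ?sqr_ge0.
    rewrite mulrC ler_wpM2r ?fejer_rV_ge0//.
    have h := fourier_le x hp; have M0 : 0 <= M by exact: le_trans (nc_ge0 _) h.
    by rewrite ler_sqr ?nnegrE ?nc_ge0.
  - exact: (cintegrable_nc hM).
pose w (z : 'rV[R]_d * 'rV[R]_d) : R[i] :=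
  (phi z.1)^*%C * phi z.2 * (C a * tri_rV a (z.2 - z.1))%:C%C.
have mT : cmeas setT (fun z : 'rV[R]_d * 'rV[R]_d => (C a * tri_rV a (z.2 - z.1))%:C%C).
  by apply: cmeas_real; apply: measurable_funM => //; exact: measurable_tri_diff.
have Tb (z : 'rV[R]_d) : nc (C a * tri_rV a z)%:C%C <= C a * a ^+ d.
  rewrite nc_real ger0_norm; last by rewrite mulr_ge0 ?C_ge0 ?tri_rV_ge0.
  by apply: ler_wpM2l; [exact: C_ge0|apply: tri_rV_le; exact: ltW].
have wi : cintegrable (mu \x mu)%E setT w.
  exact: (cintegrable_prod (cintegrable_conj hp) hp mT (fun z => Tb (z.2 - z.1))).
have e : cint mu setT (fun x => (fejer_rV a x * nc (fourier phi x) ^+ 2)%:C%C) =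
    cint (mu \x mu)%E setT w.
  rewrite fejer_fourier_double// -cint_fubini1//; apply: eq_cint => xi _.
  rewrite -cintZ//; first by apply: eq_cint => eta _; rewrite mulrA.
  apply: (@cintegrable_bounded_mul _ _ _ _ _ _ _ _ (C a * a ^+ d)) => //.
  exact: (cmeas_comp (pair1_measurable xi) mT).
have LE : (\int[mu]_x (fejer_rV a x * nc (fourier phi x) ^+ 2)%:E =
    (complex.Re (cint (mu \x mu)%E setT w))%:E)%E.
  rewrite -e /= /Rintegral fineK//; apply: integrable_fin_num => //.
  exact: (cintegrable_Re measurableT hL).
rewrite LE.
have wn := cintegrable_nc wi.
apply: (@le_trans _ _ (2%:E * \int[(mu \x mu)%E]_z (nc (w z))%:E)%E).
  have h := nc_cint measurableT wi.
  rewrite -[X in (_ <= _ * X)%E]fineK; last exact: integrable_fin_num.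
  rewrite -EFinM lee_fin; apply: le_trans h; apply: le_trans (Re_le_nc _).
  exact: ler_norm.
rewrite EFinM -muleA lee_pmul2l//.
pose T (z : 'rV[R]_d) := C a * tri_rV a z.
have T0 z : 0 <= T z by rewrite mulr_ge0 ?C_ge0 ?tri_rV_ge0.
have mTr : measurable_fun setT (fun z : 'rV[R]_d * 'rV[R]_d => T (z.2 - z.1)).
  by apply: measurable_funM => //; exact: measurable_tri_diff.
(* The factor a^(-2d) in [C a] cancels the mass a^(2d) of the triangle, so the bound does not depend
   on a. *)
have iT xi : (\int[mu]_eta (T (eta - xi))%:E = ((2 * pi) ^+ d)%:E)%E.
  rewrite /T; under eq_integral do rewrite EFinM.
  rewrite ge0_integralZl_EFin ?C_ge0//.
  - rewrite ge0_tri_rV_integral// -EFinM; congr EFin.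
    by rewrite /C exprM -exprMn; congr (_ ^+ _); field.
  - by move=> eta _; rewrite lee_fin tri_rV_ge0.
  - apply/measurable_EFinP.
    exact: (measurableT_comp (@measurable_tri_diff R d a) (pair1_measurable xi)).
have mn : measurable_fun setT (fun xi => (nc (phi xi) ^+ 2)%:E) by exact: cmeas_nc2.
pose g1 (z : 'rV[R]_d * 'rV[R]_d) := (nc (phi z.1) ^+ 2 * T (z.2 - z.1))%:E.
pose g2 (z : 'rV[R]_d * 'rV[R]_d) := (nc (phi z.2) ^+ 2 * T (z.2 - z.1))%:E.
have mg1 : measurable_fun setT g1.
  apply/measurable_EFinP; apply: measurable_funM => //; apply: measurable_funX.
  exact: (measurableT_comp (cmeas_nc mp) measurable_fst).
have mg2 : measurable_fun setT g2.
  apply/measurable_EFinP; apply: measurable_funM => //; apply: measurable_funX.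
  exact: (measurableT_comp (cmeas_nc mp) measurable_snd).
have g10 z : (0 <= g1 z)%E by rewrite lee_fin mulr_ge0 ?sqr_ge0.
have g20 z : (0 <= g2 z)%E by rewrite lee_fin mulr_ge0 ?sqr_ge0.
have ig1 : (\int[(mu \x mu)%E]_z g1 z = ((2 * pi) ^+ d)%:E * \int[mu]_xi (nc (phi xi) ^+ 2)%:E)%E.
  rewrite fubini_tonelli1// /fubini_F /g1 /=.
  rewrite -ge0_integralZl_EFin//; last first.
    by rewrite exprn_ge0// mulr_ge0// pi_ge0.
    by move=> x _; rewrite lee_fin sqr_ge0.
  apply: eq_integral => xi _; under eq_integral do rewrite EFinM.
  rewrite ge0_integralZl_EFin ?sqr_ge0//.
  - by rewrite iT muleC.
  - by move=> eta _; rewrite lee_fin.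
  - apply/measurable_EFinP; exact: (measurableT_comp mTr (pair1_measurable xi)).
have ig2 : (\int[(mu \x mu)%E]_z g2 z = ((2 * pi) ^+ d)%:E * \int[mu]_xi (nc (phi xi) ^+ 2)%:E)%E.
  rewrite fubini_tonelli2// /fubini_G /g2 /=.
  rewrite -ge0_integralZl_EFin//; last first.
    by rewrite exprn_ge0// mulr_ge0// pi_ge0.
    by move=> x _; rewrite lee_fin sqr_ge0.
  apply: eq_integral => eta _; under eq_integral do rewrite EFinM.
  rewrite ge0_integralZl_EFin ?sqr_ge0//.
  - rewrite muleC -(iT eta); congr (_ * _)%E; apply: eq_integral => xi _.
    by congr EFin; congr (_ * _); apply: eq_bigr => i _; rewrite !mxE /tri distrC.
  - by move=> xi _; rewrite lee_fin.
  - apply/measurable_EFinP; exact: (measurableT_comp mTr (pair2_measurable eta)).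
apply: (@le_trans _ _ (\int[(mu \x mu)%E]_z ((2^-1)%:E * (g1 z + g2 z)))%E).
  apply: ge0_le_integral => //.
  - by move=> z _; rewrite lee_fin nc_ge0.
  - by apply/measurable_EFinP; apply: cmeas_nc; case: wi.
  - by apply: measurable_funeM; exact: emeasurable_funD.
  - move=> z _; rewrite /g1 /g2 -EFinD -EFinM lee_fin /w !Normc.normcM nc_conj.
    rewrite nc_real ger0_norm ?T0// -mulrDl mulrA ler_wpM2r ?T0//.
    by have := sqr_ge0 (nc (phi z.1) - nc (phi z.2)); rewrite sqrrB; lra.
have g12 : measurable_fun setT (fun z => g1 z + g2 z)%E by exact: emeasurable_funD.
have g120 z : (0 <= g1 z + g2 z)%E by rewrite adde_ge0.
have h2 : 0 <= 2^-1 :> R by rewrite invr_ge0.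
rewrite (ge0_integralZl_EFin _ measurableT (fun z _ => g120 z) g12 h2).
rewrite ge0_integralD// ig1 ig2 -muleDl//.
rewrite muleA -EFinD -EFinM le_eqVlt; apply/orP; left; apply/eqP.
  by congr (_%:E * _)%E; field.
rewrite ge0_fin_numE//; apply: integral_ge0 => xi _.
by rewrite lee_fin sqr_ge0.
Qed.

(* The factor 2 is that of [nc_cint]; the sharp constant is not needed. *)
Lemma plancherel_le phi : cintegrable mu setT phi ->
  (\int[mu]_xi (nc (phi xi) ^+ 2)%:E < +oo)%E -> cmeas setT (fourier phi) ->
  (\int[mu]_x (nc (fourier phi x) ^+ 2)%:E <=
    (2 * (2 * pi) ^+ d)%:E * \int[mu]_xi (nc (phi xi) ^+ 2)%:E)%E.
Proof.
move=> hp p2 mF.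
pose F n x := (fejer_rV (n.+1%:R^-1) x * nc (fourier phi x) ^+ 2)%:E.
have mFn n : measurable_fun setT (F n).
  apply/measurable_EFinP; apply: measurable_funM; first exact: measurable_fejer_rV.
  by apply: measurable_funX; exact: cmeas_nc.
have F0 n x : (0 <= F n x)%E by rewrite lee_fin mulr_ge0 ?sqr_ge0 ?fejer_rV_ge0.
(* For a = 1 / (n + 1) the kernel tends to 1 pointwise, and Fatou's lemma removes the damping. *)
have -> : (\int[mu]_x (nc (fourier phi x) ^+ 2)%:E = \int[mu]_x limn_einf (F ^~ x))%E.
  apply: eq_integral => x _.
  have : F ^~ x @ \oo --> (nc (fourier phi x) ^+ 2)%:E.
    apply: cvg_EFin; first exact: nearW.
    rewrite -[X in _ --> X]mul1r; apply: cvgMl; exact: fejer_rV_cvg.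
  by move=> /cvg_limn_einf_sup ->.
apply: le_trans (fatou mu measurableT mFn (fun n x _ => F0 n x)) _.
apply: (@limn_einf_le _ _ _ 0%N) => n _; apply: plancherel_fejer => //.
Qed.

End fourier_transform.

(** * Fourier inversion for bounded spectra *)

Section inversion.
Variables (R : realType) (d : nat).
Implicit Types (x y xi : 'rV[R]_d) (a : R).
Local Notation mu := (@leb R d).

Lemma continuous_complexP (T : topologicalType) (f : T -> R[i]) :
  continuous (f : T -> R[i]^o) ->
  forall (p : T) (e : R), 0 < e -> \forall q \near p, nc (f p - f q) <= e.
Proof.
move=> cf p e e0; have /cvgrPdist_le/(_ e%:C%C) := cf p.
by rewrite ltcR => /(_ e0); apply: filterS => q; rewrite lecR.
Qed.

Lemma L2_cube_integrable (u : 'rV[R]_d -> R[i]) (r : R) :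
  hset (L2 setT) u -> cintegrable mu setT (fun x => if x \in cube d r then u x else 0).
Proof.
move=> hu; have /hset_L2P[mu' _] := hu.
have mc := @cube_measurable R d r.
have ic : mu.-integrable setT (EFin \o \1_(cube d r)).
  apply/integrableP; split; first by apply/measurable_EFinP; exact: measurable_indic.
  rewrite (eq_integral (fun x => (\1_(cube d r) x)%:E)); last first.
    by move=> x _; rewrite gee0_abs// lee_fin.
  rewrite integral_indic// setIT.
  have [r0|r0] := leP 0 r; first by rewrite -[X in (X < _)%E]/(lebesgue_rV R d _) lebesgue_cube// ltry.
  rewrite (_ : cube d r = set0) ?measure0//.
  apply/seteqP; split => // x /= xr.
  by have := lt_le_trans r0 (normr_ge0 x); rewrite ltNge xr.
apply: (@cintegrable_le _ _ _ mu setT measurableT _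
   (fun x => \1_(cube d r) x + nc (u x) ^+ 2)).
- apply: (cmeas_mkcond mc); exact: cmeas_sub mu'.
- move=> x _; rewrite indicE; case: ifP => _; last by rewrite Normc.normc0 add0r sqr_ge0.
  have := sqr_ge0 (nc (u x) - 1); rewrite sqrrB1; have := nc_ge0 (u x).
  by rewrite mulr1n; lra.
- have := integrableD measurableT ic (nc2_integrable hu).
  by apply: eq_integrable.
Qed.

Lemma L2_bounded_integrable (u : 'rV[R]_d -> R[i]) (r : R) :
  hset (L2 setT) u -> {ae mu, forall x, ~ cube d r x -> u x = 0} ->
  cintegrable mu setT u.
Proof.
move=> hu u0; have /hset_L2P[mu' _] := hu.
have [mc ic] := L2_cube_integrable r hu; split => //.
rewrite [X in (X < _)%E](_ : _ = \int[mu]_x (nc (if x \in cube d r then u x else 0))%:E)%E//.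
apply: ge0_ae_eq_integral => //.
- by apply/measurable_EFinP; exact: cmeas_nc.
- by apply/measurable_EFinP; exact: cmeas_nc.
- by move=> x _; rewrite lee_fin nc_ge0.
- by move=> x _; rewrite lee_fin nc_ge0.
apply: filterS u0 => x h _; case: ifPn => // /negP xr; rewrite h//.
by move=> h'; apply: xr; rewrite inE.
Qed.

Section inversion_proof.
Variables (f h : 'rV[R]_d -> R[i]) (r : R).
Hypotheses (cf : continuous (f : 'rV[R]_d -> R[i]^o)) (fh : is_inv_fourier f h)
  (h0 : {ae mu, forall xi, ~ cube d r xi -> h xi = 0}).

Let hf : hset (L2 setT) f. Proof. by case: fh. Qed.
Let hh : hset (L2 setT) h. Proof. by case: fh => _ []. Qed.
Let hi : cintegrable mu setT h. Proof. exact: L2_bounded_integrable hh h0. Qed.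

Variable x0 : 'rV[R]_d.

(** A damped character: paired with h it approximates [fourier h x0], while its own transform is a
    triangle around x0. *)
Let phi a xi : R[i] := (fejer_rV a xi)%:C%C * expi (- dotv x0 xi).

Let phi_i a : 0 < a -> cintegrable mu setT (phi a).
Proof.
move=> a0; have := cintegrable_fourier x0 (fejer_rV_integrable d a0); exact.
Qed.

Let nc_phi a xi : nc (phi a xi) = fejer_rV a xi.
Proof. by rewrite /phi Normc.normcM nc_expi mulr1 nc_real ger0_norm// fejer_rV_ge0. Qed.

Let phi_L2 a : 0 < a -> hset (L2 setT) (fun xi => (phi a xi)^*%C).
Proof.
move=> a0; have [mp ip] := phi_i a0; apply/hset_L2P; split; first exact: cmeas_conj.
apply: le_lt_trans ip; apply: ge0_le_integral => //.
- by move=> x _; rewrite lee_fin sqr_ge0.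
- by apply: cmeas_nc2; exact: cmeas_conj.
- by apply/measurable_EFinP; exact: cmeas_nc.
- move=> x _; rewrite lee_fin nc_conj nc_phi expr2 ler_piMr ?fejer_rV_ge0//.
  exact: fejer_rV_le1.
Qed.

(** The triangle around x0 normalised to integral 1: an approximate identity as a tends to 0. *)
Let t a x : R := (a ^+ (2 * d))^-1 * tri_rV a (x - x0).

Let t_ge0 a x : 0 < a -> 0 <= t a x.
Proof. by move=> a0; rewrite mulr_ge0 ?tri_rV_ge0// invr_ge0 exprn_ge0// ltW. Qed.

Let t_int a : 0 < a -> cintegrable mu setT (fun x => (t a x)%:C%C) /\
  cint mu setT (fun x => (t a x)%:C%C) = 1.
Proof.
move=> a0; have [i1 i2] := integral_tri_rV x0 a0.
have e : (fun x => (t a x)%:C%C) =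
  (fun x => ((a ^+ (2 * d))^-1)%:C%C * (tri_rV a (x - x0))%:C%C).
  by apply/funext => x; rewrite /t rmorphM.
rewrite e; split; first exact: cintegrableZ.
by rewrite cintZ// i2 -rmorphM mulVf// expf_neq0// gt_eqF.
Qed.

(** The triangle vanishes at distance greater than a from x0, so cutting f off outside a cube that
    contains this neighbourhood changes nothing: the pairing is constant in N from some point on. *)
Let trunc_pairing (N : nat) a : 0 < a -> `|x0| + a <= N%:R ->
  hdot (L2 setT) (inv_fourier_trunc N f) (fun xi => (phi a xi)^*%C) =
  cint mu setT (fun x => f x * (t a x)%:C%C).
Proof.
move=> a0 aN.
pose fN x := if x \in cube d N%:R then f x else 0.
have fNi : cintegrable mu setT fN by exact: L2_cube_integrable.
pose c : R[i] := (((2 * pi) ^+ d)^-1)%:C%C.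
have pi0 : (2 * pi) ^+ d != 0 :> R by rewrite expf_neq0// mulf_neq0// gt_eqF// pi_gt0.
transitivity (cint mu setT (fun xi => c * (phi a xi *
   cint mu setT (fun x => fN x * expi (dotv xi x))))).
  apply: eq_cint => xi _; rewrite conjK mulrC [RHS]mulrCA; congr (_ * _).
  rewrite /inv_fourier_trunc -/c; congr (_ * _).
  rewrite -[LHS]/(cint mu (cube d N%:R) (fun x => f x * expi (dotv xi x))).
  rewrite cint_mkcond; apply: eq_cint => x _; rewrite /fN.
  by case: ifP => //; rewrite mul0r.
have FNL : hset (L2 setT) (inv_fourier_trunc N f) by case: fh => _ [].
(* The truncated transform lies in L_2 as part of [is_inv_fourier], so its product with the L_2
   function phi is integrable. *)
have qi : cintegrable mu setT (fun xi => phi a xi *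
   cint mu setT (fun x => fN x * expi (dotv xi x))).
  have := cintegrableZ measurableT c^-1 (L2_mul_integrable measurableT FNL (phi_L2 a0)).
  congr (cintegrable _ _ _); apply/funext => xi.
  have c0 : c != 0.
    by rewrite /c; apply/eqP => -[/eqP]; rewrite invr_eq0 (negPf pi0).
  rewrite conjK /inv_fourier_trunc -/c -mulrA mulrA mulVf// mul1r mulrC; congr (_ * _).
  rewrite -[LHS]/(cint mu (cube d N%:R) (fun x => f x * expi (dotv xi x))).
  rewrite cint_mkcond; apply: eq_cint => x _; rewrite /fN.
  by case: ifP => //; rewrite mul0r.
rewrite cintZ// mul_fourier_swap//; last exact: phi_i.
have ti x : cint mu setT (fun xi => phi a xi * expi (dotv xi x)) =
    ((2 * pi) ^+ d)%:C%C * (t a x)%:C%C.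
  have [_ e] := fejer_rV_fourier (x - x0) a0.
  transitivity (cint mu setT (fun xi => (fejer_rV a xi)%:C%C * expi (dotv (x - x0) xi))).
    apply: eq_cint => xi _; rewrite /phi -mulrA -expiD; congr (_ * expi _).
    by rewrite dotvBl addrC (dotvC xi).
  rewrite e -rmorphM /t mulrA; congr (_ * _)%:C%C.
  by rewrite exprMn; congr (_ * _); rewrite exprVn exprM.
have [ti1 _] := t_int a0.
have fti : cintegrable mu setT (fun x => fN x * (t a x)%:C%C).
  apply: (@cintegrable_bounded_mul _ _ _ _ _ _ _ _ ((a ^+ (2 * d))^-1 * a ^+ d)) => //.
    by case: ti1.
  move=> x _; rewrite nc_real ger0_norm ?t_ge0// ler_wpM2l ?invr_ge0 ?exprn_ge0 ?(ltW a0)//.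
  by apply: tri_rV_le; exact: ltW.
transitivity (c * cint mu setT (fun x => ((2 * pi) ^+ d)%:C%C * (fN x * (t a x)%:C%C))).
  by congr (_ * _); apply: eq_cint => x _; rewrite ti mulrCA.
rewrite cintZ// mulrA -rmorphM mulVf// mul1r.
apply: eq_cint => x _; rewrite /fN; case: ifPn => // xN.
rewrite mul0r /t tri_rV_eq0 ?mulr0 ?mulr0//; last exact: ltW.
rewrite ltNge; apply/negP => xa; move/negP: xN; apply; rewrite inE /cube /=.
apply: le_trans aN; rewrite -{1}(subrK x0 x) addrC (le_trans (ler_normD _ _))//.
by rewrite lerD2l.
Qed.

Let pairing a : 0 < a ->
  cint mu setT (fun xi => h xi * phi a xi) = cint mu setT (fun x => f x * (t a x)%:C%C).
Proof.
move=> a0; have [_ hcv] := fh.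
have := hcvg_dot (L2_prehilbert measurableT) (phi_L2 a0) hcv.
have -> : hdot (L2 setT) h (fun xi => (phi a xi)^*%C) = cint mu setT (fun xi => h xi * phi a xi).
  by apply: eq_cint => xi _; rewrite conjK.
move=> h1; apply: (ccvg_unique h1).
apply: cvg_near_cst; near=> N; rewrite trunc_pairing ?subrr ?Normc.normc0//.
near: N; exact: nbhs_infty_ger.
Unshelve. all: by end_near. Qed.

Let local_mean a (e : R) : 0 < a -> 0 <= e ->
  (forall x, `|x - x0| <= a -> nc (f x - f x0) <= e) ->
  nc (cint mu setT (fun x => f x * (t a x)%:C%C) - f x0) <= 2 * e.
Proof.
move=> a0 e0 fe; have [ti1 ti2] := t_int a0.
have /hset_L2P[mf _] := hf.
have bd x : nc ((f x - f x0) * (t a x)%:C%C) <= e * t a x.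
  rewrite Normc.normcM nc_real ger0_norm ?t_ge0//.
  have [xa|xa] := leP `|x - x0| a; first by rewrite ler_wpM2r ?t_ge0// fe.
  by rewrite /t tri_rV_eq0 ?(ltW a0)// !mulr0.
have gi : cintegrable mu setT (fun x => (f x - f x0) * (t a x)%:C%C).
  apply: (@cintegrable_le _ _ _ mu setT measurableT _ (fun x => e * t a x)) => //.
    apply: cmeas_mul; last by case: ti1.
    by apply: cmeas_add => //; exact: cmeas_cst.
  have := integrableZl measurableT e (cintegrable_Re measurableT ti1).
  by apply: eq_integrable.
have -> : cint mu setT (fun x => f x * (t a x)%:C%C) - f x0 =
    cint mu setT (fun x => (f x - f x0) * (t a x)%:C%C).
  transitivity (cint mu setT (fun x => (f x - f x0) * (t a x)%:C%C + f x0 * (t a x)%:C%C) - f x0).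
    by congr (_ - _); apply: eq_cint => x _; rewrite -mulrDl subrK.
  by rewrite cintD// ?cintZ// ?ti2 ?mulr1 ?addrK//; exact: cintegrableZ.
rewrite (le_trans (nc_cint measurableT gi))// ler_pM2l//.
have tR : \int[mu]_x (t a x) = 1.
  by have := congr1 (fun z : R[i] => complex.Re z) ti2.
have tRi := cintegrable_Re measurableT ti1.
rewrite -[leRHS]mulr1 -tR -RintegralZl//.
apply: le_Rintegral => //; first exact: (cintegrable_nc gi).
by have := integrableZl measurableT e tRi; apply: eq_integrable.
Qed.

(** Dominated convergence with dominating function |h|, as the kernel lies in [0, 1] and tends to
    1. *)
Let abel_limit : ccvg (fun n => cint mu setT (fun xi => h xi * phi (n.+1%:R^-1) xi)) (fourier h x0).
Proof.
pose a (n : nat) : R := n.+1%:R^-1.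
have a0 n : 0 < a n by rewrite invr_gt0.
have [mh _] := hi.
have hfi := cintegrable_fourier x0 hi.
have mK n : measurable_fun setT (fun xi => 1 - fejer_rV (a n) xi).
  by apply: measurable_funB => //; exact: measurable_fejer_rV.
have hp n : cintegrable mu setT (fun xi => h xi * phi (a n) xi).
  apply: (@cintegrable_bounded_mul _ _ _ _ _ _ _ _ 1) => //; first by case: (phi_i (a0 n)).
  by move=> xi _; rewrite nc_phi fejer_rV_le1.
pose F n xi := (nc (h xi) * (1 - fejer_rV (a n) xi))%:E.
have F0 n xi : (0 <= F n xi)%E.
  by rewrite lee_fin mulr_ge0 ?nc_ge0// subr_ge0 fejer_rV_le1.
have mF n : measurable_fun setT (F n).
  by apply/measurable_EFinP; apply: measurable_funM => //; exact: cmeas_nc.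
have Fle n xi : (F n xi <= (nc (h xi))%:E)%E.
  by rewrite lee_fin ler_piMr ?nc_ge0// gerBl fejer_rV_ge0.
have Fcv xi : F ^~ xi @ \oo --> 0%E.
  rewrite -[0%E]/((0 : R)%:E); apply: cvg_EFin; first exact: nearW.
  rewrite -(mulr0 (nc (h xi))); apply: cvgMr; rewrite -(subrr (1 : R)).
  by apply: cvgB; [exact: cvg_cst|exact: fejer_rV_cvg].
have H1 : {ae mu, forall xi, setT xi -> F ^~ xi @ \oo --> (cst 0%E : 'rV[R]_d -> \bar R) xi}.
  by apply: nearW => xi _; exact: Fcv.
have H2 : {ae mu, forall xi n, setT xi -> (`|F n xi| <= (nc (h xi))%:E)%E}.
  by apply: nearW => xi n _; rewrite gee0_abs.
have [_ _] := dominated_convergence measurableT mF (measurable_cst _) H1 (cintegrable_nc hi) H2.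
rewrite integral0 => lim.
have lim' : 2 * \int[mu]_xi (nc (h xi) * (1 - fejer_rV (a n) xi)) @[n --> \oo] --> (0 : R).
  rewrite -(mulr0 2); apply: cvgMr; exact: fine_cvg lim.
apply: (ccvg_le _ lim') => n.
rewrite /fourier -(cintB measurableT (hp n) hfi).
apply: le_trans (nc_cint measurableT (cintegrableB measurableT (hp n) hfi)) _.
rewrite ler_pM2l// le_eqVlt; apply/orP; left; apply/eqP; apply: eq_Rintegral => xi _.
rewrite /phi mulrA -mulrBl Normc.normcM nc_expi mulr1.
rewrite -[X in nc (_ - X)]mulr1 -mulrBr Normc.normcM; congr (_ * _).
by rewrite ncB -rmorphB nc_real ger0_norm// subr_ge0 fejer_rV_le1.
Qed.

(** The damped integrals of h tend to [fourier h x0]; by [pairing] they are also local means of f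
    around x0, which tend to [f x0] by continuity. *)
Lemma fourier_inversion_at : f x0 = fourier h x0.
Proof.
apply: (ccvg_unique _ abel_limit).
apply/cvgr0Pnorm_le => e e0; have e20 : 0 < e / 2 by rewrite divr_gt0.
have /nbhs_ballP[s /= s0 hs] := continuous_complexP cf x0 e20.
have hn : (fun n => n.+1%:R^-1 : R) @ \oo --> (0 : R) by exact: cvg_harmonic.
have /cvgr0_norm_lt/(_ s s0) := hn.
apply: filterS => n; rewrite ger0_norm ?invr_ge0// => ns.
have a0 : 0 < n.+1%:R^-1 :> R by rewrite invr_gt0.
rewrite ger0_norm ?nc_ge0// pairing//.
have -> : e = 2 * (e / 2) by field.
apply: local_mean => //; first exact: ltW.
move=> x xa; rewrite ncB; apply: hs; rewrite mx_norm_ball /ball_ /= distrC.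
exact: le_lt_trans xa ns.
Qed.

End inversion_proof.

Lemma fourier_inversion (f h : 'rV[R]_d -> R[i]) (r : R) :
  continuous (f : 'rV[R]_d -> R[i]^o) -> is_inv_fourier f h ->
  {ae mu, forall xi, ~ cube d r xi -> h xi = 0} -> f = fourier h.
Proof. by move=> cf fh h0; apply/funext => x; exact: fourier_inversion_at fh h0 x. Qed.

End inversion.

(** * The sampling series *)

Section scaling.
Variables (R : realType) (d : nat).
Implicit Types (x y xi : 'rV[R]_d) (a : R).
Local Notation mu := (@leb R d).

Lemma integral_scale a (F : 'rV[R]_d -> \bar R) : 0 < a -> mu.-integrable setT F ->
  (\int[mu]_x F (a *: x)%R = ((a ^+ d)^-1)%:E * \int[mu]_x F x)%E.
Proof.
move=> a0 Fi; have mF := measurable_int _ Fi.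
rewrite integralE [in RHS]integralE muleBr//; last first.
  by apply: fin_num_adde_defl; rewrite fin_numN; exact: integrable_neg_fin_num.
have mp : measurable_fun setT F^\+%E by exact: measurable_funepos.
have mn : measurable_fun setT F^\-%E by exact: measurable_funeneg.
rewrite -(ge0_integral_scale a0 mp)// -(ge0_integral_scale a0 mn)//.
by congr (_ - _)%E; apply: eq_integral => x _; rewrite ?funeposE ?funenegE.
Qed.

Lemma cintegrable_scale a (F : 'rV[R]_d -> R[i]) : 0 < a -> cintegrable mu setT F ->
  cintegrable mu setT (fun x => F (a *: x)).
Proof.
move=> a0 [mF Fi]; split; first exact: (cmeas_comp (@measurable_rV_scale R d a) mF).
rewrite (ge0_integral_scale (F := fun x => (nc (F x))%:E) a0).
- rewrite lte_mul_pinfty// ?lee_fin ?invr_ge0 ?exprn_ge0 ?(ltW a0)//.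
- by apply/measurable_EFinP; exact: cmeas_nc.
- by move=> x; rewrite lee_fin nc_ge0.
Qed.

Lemma cint_scale a (F : 'rV[R]_d -> R[i]) : 0 < a -> cintegrable mu setT F ->
  cint mu setT (fun x => F (a *: x)) = ((a ^+ d)^-1)%:C%C * cint mu setT F.
Proof.
move=> a0 Fi; have fr := cintegrable_Re measurableT Fi.
have fm := cintegrable_Im measurableT Fi.
have e (h : 'rV[R]_d -> R) : mu.-integrable setT (EFin \o h) ->
    \int[mu]_x h (a *: x) = (a ^+ d)^-1 * \int[mu]_x h x.
  move=> hi; rewrite /Rintegral (integral_scale (F := EFin \o h) a0 hi) fineM//.
  exact: integrable_fin_num.
by apply: complex_eqP; rewrite ?ReM ?ImM /= (e _ fr, e _ fm)//= mul0r ?subr0 ?addr0.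
Qed.

Lemma continuous_cmeas (f : 'rV[R]_d -> R[i]) :
  continuous (f : 'rV[R]_d -> R[i]^o) -> cmeas setT f.
Proof.
move=> cf; split; apply: continuous_measurable_rV => x; have FF := nbhs_filter (x : 'rV[R]_d).
- apply/(@cvgrPdist_le _ _ _ _ FF) => e e0.
  apply: (@filterS _ _ FF) (continuous_complexP cf x e0) => q.
  by apply: le_trans; rewrite -ReN -ReD; exact: Re_le_nc.
- apply/(@cvgrPdist_le _ _ _ _ FF) => e e0.
  apply: (@filterS _ _ FF) (continuous_complexP cf x e0) => q.
  by apply: le_trans; rewrite -ImN -ImD; exact: Im_le_nc.
Qed.

Lemma measurable_rV_translate (s : 'rV[R]_d) :
  measurable_fun setT (fun x : 'rV[R]_d => x - s).
Proof.
apply: measurable_rVP => i; under eq_fun do rewrite !mxE.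
exact: (@measurable_funB _ _ R setT _ _ (@measurable_coord R d i) (measurable_cst _)).
Qed.

Lemma uniform_nc_cvg (T : choiceType) (p : nat -> T -> R[i]) (f : T -> R[i]) (e : nat -> R) :
  (forall n (z : T), nc (p n z - f z) <= e n) -> e @ \oo --> (0 : R) ->
  {uniform setT, p @ \oo --> (f : T -> R[i]^o)}.
Proof.
move=> pe e0 P /uniform_nbhs[V [/= eV VP]].
have [r /= r0 rV] : exists2 r : R[i], 0 < r & [set xy : R[i]^o * R[i]^o | ball xy.1 r xy.2] `<=` V.
  by have := eV; rewrite -entourage_ballE => -[r r0 rV]; exists r.
(* Entourage radii for [R[i]^o] are complex, and positivity makes them real. *)
have rR : r = (complex.Re r)%:C%C.
  by move: r0; case: r {rV} => a b; rewrite ltcE /= => /andP[/eqP -> _].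
have r0' : 0 < complex.Re r by move: r0; rewrite {1}rR ltcR.
have /cvgr0_norm_lt/(_ _ r0') := e0.
apply: filterS => n en; apply: VP => x _; apply: rV => /=.
rewrite -ball_normE /ball_ /= rR -[`|_|]/((nc (f x - p n x))%:C%C) ltcR ncB.
exact: le_lt_trans (pe n x) (le_lt_trans (ler_norm _) en).
Qed.

End scaling.

(** * Restriction, dilation and bounded supports in L_2 *)

Section L2_scaling.
Variables (R : realType) (d : nat).
Implicit Types (x xi : 'rV[R]_d) (a r s : R) (u v : 'rV[R]_d -> R[i]).
Local Notation mu := (@leb R d).

Let pL := @L2_prehilbert R d _ measurableT.

Lemma L2_restrict (D : set 'rV[R]_d) u : measurable D ->
  hset (L2 setT) u -> hset (L2 D) u.
Proof.
move=> mD /hset_L2P[mu' ui]; apply/hset_L2P; split; first exact: cmeas_sub mu'.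
apply: le_lt_trans ui; apply: ge0_subset_integral => //; first exact: cmeas_nc2.
by move=> x _; rewrite lee_fin sqr_ge0.
Qed.

Lemma L2_mkcond (D : set 'rV[R]_d) u : measurable D -> hset (L2 D) u ->
  hset (L2 setT) (fun x => if x \in D then u x else 0) /\
  hnorm (L2 setT) (fun x => if x \in D then u x else 0) = hnorm (L2 D) u.
Proof.
move=> mD hu; have /hset_L2P[mu' ui] := hu.
have e : (\int[mu]_x (nc (if x \in D then u x else 0) ^+ 2)%:E =
          \int[mu]_(x in D) (nc (u x) ^+ 2)%:E)%E.
  rewrite [RHS]integral_mkcond; apply: eq_integral => x _; rewrite /patch.
  by case: ifP => // _; rewrite Normc.normc0 expr0n.
have h : hset (L2 setT) (fun x => if x \in D then u x else 0).
  by apply/hset_L2P; split; [exact: cmeas_mkcond|rewrite [X in (X < _)%E]e].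
split => //; apply/eqP; rewrite -(@eqrXn2 _ 2) ?hnorm_ge0//; apply/eqP.
by apply: EFin_inj; rewrite (L2_normE measurableT h) (L2_normE mD hu).
Qed.

Lemma L2_scale a u : 0 < a -> hset (L2 setT) u ->
  hset (L2 setT) (fun x => u (a *: x)) /\
  hnorm (L2 setT) (fun x => u (a *: x)) ^+ 2 = (a ^+ d)^-1 * hnorm (L2 setT) u ^+ 2.
Proof.
move=> a0 hu; have /hset_L2P[mu' ui] := hu.
have e : (\int[mu]_x (nc (u (a *: x)) ^+ 2)%:E =
          ((a ^+ d)^-1)%:E * \int[mu]_x (nc (u x) ^+ 2)%:E)%E.
  apply: (ge0_integral_scale (F := fun x => (nc (u x) ^+ 2)%:E) a0).
    exact: cmeas_nc2.
  by move=> x; rewrite lee_fin sqr_ge0.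
have h : hset (L2 setT) (fun x => u (a *: x)).
  apply/hset_L2P; split; first exact: (cmeas_comp (@measurable_rV_scale R d a) mu').
  rewrite [X in (X < _)%E]e lte_mul_pinfty// ?lee_fin ?invr_ge0 ?exprn_ge0 ?(ltW a0)//.
split => //; apply: EFin_inj; rewrite [RHS]EFinM (L2_normE measurableT h).
by rewrite (L2_normE measurableT hu).
Qed.

Lemma hnorm_L2_mono (c : R) u v : 0 <= c -> hset (L2 setT) u -> cmeas setT v ->
  (forall x, nc (v x) <= c * nc (u x)) ->
  hset (L2 setT) v /\ hnorm (L2 setT) v <= c * hnorm (L2 setT) u.
Proof.
move=> c0 hu mv vu; have /hset_L2P[mu' ui] := hu.
have h1 : (\int[mu]_x (nc (v x) ^+ 2)%:E <= (c ^+ 2)%:E * \int[mu]_x (nc (u x) ^+ 2)%:E)%E.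
  rewrite -ge0_integralZl_EFin ?sqr_ge0//; last exact: cmeas_nc2.
    apply: ge0_le_integral => //.
    - by move=> x _; rewrite lee_fin sqr_ge0.
    - exact: cmeas_nc2.
    - by apply: measurable_funeM; exact: cmeas_nc2.
    - move=> x _; rewrite -EFinM lee_fin -exprMn ler_sqr ?nnegrE ?mulr_ge0 ?nc_ge0//.
  by move=> x _; rewrite lee_fin sqr_ge0.
have h : hset (L2 setT) v.
  apply/hset_L2P; split => //; apply: le_lt_trans h1 _.
  by rewrite lte_mul_pinfty// lee_fin sqr_ge0.
split => //; rewrite -ler_sqr ?nnegrE ?mulr_ge0 ?hnorm_ge0// exprMn.
by rewrite -lee_fin [X in (_ <= X)%E]EFinM (L2_normE measurableT h) (L2_normE measurableT hu).
Qed.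

(** For s above the norm of u, integrating |u(x)| <= s + |u(x)|^2 / s over the cube gives at most
    ((2 r)^d + 1) s; then s decreases to the norm. Keeping s strictly larger also covers norm 0. *)
Lemma Rintegral_nc_le_hnorm u r : 0 <= r -> hset (L2 setT) u ->
  (forall x, ~ cube d r x -> u x = 0) ->
  \int[mu]_x nc (u x) <= ((2 * r) ^+ d + 1) * hnorm (L2 setT) u.
Proof.
move=> r0 hu u0.
have ui : cintegrable mu setT u by apply: (L2_bounded_integrable hu); exact: nearW u0.
have c0 : 0 <= (2 * r) ^+ d by rewrite exprn_ge0// mulr_ge0.
have mc := @cube_measurable R d r.
have key s : hnorm (L2 setT) u < s ->
    \int[mu]_x nc (u x) <= ((2 * r) ^+ d + 1) * s.
  move=> us; have s0 : 0 < s := le_lt_trans (hnorm_ge0 _ _) us.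
  have /hset_L2P[mu' _] := hu.
  rewrite -lee_fin /Rintegral fineK; last exact: integrable_fin_num (cintegrable_nc ui).
  apply: (@le_trans _ _ (\int[mu]_x (s%:E * (\1_(cube d r) x)%:E + (s^-1)%:E * (nc (u x) ^+ 2)%:E))%E).
    apply: ge0_le_integral => //.
    - by move=> x _; rewrite lee_fin nc_ge0.
    - by apply/measurable_EFinP; exact: cmeas_nc.
    - apply: emeasurable_funD; apply: measurable_funeM; last exact: cmeas_nc2.
      by apply/measurable_EFinP; exact: measurable_indic.
    - move=> x _; rewrite -!EFinM -EFinD lee_fin indicE.
      have [xr|xr] := boolP (x \in cube d r); last first.
        rewrite u0; first by rewrite Normc.normc0 mulr0 add0r expr0n mulr0.
        by move=> h; move/negP: xr; apply; rewrite inE.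
      rewrite mulr1 -(ler_pM2l s0) mulrDr mulrA mulfV ?gt_eqF// mul1r.
      have := sqr_ge0 (s - nc (u x)); rewrite sqrrB.
      have := nc_ge0 (u x); have := mulr_ge0 (ltW s0) (nc_ge0 (u x)); lra.
  rewrite ge0_integralD//; last 4 first.
    by move=> x _; rewrite -EFinM lee_fin mulr_ge0 ?(ltW s0).
    by apply: measurable_funeM; apply/measurable_EFinP; exact: measurable_indic.
    by move=> x _; rewrite -EFinM lee_fin mulr_ge0 ?sqr_ge0 ?invr_ge0 ?(ltW s0).
    by apply: measurable_funeM; exact: cmeas_nc2.
  have m1 : measurable_fun setT (fun x => (\1_(cube d r) x : R)%:E).
    by apply/measurable_EFinP; exact: measurable_indic.
  have p1 x : setT x -> (0 <= (\1_(cube d r) x : R)%:E)%E by rewrite lee_fin.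
  have p2 x : setT x -> (0 <= (nc (u x) ^+ 2)%:E)%E by rewrite lee_fin sqr_ge0.
  have si : 0 <= s^-1 by rewrite invr_ge0 ltW.
  rewrite (ge0_integralZl_EFin _ measurableT p1 m1 (ltW s0)).
  rewrite (ge0_integralZl_EFin _ measurableT p2 (cmeas_nc2 mu') si).
  rewrite integral_indic// setIT -(L2_normE measurableT hu).
  rewrite -[X in (_ * X + _)%E]/(lebesgue_rV R d _) lebesgue_cube//.
  rewrite -!EFinM -EFinD lee_fin [leRHS]mulrDl mul1r [leRHS]addrC [leLHS]addrC (mulrC s) lerD2r.
  rewrite -(ler_pM2l s0) mulrA mulfV ?gt_eqF// mul1r -expr2 ler_sqr ?nnegrE ?hnorm_ge0 ?(ltW s0)//.
  exact: ltW.
have C0 : 0 < (2 * r) ^+ d + 1 by rewrite ltr_wpDl.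
rewrite -ler_pdivrMl//; apply/ler_addgt0Pr => e e0; rewrite ler_pdivrMl//.
by apply: key; rewrite ltrDl.
Qed.

End L2_scaling.

(** * The sampling formula *)

Section sampling.
Variables (R : realType) (d : nat) (E : set 'rV[R]_d) (t : nat -> 'rV[R]_d).
Variables (l0 l A B : R) (G : 'rV[R]_d -> R) (g f h0 : 'rV[R]_d -> R[i]).
Local Notation mu := (@leb R d).
Local Notation fn := (fun (n : nat) (x : 'rV[R]_d) => expi (dotv x (t n))).
Local Notation LE := (L2 E).

Hypotheses (cE : compact E)
  (dilE : forall m : R, 1 < m -> E `<=` interior (dilate m E))
  (hfn : forall n, hset LE (fn n)) (A0 : 0 < A) (AB : A < B)
  (ana_le : forall u, hset LE u -> sqsum (analysis LE fn u) (B * hnorm LE u ^+ 2))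
  (ana_ge : forall u M, hset LE u -> sqsum (analysis LE fn u) M ->
     A * hnorm LE u ^+ 2 <= M)
  (l01 : 1 < l0) (cg : continuous (g : 'rV[R]_d -> R[i]^o))
  (gG : is_inv_fourier g (fun xi => (G xi)%:C%C)) (cG : continuous G)
  (G1 : forall xi, E xi -> G xi = 1) (G0 : forall xi, ~ dilate l0 E xi -> G xi = 0)
  (ll0 : l0 <= l) (cf : continuous (f : 'rV[R]_d -> R[i]^o))
  (fh0 : is_inv_fourier f h0) (h0E : {ae mu, forall xi, ~ E xi -> h0 xi = 0}).

Let mE : measurable E. Proof. exact: compact_measurable_rV. Qed.
Let pH := L2_prehilbert mE.
Let cH := L2_complete mE.
Let pL := @L2_prehilbert R d _ measurableT.
Let l_gt0 : 0 < l. Proof. exact: lt_le_trans (lt_trans ltr01 l01) ll0. Qed.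
Let l_neq0 : l != 0. Proof. by rewrite gt_eqF. Qed.

(** E lies in each dilate m E with m > 1, which makes it star-shaped about the origin. *)
Let E_shrink (m : R) xi : 1 <= m -> E xi -> E (m^-1 *: xi).
Proof.
rewrite le_eqVlt => /predU1P[<-|m1]; first by rewrite invr1 scale1r.
move=> /(dilE m1)/interior_subset[x Ex <-].
have m0 : m != 0 by rewrite gt_eqF// (lt_trans ltr01).
by rewrite scalerA mulVf// scale1r.
Qed.

Let G_out xi : ~ E (l^-1 *: xi) -> G xi = 0.
Proof.
move=> h; apply: G0 => -[x Ex xE]; apply: h; rewrite -xE scalerA.
have -> : l^-1 * l0 = (l / l0)^-1 by rewrite invf_div mulrC.
by apply: E_shrink => //; rewrite ler_pdivlMr ?mul1r// (lt_trans ltr01).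
Qed.

Let E_dil xi : E (l *: xi) -> E xi.
Proof.
move=> h; have := @E_shrink l _ _ h; rewrite scalerA mulVf// scale1r; apply.
exact: le_trans (ltW l01) ll0.
Qed.

Let E_cube : exists2 r, 0 <= r & E `<=` cube d r.
Proof.
have [M M0 hM] : exists2 M : R, M > 0 & forall x, E x -> `|x| <= M.
  have := compact_bounded cE.
  move=> /pinfty_ex_gt0[M M0 hM]; exists M => // x Ex; exact: hM.
by exists M; [exact: ltW|move=> x; exact: hM].
Qed.

(** A representative that vanishes everywhere off E, not merely almost everywhere. *)
Let h xi : R[i] := if xi \in E then h0 xi else 0.

Let h_out xi : ~ E xi -> h xi = 0.
Proof. by move=> nE; rewrite /h; case: ifPn => //; rewrite inE. Qed.

Let hh0 : hset (L2 setT) h0. Proof. by case: fh0 => _ []. Qed.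

Let hh : hset (L2 setT) h.
Proof. by have [] := L2_mkcond mE (L2_restrict mE hh0). Qed.

Let fh : is_inv_fourier f h.
Proof.
have [hf hc] := fh0; split => //; apply: (hcvg_heq pL hh) hc.
rewrite /heq; apply/eqP; rewrite -sqrf_eq0; apply/eqP; apply: EFin_inj.
have hB := ph_sub pL hh0 hh.
rewrite (L2_normE measurableT hB); transitivity (\int[mu]_x (0 : \bar R))%E; last exact: integral0.
have /hset_L2P[mB _] := hB.
apply: ge0_ae_eq_integral => //.
- exact: cmeas_nc2.
- by move=> x _; rewrite lee_fin sqr_ge0.
apply: filterS h0E => xi hxi _; rewrite /= /h.
case: ifPn => [_|/negP xE]; first by rewrite subrr Normc.normc0 expr0n.
by rewrite hxi ?subrr ?Normc.normc0 ?expr0n// => ?; apply: xE; rewrite inE.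
Qed.

Let hi : cintegrable mu setT h.
Proof.
have [r r0 rE] := E_cube; apply: (L2_bounded_integrable (r := r) hh).
by apply: nearW => x /= xr; apply: h_out => /rE.
Qed.

Let f_fourier : f = fourier h.
Proof.
have [r r0 rE] := E_cube; apply: (fourier_inversion (r := r) cf fh).
by apply: nearW => x /= xr; apply: h_out => /rE.
Qed.

Let hG : hset (L2 setT) (fun xi => (G xi)%:C%C). Proof. by case: gG => _ []. Qed.

Let cube_out : exists2 r, 0 <= r & forall xi, ~ cube d r xi -> ~ E (l^-1 *: xi).
Proof.
have [r r0 rE] := E_cube; exists (l * r) => [|xi xr /rE]; first by rewrite mulr_ge0// ltW.
move=> h1; apply: xr; move: h1; rewrite /cube /= normrZ normfV (gtr0_norm l_gt0).
by rewrite mulrC ler_pdivrMr// mulrC.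
Qed.

Let Gi : cintegrable mu setT (fun xi => (G xi)%:C%C).
Proof.
have [r r0 hr] := cube_out; apply: (L2_bounded_integrable (r := r) hG).
by apply: nearW => x /= xr; rewrite G_out//; exact: hr.
Qed.

Let g_fourier : g = fourier (fun xi => (G xi)%:C%C).
Proof.
have [r r0 hr] := cube_out; apply: (fourier_inversion (r := r) cg gG).
by apply: nearW => x /= xr; rewrite G_out//; exact: hr.
Qed.

(** G is supported in the dilate of E by lambda0, a continuous image of a compact set. *)
Let G_bounded : exists2 M, 0 <= M & forall xi, `|G xi| <= M.
Proof.
have cGl : continuous (fun x : 'rV[R]_d => G (l0 *: x)).
  by move=> x; apply: continuous_comp; [exact: scaler_continuous|exact: cG].
have cD : compact ((fun x => G (l0 *: x)) @` E).
  exact: continuous_compact (continuous_subspaceT cGl) cE.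
have [M M0 hM] := pinfty_ex_gt0 (compact_bounded cD); exists M; first exact: ltW.
move=> xi; have [[x Ex <-]|D] := pselect (dilate l0 E xi); first by apply: hM; exists x.
by rewrite G0// normr0 ltW.
Qed.

Let c : R[i] := (l ^+ d)%:C%C.

Let ld_gt0 : 0 < l ^+ d. Proof. by rewrite exprn_gt0. Qed.

Let H eta : R[i] := c * h (l *: eta).

Let hH : hset LE H.
Proof. by apply: L2_restrict => //; apply: (ph_scale pL); have [] := L2_scale l_gt0 hh. Qed.

Let samples : (fun n => f (l^-1 *: t n)) = analysis LE fn H.
Proof.
apply/funext => n; rewrite f_fourier /fourier /analysis.
pose F xi := h xi * expi (- dotv (l^-1 *: t n) xi).
have Fi : cintegrable mu setT F by exact: cintegrable_fourier.
transitivity (cint mu setT (fun eta => c * F (l *: eta))).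
  rewrite cintZ//; last exact: cintegrable_scale.
  rewrite (cint_scale l_gt0 Fi) mulrA -rmorphM /= mulfV ?gt_eqF// mul1r.
  by [].
transitivity (cint mu E (fun eta => H eta * (expi (dotv eta (t n)))^*%C)); last by [].
rewrite [RHS]cint_mkcond; apply: eq_cint => eta _; rewrite /F /H.
(* Off E the integrand vanishes, because [l *: eta] in E would force eta into E. *)
have [xE|/negP xE] := boolP (eta \in E); last first.
  rewrite h_out ?mul0r ?mulr0// => /E_dil ?; apply: xE; by rewrite inE.
rewrite expi_conj mulrA; congr (_ * expi (- _)).
by rewrite dotvZl dotvZr mulrA mulVf// mul1r dotvC.
Qed.

Let co := analysis LE fn (frame_op_inv LE fn H).

Let gram_samples : gram_map LE fn (fun n => f (l^-1 *: t n)) = co.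
Proof. by rewrite samples (gram_map_analysis pH cH hfn A0 AB ana_le ana_ge hH). Qed.

(** The error of the frame expansion of H; every bound below is a constant times its norm. *)
Let w K := lincomb co fn K \- H.

Let hw K : hset LE (w K). Proof. by apply: ph_sub => //; exact: ph_lincomb. Qed.

Let w_cvg : hnorm LE (w K) @[K --> \oo] --> (0 : R).
Proof. by have [] := Sinv_cvg pH cH hfn A0 AB ana_le ana_ge hH. Qed.

(** The spectrum of the sampling error: the frame error dilated back and cut off by G. *)
Let rho K xi : R[i] := c^-1 * (G xi)%:C%C * w K (l^-1 *: xi).

Let w' K xi : R[i] := if xi \in E then w K xi else 0.

Let hw' K : hset (L2 setT) (w' K) /\ hnorm (L2 setT) (w' K) = hnorm LE (w K).
Proof. exact: L2_mkcond. Qed.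

(** Off E, [w K] is uncontrolled, since it still contains the characters. It may be replaced by 0
    there because [G xi] vanishes when [l^-1 *: xi] leaves E. *)
Let rhoE K xi : rho K xi = c^-1 * (G xi)%:C%C * w' K (l^-1 *: xi).
Proof.
rewrite /rho /w'; have [//|/negP xE] := boolP (l^-1 *: xi \in E).
by rewrite G_out ?mulr0 ?mul0r// => ?; apply: xE; rewrite inE.
Qed.

Let rho_norm : exists2 C, 0 <= C & forall K,
  hset (L2 setT) (rho K) /\ hnorm (L2 setT) (rho K) <= C * hnorm LE (w K).
Proof.
have [M M0 hM] := G_bounded.
have li0 : 0 < l^-1 by rewrite invr_gt0.
have D0 : 0 <= Num.sqrt ((l^-1 ^+ d)^-1) by exact: sqrtr_ge0.
have N0 : 0 <= nc c^-1 * M by rewrite mulr_ge0 ?nc_ge0.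
exists (nc c^-1 * M * Num.sqrt ((l^-1 ^+ d)^-1)); first by rewrite mulr_ge0.
move=> K; have [hw1 e1] := hw' K.
have [hw2 e2] := L2_scale li0 hw1.
have mr : cmeas setT (rho K).
  rewrite (_ : rho K = fun xi => c^-1 * (G xi)%:C%C * w' K (l^-1 *: xi)); last first.
    by apply/funext => xi; exact: rhoE.
  have /hset_L2P[mw _] := hw2; have [mG _] := Gi.
  by apply: cmeas_mul mw; apply: cmeas_mul mG; exact: cmeas_cst.
have [] := hnorm_L2_mono N0 hw2 mr.
  move=> xi; rewrite rhoE !Normc.normcM ler_wpM2r ?nc_ge0//.
  by rewrite ler_wpM2l ?nc_ge0// nc_real.
move=> h1 h2; split => //; apply: le_trans h2 _.
rewrite -[leRHS]mulrA ler_wpM2l// -e1 -ler_sqr ?nnegrE ?mulr_ge0 ?hnorm_ge0//.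
rewrite e2 [leRHS]exprMn (@sqr_sqrtr _ ((l^-1 ^+ d)^-1))//.
by rewrite invr_ge0 exprn_ge0// ltW.
Qed.

Let p K x : R[i] := ((l ^+ d)^-1)%:C%C * \sum_(k < K) co k * g (x - l^-1 *: t k).

Let hrho K : hset (L2 setT) (rho K). Proof. by have [C _ /(_ K)[]] := rho_norm. Qed.

Let rho_i K : cintegrable mu setT (rho K).
Proof.
have [r r0 hr] := cube_out; apply: (L2_bounded_integrable (r := r) (hrho K)).
by apply: nearW => x /= xr; rewrite /rho G_out ?mulr0 ?mul0r//; exact: hr.
Qed.

(** Translating g multiplies its spectrum G by a character, which is a dilated frame vector; f is
    the transform of h, and h = G h. *)
Let remainder K x : p K x - f x = fourier (rho K) x.
Proof.
pose T k xi := (G xi)%:C%C * expi (- dotv (x - l^-1 *: t k) xi).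
have Ti k : cintegrable mu setT (T k) by exact: cintegrable_fourier.
have cTi k : cintegrable mu setT (fun xi => co k * T k xi) by exact: cintegrableZ.
rewrite /p f_fourier g_fourier /fourier -/(T _).
under eq_bigr => k _ do rewrite -/(T k) -(cintZ measurableT _ (Ti k)).
have cSi := cintegrable_sum measurableT K cTi.
rewrite -(cint_sum measurableT _ cTi) -(cintZ measurableT _ cSi).
rewrite -(cintB measurableT (cintegrableZ measurableT _ cSi) (cintegrable_fourier x hi)).
apply: eq_cint => xi _; rewrite /rho /w /lincomb /H /=.
have c0 : c != 0 by rewrite /c; apply/eqP => -[/eqP]; rewrite gt_eqF.
have ci : ((l ^+ d)^-1)%:C%C = c^-1 :> R[i] by rewrite /c -fmorphV.
rewrite ci scalerA mulfV// scale1r mulrBr mulrBl; congr (_ - _).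
  rewrite -!mulrA; congr (_ * _); rewrite mulr_suml mulr_sumr; apply: eq_bigr => k _.
  rewrite /T dotvBl opprB expiD dotvZl dotvZl (dotvC xi).
  by ring.
(* The dilation and c cancel in H, leaving G h, which is h because G = 1 on E and h = 0 off E. *)
rewrite mulrACA mulVf// mul1r; have [xE|xE] := pselect (E xi); last by rewrite h_out// mulr0.
by rewrite G1// mul1r.
Qed.

(** Together with the continuity of f this supplies the measurability of [fourier (rho K)] that
    [plancherel_le] asks for. *)
Let mp K : cmeas setT (p K).
Proof.
apply: cmeas_mul; first exact: cmeas_cst.
elim: K => [|K IH].
  by under eq_fun do rewrite big_ord0; exact: cmeas_cst.
under eq_fun do rewrite big_ord_recr; apply: cmeas_add IH _.
apply: cmeas_mul; first exact: cmeas_cst.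
exact: (cmeas_comp (measurable_rV_translate (l^-1 *: t K)) (continuous_cmeas cg)).
Qed.

Let remainder_L2 : exists2 C, 0 <= C & forall K,
  hset (L2 setT) (p K \- f) /\ hnorm (L2 setT) (p K \- f) <= C * hnorm LE (w K).
Proof.
have [C C0 hC] := rho_norm.
pose D := 2 * (2 * pi : R) ^+ d.
have D0 : 0 <= D by rewrite mulr_ge0// exprn_ge0// mulr_ge0// pi_ge0.
exists (Num.sqrt D * C); first by rewrite mulr_ge0// sqrtr_ge0.
move=> K; have [hr rC] := hC K; have /hset_L2P[_ ri2] := hr.
have e : p K \- f = fourier (rho K) by apply/funext => x; exact: remainder.
have mpf : cmeas setT (p K \- f).
  by rewrite subE; apply: cmeas_lin => //; exact: continuous_cmeas.
have h1 := plancherel_le (rho_i K) ri2; rewrite -e in h1; have {h1} h1 := h1 mpf.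
have h2 : hset (L2 setT) (p K \- f).
  apply/hset_L2P; split => //; apply: le_lt_trans h1 _.
  by rewrite lte_mul_pinfty// ?lee_fin.
split => //.
rewrite -(L2_normE measurableT h2) -(L2_normE measurableT hr) -EFinM lee_fin in h1.
rewrite -[leRHS]mulrA; apply: (@le_trans _ _ (Num.sqrt D * hnorm (L2 setT) (rho K))).
  rewrite -ler_sqr ?nnegrE ?mulr_ge0 ?hnorm_ge0 ?sqrtr_ge0//.
  by rewrite [leRHS]exprMn (@sqr_sqrtr _ D).
by rewrite ler_wpM2l// sqrtr_ge0.
Qed.

Lemma sampling :
  let y n := f (l^-1 *: t n) in
  let q (K : nat) x := ((l ^+ d)^-1)%:C%C *
    \sum_(k < K) gram_map LE fn y k * g (x - l^-1 *: t k) in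
  [/\ forall k, summable_series (fun n => dual_gram LE fn k n * y n),
      hcvg (L2 setT) q f & {uniform setT, q @ \oo --> (f : 'rV[R]_d -> R[i]^o)}].
Proof.
have wC C : (fun K => C * hnorm LE (w K)) @ \oo --> (0 : R).
  by rewrite -(mulr0 C); apply: cvgMr.
have [hf _] := fh; rewrite /= gram_samples -/p; split.
- move=> k; apply: (gram_map_summable pH cH hfn A0 AB ana_le ana_ge).
  by rewrite samples; exact: (hset_l2_analysis ana_le).
- have [C C0 hC] := remainder_L2; apply: (hcvg_le _ hf _ (wC C)) => K.
    have [h1 _] := hC K; have := ph_add pL h1 hf; congr (hset _ _).
    by apply/funext => x /=; rewrite subrK.
  by have [] := hC K.
(* The sup norm of a transform is at most twice the L_1 norm, and on a fixed cube the L_1 norm is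
   bounded by the L_2 norm. *)
- have [C C0 hC] := rho_norm; have [r r0 hr] := cube_out.
  apply: (uniform_nc_cvg _ (wC (2 * ((2 * r) ^+ d + 1) * C))) => K x.
  rewrite remainder (le_trans (fourier_le x (rho_i K)))// -!mulrA ler_pM2l//.
  apply: (@le_trans _ _ (((2 * r) ^+ d + 1) * hnorm (L2 setT) (rho K))).
    apply: Rintegral_nc_le_hnorm => // xi xr.
    by rewrite /rho G_out ?mulr0 ?mul0r//; exact: hr.
  rewrite ler_wpM2l//; first by rewrite addr_ge0// exprn_ge0// mulr_ge0.
  by have [] := hC K.
Qed.

End sampling.

Unset Implicit Arguments.
Set Strict Implicit.
Set Printing Implicit Defensive.

Theorem theorem3p1 (R : realType) (d : nat) (E : set 'rV[R]_d)
    (t : nat -> 'rV[R]_d) (lambda0 : R)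
    (G : 'rV[R]_d -> R) (g : 'rV[R]_d -> R[i]) :
  let fn := fun (n : nat) (x : 'rV[R]_d) => expi (dotv x (t n)) in
  let Sinv := frame_op_inv (L2 E) fn in
  let B := fun k n : nat => hdot (L2 E) (Sinv (fn n)) (Sinv (fn k)) in
  let Bmap := fun (y : nat -> R[i]) (k : nat) => csum (fun n => B k n * y n) in
  E 0 -> compact E ->
  (forall lambda : R, 1 < lambda -> E `<=` interior (dilate lambda E)) ->
  is_frame (L2 E) fn ->
  1 < lambda0 ->
  continuous (g : 'rV[R]_d -> R[i]^o) ->
  is_inv_fourier g (fun xi => (G xi)%:C%C) ->
  smooth G ->
  (forall xi, E xi -> G xi = 1) ->
  (forall xi, ~ dilate lambda0 E xi -> G xi = 0) ->
  (forall (lambda : R) (f : 'rV[R]_d -> R[i]), lambda0 <= lambda -> PW E f ->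
     let y := fun n => f (lambda^-1 *: t n) in
     let partial_sum := fun (K : nat) (x : 'rV[R]_d) =>
       ((lambda ^+ d)^-1)%:C%C *
       \sum_(k < K) Bmap y k * g (x - lambda^-1 *: t k) in
     [/\ forall k, summable_series (fun n => B k n * y n),
         hcvg (L2 setT) partial_sum f &
         {uniform setT, partial_sum @ \oo --> (f : 'rV[R]_d -> R[i]^o)}]) /\
  (forall y, hset (l2 R) y -> forall k, summable_series (fun n => B k n * y n)) /\
  is_bounded_linear (l2 R) Bmap /\
  (is_onto_isomorphism (l2 R) Bmap <-> is_riesz_basis (L2 E) fn).
Proof.
move=> fn Sinv B Bmap _ cE dilE hfr l01 cg gG sG G1 G0.
have [A [A' [A0 AA' hfn ana_le ana_ge]]] := is_frameP hfr.
have mE := compact_measurable_rV cE.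
have pH := L2_prehilbert mE; have cH := L2_complete mE.
split; [move=> l f ll0 [cf [h [fh hE]]]|split; [|split]].
(* The empty list of partial derivatives yields the continuity of G itself. *)
- exact: (sampling cE dilE hfn A0 AA' ana_le ana_ge l01 cg gG (proj1 (sG [::])) G1 G0 ll0 cf fh hE).
- move=> y hy k; exact: (gram_map_summable pH cH hfn A0 AA' ana_le ana_ge hy).
- exact: (gram_map_bounded_linear pH cH hfn A0 AA' ana_le ana_ge).
- exact: (gram_map_iso_riesz pH cH hfn A0 AA' ana_le ana_ge).
Qed.
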